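(* Let $n\ge 1$, let $p\in(1,+\infty]$ and let $\{\phi_s\}_{s\in\partial\mathbb{D}}$ be a measurable family of convex functions on $\mathbb{C}^n$ satisfying the $p$-uniform growth conditions. Assume additionally that $\phi_s:\mathbb{C}^n\to\mathbb{R}\cup\{+\infty\}$ is strictly convex for all $s\in\partial\mathbb{D}$. Then for any $(t_0,w_0)\in\mathbb{D}\times\mathbb{C}^n$ with $\tilde\phi(t_0,w_0)<\infty$, the function $F=F_{t_0,w_0}\in H^p(\mathbb{D},\mathbb{C}^n)$ satisfying $F(t_0)=w_0$ and $$\tilde\phi(t,F(t))=P[\phi(s,F(s))](t)\qquad(t\in\mathbb{D})$$ (which exists) is uniquely determined. Moreover, suppose that $F_{t_0,w_0}(t)=F_{t_1,w_1}(t)$ for some $t,t_0,t_1\in\mathbb{D}$ and $w_0,w_1\in\mathbb{C}^n$ with $\tilde\phi(t_0,w_0)<\infty$ and $\tilde\phi(t_1,w_1)<\infty$. Then $F_{t_0,w_0}\equiv F_{t_1,w_1}$.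
   Context: $\mathbb{D}=\{t\in\mathbb{C}:|t|<1\}$, and $\sigma$ is the rotation-invariant probability measure on $\partial\mathbb{D}$. For $h$ on $\partial\mathbb{D}$ integrable (or measurable and bounded below, with value $+\infty$ allowed), $P[h](t)=P[h(s)](t)=\int_{\partial\mathbb{D}}\frac{1-|t|^2}{|s-t|^2}h(s)\,d\sigma(s)$, $t\in\mathbb{D}$, is its Poisson integral. $H^r(\mathbb{D},\mathbb{C}^n)$ is the Hardy space of $\mathbb{C}^n$-valued holomorphic functions on $\mathbb{D}$, each identified with its radial boundary values $F(s)=\lim_{r\to1^-}F(rs)$, defined for a.e. $s\in\partial\mathbb{D}$. For $z,w\in\mathbb{C}^n$, $z\cdot w=\sum_j z_jw_j$ (no conjugation), and $|\cdot|$ is the Euclidean norm. Measurable family of convex functions: a Borel measurable function $\phi:\partial\mathbb{D}\times\mathbb{C}^n\to\mathbb{R}\cup\{+\infty\}$ such that each $\phi_s=\phi(s,\cdot)$ is convex on $\mathbb{C}^n\cong\mathbb{R}^{2n}$. A convex function $\psi:\mathbb{C}^n\to\mathbb{R}\cup\{+\infty\}$ is strictly convex if $\psi((z+w)/2)<(\psi(z)+\psi(w))/2$ for any distinct $z,w$ with $\psi(z),\psi(w)$ finite. $p$-uniform growth conditions: there are $c,C,A>0$ such that for all $s\in\partial\mathbb{D}$, $w\in\mathbb{C}^n$: if $p\in(1,\infty)$, $c|w|^p-A\le\phi_s(w)\le C|w|^p+A$; if $p=+\infty$, $\chi(c|w|)-A\le\phi_s(w)\le\chi(C|w|)+A$,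 where $\chi(x)=0$ for $x\le1$ and $\chi(x)=+\infty$ for $x>1$, and in addition each $\phi_s$ is lower semi-continuous. Fiberwise (conjugate) Legendre transform: $\phi_s^*(z)=\sup_{w\in\mathbb{C}^n}\{\mathrm{Re}(z\cdot w)-\phi(s,w)\}$. With $q=p/(p-1)\in[1,\infty)$ ($q=1$ if $p=\infty$), for $(t,w)\in\mathbb{D}\times\mathbb{C}^n$, $$\tilde\phi(t,w)=\sup_{f\in H^q(\mathbb{D},\mathbb{C}^n)}\big\{\mathrm{Re}(f(t)\cdot w)-P[\phi_s^*(f(s))](t)\big\}.$$ Existence of a function $F$ as in the claim, for every $(t_0,w_0)$ with $\tilde\phi(t_0,w_0)<\infty$, is a theorem of the paper holding without strict convexity. *)

(* Defs.v *)
(* C is R[i] over an abstract R : realType, and C^n is the space of row vectors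
   'rV[R[i]]_n. *)
From HB Require Import structures.
From mathcomp Require Import all_boot all_order all_algebra.
From mathcomp Require Import complex.
From mathcomp Require Import all_classical all_reals all_analysis.
From mathcomp Require Import measurable_realfun.

Set Implicit Arguments.
Unset Strict Implicit.
Unset Printing Implicit Defensive.

Import Order.TTheory GRing.Theory Num.Theory.
Import numFieldNormedType.Exports.

Local Open Scope classical_set_scope.
Local Open Scope ring_scope.
Local Open Scope complex_scope.

(* The topology of C given by its modulus. With this structure, [derivable]
   on functions from R[i] is complex differentiability. *)
HB.instance Definition _ (R : rcfType) := NormedModule.copy R[i] R[i]^o.

(* The modulus as a real number; the norm `|z| of R[i] is the element
   (cabs z)%:C of R[i]. *)
Definition cabs (R : realType) (z : R[i]) : R := Normc.normc z.

Definition disc (R : realType) : set R[i] := [set t | cabs t < 1].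

Definition circle (R : realType) : set R[i] := [set s | cabs s = 1].

Definition enorm (R : realType) (n : nat) (w : 'rV[R[i]]_n) : R :=
  Num.sqrt (\sum_(j < n) cabs (w 0 j) ^+ 2).

(* Bilinear: no conjugation. *)
Definition cdot (R : realType) (n : nat) (z w : 'rV[R[i]]_n) : R[i] :=
  \sum_(j < n) z 0 j * w 0 j.

Notation borel T := (g_sigma_algebraType (open : set (set T))).

Definition expi (R : realType) (x : measurableTypeR R) : borel R[i] :=
  cos x +i* sin x.

Lemma expi_continuous (R : realType) :
  continuous (fun x : R => cos x +i* sin x : R[i]).
Proof.
move=> x; apply/cvgrPdist_lt => /= e e0.
have /complex_realP[d ed] : e \is Num.real by exact: gtr0_real.
have d0 : 0 < d by move: e0; rewrite ed ltcR.
have d2 : 0 < d / 2 by rewrite divr_gt0.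
have /cvgrPdist_lt/(_ _ d2) Hc := @continuous_cos R x.
have /cvgrPdist_lt/(_ _ d2) Hs := @continuous_sin R x.
near=> y.
have hc : `|cos x - cos y| < d / 2 by near: y.
have hs : `|sin x - sin y| < d / 2 by near: y.
have -> : (cos x +i* sin x) - (cos y +i* sin y)
    = (cos x - cos y)%:C + 'i%C * (sin x - sin y)%:C :> R[i].
  by apply/eqP; rewrite eq_complex /= !(mul0r, mul1r, mulr0, addr0, subr0, add0r) !eqxx.
apply: le_lt_trans (ler_normD _ _) _.
rewrite normrM normc_def /= !normc_def /= !expr0n /= !expr1n ?addr0 ?add0r sqrtr1 mul1r.
by rewrite !sqrtr_sqr -rmorphD/= ed ltcR [d]splitr ltrD.
Unshelve. all: by end_near. Qed.

Lemma measurable_expi (R : realType) : measurable_fun setT (@expi R).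
Proof.
apply: (@measurability _ _ _ (borel R[i]) _ _ open) => //= _ [U oU <-].
rewrite setTI.
by apply: open_measurable; apply: open_comp => // x _; exact: expi_continuous.
Qed.

HB.instance Definition _ (R : realType) :=
  isMeasurableFun.Build _ _ _ _ (@expi R) (@measurable_expi R).

Lemma pi2_gt0 (R : realType) : 0 < pi *+ 2 :> R.
Proof. by rewrite mulrn_wgt0 // pi_gt0. Qed.

(* The rotation-invariant probability on the circle, as a Borel probability on
   C: the law of e^{ix} for x uniform on [0, 2 pi]. *)
Definition sigma (R : realType) : probability (borel R[i]) R :=
  distribution (uniform_prob (pi2_gt0 R))
    (@expi R).

Definition poisson (R : realType) (h : R[i] -> \bar R) (t : R[i]) : \bar R :=
  (\int[sigma R]_(s in @circle R)
     (((1 - cabs t ^+ 2) / cabs (s - t) ^+ 2)%:E * h s))%E.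

Definition holomorphic_on_disc (R : realType) (n : nat)
    (F : R[i] -> 'rV[R[i]]_n) : Prop :=
  forall (j : 'I_n) (t : R[i]), disc t -> derivable (fun z => F z 0 j) t 1.

(* The Hardy space H^r. Members are total functions, of which only the values
   on the disc are meaningful. *)
Definition hardy (R : realType) (n : nat) (r : \bar R)
    (F : R[i] -> 'rV[R[i]]_n) : Prop :=
  holomorphic_on_disc F /\
  match r with
  | r%:E => exists M : R, forall x : R, 0 <= x -> x < 1 ->
      (\int[sigma R]_(s in @circle R) (enorm (F (x%:C * s)) `^ r)%:E <= M%:E)%E
  | +oo%E => exists M : R, forall t : R[i], disc t -> enorm (F t) <= M
  | -oo%E => False
  end.

(* Radial boundary values. Where the limit does not exist, [lim] is a fixed
   default vector; for Hardy functions this happens only on a null set. *)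
Definition bdry (R : realType) (n : nat) (F : R[i] -> 'rV[R[i]]_n)
    (s : R[i]) : 'rV[R[i]]_n :=
  lim (F (x%:C * s) @[x --> (1 : R)^'-]).

Definition convex_ext (R : realType) (n : nat)
    (psi : 'rV[R[i]]_n -> \bar R) : Prop :=
  forall (z w : 'rV[R[i]]_n) (l : R), 0 < l -> l < 1 ->
    (psi (l%:C *: z + (1 - l)%:C *: w)%R
       <= l%:E * psi z + (1 - l)%R%:E * psi w)%E.

Definition strictly_convex_ext (R : realType) (n : nat)
    (psi : 'rV[R[i]]_n -> \bar R) : Prop :=
  forall z w : 'rV[R[i]]_n, z != w ->
    psi z \is a fin_num -> psi w \is a fin_num ->
    (psi (2^-1 *: (z + w))%R < (2^-1)%R%:E * (psi z + psi w))%E.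

(* A family indexed by the circle is a function phi on C x C^n of which only
   the values over the circle matter. *)
Definition measurable_convex_family (R : realType) (n : nat)
    (phi : R[i] -> 'rV[R[i]]_n -> \bar R) : Prop :=
  [/\ measurable_fun
        (@circle R `*` [set: 'rV[R[i]]_n] :
           set (borel (R[i] * 'rV[R[i]]_n)%type))
        (fun x => phi x.1 x.2),
      forall s w, circle s -> (-oo < phi s w)%E &
      forall s, circle s -> convex_ext (phi s)].

Definition chi (R : realType) (x : R) : \bar R :=
  if x <= 1 then 0%E else +oo%E.

Definition uniform_growth (R : realType) (n : nat) (p : \bar R)
    (phi : R[i] -> 'rV[R[i]]_n -> \bar R) : Prop :=
  exists c C A : R, [/\ 0 < c, 0 < C, 0 < A &
    match p with
    | p%:E => forall s w, circle s ->
        ((c * enorm w `^ p - A)%:E <= phi s w <= (C * enorm w `^ p + A)%:E)%E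
    | +oo%E =>
        (forall s w, circle s ->
          (chi (c * enorm w)%R - A%:E <= phi s w
             <= chi (C * enorm w)%R + A%:E)%E) /\
        (forall s, circle s -> lower_semicontinuous (phi s))
    | -oo%E => False
    end].

Definition legendre (R : realType) (n : nat)
    (phi : R[i] -> 'rV[R[i]]_n -> \bar R) (s : R[i]) (z : 'rV[R[i]]_n) :
    \bar R :=
  ereal_sup [set ((complex.Re (cdot z w))%:E - phi s w)%E | w in setT].

(* The function written phi with a tilde; q is the exponent conjugate to p. *)
Definition phi_tilde (R : realType) (n : nat) (p : \bar R)
    (phi : R[i] -> 'rV[R[i]]_n -> \bar R) (t : R[i]) (w : 'rV[R[i]]_n) :
    \bar R :=
  let q := hoelder_conjugate p in
  ereal_sup [set ((complex.Re (cdot (f t) w))%:E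
                   - poisson (fun s => legendre phi s (bdry f s)) t)%E
            | f in [set f : R[i] -> 'rV[R[i]]_n | hardy q f]].

(* F has the properties that define F_{t0,w0}. *)
Definition extremal (R : realType) (n : nat) (p : \bar R)
    (phi : R[i] -> 'rV[R[i]]_n -> \bar R) (t0 : R[i]) (w0 : 'rV[R[i]]_n)
    (F : R[i] -> 'rV[R[i]]_n) : Prop :=
  [/\ hardy p F,
      F t0 = w0 &
      forall t, disc t ->
        phi_tilde p phi t (F t) = poisson (fun s => phi s (bdry F s)) t].

(* Main.v *)
From HB Require Import structures.
Require Import Defs.
From mathcomp Require Import all_boot all_order all_algebra.
From mathcomp Require Import complex.
From mathcomp Require Import all_classical all_reals all_analysis.
From mathcomp Require Import measurable_realfun.
From mathcomp Require Import ring lra.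

(** Suppose that the extremal functions F and G take the same value w at t, and
put H = (F + G) / 2 on the circle.  Young's inequality makes f . F and f . G
functions of class H^1 for every competitor f in H^q, so both are the Poisson
integrals of their boundary values.  Integrating Fenchel's inequality
phi_s^*(f) >= Re (f . H) - phi_s(H) therefore bounds every term of the supremum
that defines phi~(t, w), and
  phi~(t, w) <= P[phi_s(H)](t)                           ([phi_tilde_le]).
The left side is P[phi_s(F)](t) and also P[phi_s(G)](t), and convexity gives
phi_s(H) <= (phi_s(F) + phi_s(G)) / 2 for every s.  Hence equality holds for
almost every s ([midpoint_eq_ae]), strict convexity gives F = G almost
everywhere on the circle, and the Poisson representation gives F = G on the disc
([extremal_eq_of_meet]).  The first claim is the case t = t0.

Nothing is known about the measurability of phi_s^* along f.  The Lebesgue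
integral of a function that need not be measurable is still monotone up to null
sets ([integral_le_ae]), and this is all that the Fenchel step asks of it.
phi_s(F(s)), on the other hand, has to be measurable, which holds off a null set
because s |-> (s, F(s)) is a limit of the continuous maps s |-> (s, F(r s))
([measurable_family_boundary]).

The analytic input is the theorem of Fatou and Riesz for scalar H^1
([hardy1_boundary]): such a g has radial limits almost everywhere, and is the
Poisson integral of them.  Goursat's theorem on rectangles, pulled through the
exponential, shows that circle means of holomorphic functions are constant on
annuli; this gives the mean value property, the Poisson formula and the maximum
principle.  For g holomorphic on the closed disc, the identity
  mean |g_r - g_s|^2 = mean |g_r|^2 + mean |g_s|^2 - 2 mean |g_sqrt(rs)|^2
replaces Fourier series in H^2 ([mean2_dist]).  It is carried to H^1 by a
factorization f = E K with E free of zeros and |E|^2 slightly above |f| on the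
circle ([outer_factor]): E is the exponential of a polynomial whose real part
approximates log (|f| + delta) / 2, so that the zeros of f stay in K and no Blaschke
product is needed.  Both factors are bounded in H^2 by about the mean of |f|, and
the Cauchy-Schwarz inequality yields an estimate of mean |f_r - f| by the
increase of the means of |f| ([mean1_dist]).  So the dilates of an H^1 function
are Cauchy in L^1 and their limit represents the function; radial limits follow
at Lebesgue points, where the Poisson kernel is an approximate identity
([poisson_radial_cvg]). *)

Set Implicit Arguments.
Unset Strict Implicit.
Unset Printing Implicit Defensive.

Import Order.TTheory GRing.Theory Num.Theory.
Import numFieldNormedType.Exports.

Local Notation Re := complex.Re.
Local Notation Im := complex.Im.

Local Open Scope classical_set_scope.
Local Open Scope ring_scope.
Local Open Scope complex_scope.

(** * Modulus and limits in the complex plane *)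

Lemma cvg_continuous_at {T : Type} {V U : topologicalType} (F : set_system T)
    {FF : Filter F} (f : T -> V) (h : V -> U) (a : V) :
  f @ F --> a -> {for a, continuous h} -> (fun x => h (f x)) @ F --> h a.
Proof. by move=> fa ha; exact: (@continuous_cvg _ _ _ F FF f h a ha fa). Qed.

Section ComplexModulus.
Context {R : realType}.
Implicit Types z w : R[i].

(** Makes the limit lemmas below applicable to limits at a point of the plane. *)
#[global] Instance nbhsc_filter z : Filter (nbhs z).
Proof. exact: nbhs_filter. Qed.

Lemma cabsE z : `|z| = (cabs z)%:C.
Proof. by []. Qed.

Lemma cabs_ge0 z : 0 <= cabs z.
Proof. by case: z => a b /=; exact: sqrtr_ge0. Qed.

Lemma cabsM z w : cabs (z * w) = cabs z * cabs w.
Proof. exact: Normc.normcM. Qed.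

Lemma cabsV z : cabs z^-1 = (cabs z)^-1.
Proof. exact: Normc.normcV. Qed.

Lemma cabsN z : cabs (- z) = cabs z.
Proof. exact: normcN. Qed.

Lemma cabsD z w : cabs (z + w) <= cabs z + cabs w.
Proof. exact: le_normcD. Qed.

Lemma cabsB z w : cabs (z - w) = cabs (w - z).
Proof. by rewrite -cabsN opprB. Qed.

Lemma cabs0 : cabs (0 : R[i]) = 0.
Proof. exact: Normc.normc0. Qed.

Lemma cabs1 : cabs (1 : R[i]) = 1.
Proof. exact: Normc.normc1. Qed.

Lemma cabs_eq0 z : (cabs z == 0) = (z == 0).
Proof. by apply/eqP/eqP => [/Normc.eq0_normc//|->]; exact: cabs0. Qed.

Lemma cabs_gt0 z : (0 < cabs z) = (z != 0).
Proof. by rewrite lt_def cabs_eq0 cabs_ge0 andbT. Qed.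

Lemma cabsR (x : R) : cabs x%:C = `|x|.
Proof. by rewrite /cabs /= expr0n addr0 sqrtr_sqr. Qed.

Lemma cabsX z n : cabs (z ^+ n) = cabs z ^+ n.
Proof. by elim: n => [|n IH]; rewrite ?expr0 ?cabs1// !exprS cabsM IH. Qed.

Lemma cabsJ z : cabs (conjc z) = cabs z.
Proof. by case: z => a b; rewrite /cabs/= sqrrN. Qed.

Lemma sqr_cabs z : cabs z ^+ 2 = Re z ^+ 2 + Im z ^+ 2.
Proof. by case: z => a b; rewrite /cabs/= sqr_sqrtr// addr_ge0 ?sqr_ge0. Qed.

Lemma Re_le_cabs z : `|Re z| <= cabs z.
Proof. by rewrite -ler_sqr ?nnegrE ?cabs_ge0// real_normK ?num_real// sqr_cabs lerDl sqr_ge0. Qed.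

Lemma Im_le_cabs z : `|Im z| <= cabs z.
Proof. by rewrite -ler_sqr ?nnegrE ?cabs_ge0// real_normK ?num_real// sqr_cabs lerDr sqr_ge0. Qed.

Lemma cabs_le_ReIm z : cabs z <= `|Re z| + `|Im z|.
Proof.
rewrite -ler_sqr ?nnegrE ?cabs_ge0 ?addr_ge0// sqrrD !real_normK ?num_real// sqr_cabs.
have := mulr_ge0 (normr_ge0 (Re z)) (normr_ge0 (Im z)).
by lra.
Qed.

Lemma mulcJ z : z * conjc z = (cabs z ^+ 2)%:C.
Proof. by rewrite sqr_cabs; case: z => a b; apply/eqP; rewrite eq_complex /=; apply/andP; split; apply/eqP; ring. Qed.

Lemma cvgcP T (F : set_system T) (FF : Filter F) (f : T -> R[i]) (l : R[i]) :
  f @ F --> l <-> forall e : R, 0 < e -> \forall x \near F, cabs (l - f x) < e.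
Proof.
split.
  move=> /cvgrPdist_lt h e e0; have e0' : 0 < e%:C :> R[i] by rewrite ltcR.
  by have := h _ e0'; apply: filterS => x; rewrite cabsE ltcR.
move=> h; apply/cvgrPdist_lt => e e0.
have /complex_realP[d ed] : e \is Num.real by exact: gtr0_real.
have d0 : 0 < d by move: e0; rewrite ed ltcR.
by have := h _ d0; apply: filterS => x; rewrite ed cabsE ltcR.
Qed.

Lemma nbhscP z (P : set R[i]) :
  nbhs z P <-> exists2 e : R, 0 < e & forall w, cabs (z - w) < e -> P w.
Proof.
split.
  move=> /nbhs_ballP[e /= e0 zeP].
  have /complex_realP[d ed] : e \is Num.real by exact: gtr0_real.
  exists d; first by move: e0; rewrite ed ltcR.
  by move=> w zw; apply: zeP; rewrite -ball_normE /= ed cabsE ltcR.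
move=> [e e0 h]; apply/nbhs_ballP; exists e%:C; first by rewrite /= ltcR.
by move=> w; rewrite -ball_normE /= cabsE ltcR; exact: h.
Qed.

Lemma continuouscP (f : R[i] -> R[i]) z : {for z, continuous f} <->
  forall e : R, 0 < e -> exists2 d : R, 0 < d &
    forall w, cabs (w - z) < d -> cabs (f w - f z) < e.
Proof.
split.
  move=> /(@cvgcP _ _ (nbhs_filter z)) h e e0; have /nbhscP[d d0 hd] := h _ e0.
  by exists d => // w wz; rewrite cabsB; apply: hd; rewrite cabsB.
move=> h; apply/(@cvgcP _ _ (nbhs_filter z)) => e e0; have [d d0 hd] := h _ e0.
by apply/nbhscP; exists d => // w wz; rewrite cabsB; apply: hd; rewrite cabsB.
Qed.

Lemma Re_continuous : continuous (@Re R).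
Proof.
move=> z; apply/cvgrPdist_lt => e e0; apply/nbhscP; exists e => // w.
by apply: le_lt_trans; rewrite -raddfB; exact: Re_le_cabs.
Qed.

Lemma Im_continuous : continuous (@Im R).
Proof.
move=> z; apply/cvgrPdist_lt => e e0; apply/nbhscP; exists e => // w.
by apply: le_lt_trans; rewrite -raddfB; exact: Im_le_cabs.
Qed.

Lemma cabs_dist z w : `|cabs z - cabs w| <= cabs (z - w).
Proof.
have h (u v : R[i]) : cabs u <= cabs v + cabs (u - v).
  by have := cabsD (u - v) v; rewrite subrK [leRHS]addrC.
have h1 := h z w; have h2 := h w z; rewrite cabsB in h2.
by rewrite ler_norml; apply/andP; split; lra.
Qed.

Lemma cabs_continuous : continuous (@cabs R).
Proof.
move=> z; apply/cvgrPdist_lt => e e0; apply/nbhscP; exists e => // w.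
by apply: le_lt_trans; exact: cabs_dist.
Qed.

Lemma conjc_continuous : continuous (@conjc R).
Proof.
move=> z; apply/cvgcP => e e0; apply/nbhscP; exists e => // w.
by rewrite -rmorphB cabsJ.
Qed.

Lemma RtoC_continuous : continuous (fun x : R => x%:C : R[i]).
Proof.
move=> x; apply/cvgcP => e e0; near=> y.
by rewrite -rmorphB cabsR; near: y; apply: cvgr_dist_lt.
Unshelve. all: by end_near. Qed.

Section ComplexLimits.
Context {T : Type} (F : set_system T) {FF : Filter F}.
Implicit Types (f g : T -> R[i]) (a b : R[i]).

Lemma cvgcD f g a b : f @ F --> a -> g @ F --> b ->
  (fun x => f x + g x) @ F --> a + b.
Proof. exact: (@cvgD _ _ _ F FF f g). Qed.

Lemma cvgcM f g a b : f @ F --> a -> g @ F --> b ->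
  (fun x => f x * g x) @ F --> a * b.
Proof. exact: (@cvgM _ _ F FF f g). Qed.

Lemma cvgcN f a : f @ F --> a -> (fun x => - f x) @ F --> - a.
Proof. exact: (@cvgN _ _ _ F FF f). Qed.

Lemma cvgcB f g a b : f @ F --> a -> g @ F --> b ->
  (fun x => f x - g x) @ F --> a - b.
Proof. by move=> fa /cvgcN; exact: cvgcD. Qed.

Lemma cvgcV f a : a != 0 -> f @ F --> a -> (fun x => (f x)^-1) @ F --> a^-1.
Proof. exact: (@cvgV _ _ F FF f). Qed.

Lemma cvgc_cst a : (fun=> a) @ F --> a.
Proof. exact: cvg_cst. Qed.

Lemma cvgc_sum (I : Type) (s : seq I) (f : I -> T -> R[i]) (a : I -> R[i]) :
  (forall i, f i @ F --> a i) ->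
  (fun x => \sum_(i <- s) f i x) @ F --> \sum_(i <- s) a i.
Proof.
move=> h; elim: s => [|i s IH].
  by rewrite big_nil (_ : (fun=> _) = fun=> 0); [exact: cvgc_cst|apply/funext => x; rewrite big_nil].
rewrite big_cons (_ : (fun x => _) = fun x => f i x + \sum_(j <- s) f j x).
  exact: (cvgcD (h i) IH).
by apply/funext => x; rewrite big_cons.
Qed.

End ComplexLimits.

Lemma contc_cst (a z : R[i]) : {for z, continuous (fun=> a : R[i])}.
Proof. exact: cvgc_cst. Qed.

Lemma contc_id (z : R[i]) : {for z, continuous (fun w : R[i] => w)}.
Proof. by []. Qed.

Lemma continuous_Re (T : topologicalType) (f : T -> R[i]) (x : T) :
  {for x, continuous f} -> {for x, continuous (fun x => Re (f x))}.
Proof. by move=> cf; exact: (cvg_continuous_at cf (@Re_continuous (f x))). Qed.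

Lemma continuous_cabs (T : topologicalType) (f : T -> R[i]) (x : T) :
  {for x, continuous f} -> {for x, continuous (fun x => cabs (f x))}.
Proof. by move=> cf; exact: (cvg_continuous_at cf (@cabs_continuous (f x))). Qed.

End ComplexModulus.

Arguments cvgc_cst {R T} F {FF} a.
Arguments contc_cst {R} a z.
Arguments contc_id {R} z.

(** * Complex differentiability *)

Section ComplexDifferentiable.
Context {R : realType}.
Implicit Types (f g : R[i] -> R[i]) (z w : R[i]).

(** Caratheodory's form of differentiability: the difference quotient extends
continuously.  Products, compositions and inverses then need no estimates, and
the extended quotient itself is the function used in the Poisson formula. *)
Definition cdiff f z :=
  exists2 Phi : R[i] -> R[i], {for z, continuous Phi} &
    forall w, f w - f z = Phi w * (w - z).

Lemma cdiffP f z : cdiff f z <->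
  exists d, forall e : R, 0 < e -> exists2 r : R, 0 < r &
    forall w, cabs (w - z) < r ->
      cabs (f w - f z - d * (w - z)) <= e * cabs (w - z).
Proof.
split.
  move=> [Phi /continuouscP cPhi fE]; exists (Phi z) => e /cPhi[r r0 hr].
  exists r => // w wz; rewrite fE -mulrBl cabsM ler_wpM2r ?cabs_ge0//.
  exact/ltW/hr.
move=> [d hd].
exists (fun w => if w == z then d else (f w - f z) / (w - z)); last first.
  move=> w; case: ifPn => [/eqP ->|wz]; first by rewrite !subrr mulr0.
  by rewrite divfK // subr_eq0.
apply/continuouscP => e e0; have [|r r0 hr] := hd (e / 2); first by rewrite divr_gt0.
exists r => // w wz; rewrite eqxx; case: ifPn => [_|nwz].
  by rewrite subrr cabs0.
have wz0 : 0 < cabs (w - z) by rewrite cabs_gt0 subr_eq0.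
rewrite -(ltr_pM2r wz0) -cabsM mulrBl divfK ?subr_eq0//.
apply: (le_lt_trans (hr _ wz)).
by rewrite ltr_pM2r// ltr_pdivrMr// ltr_pMr// ltr1n.
Qed.

Lemma cdiff_near f g z (r : R) : 0 < r ->
  (forall w, cabs (w - z) < r -> f w = g w) -> cdiff f z -> cdiff g z.
Proof.
move=> r0 fg /cdiffP[d hd]; apply/cdiffP; exists d => e /hd[r' r'0 hr'].
exists (Num.min r r'); first by rewrite lt_min r0.
move=> w; rewrite lt_min => /andP[wr wr'].
by rewrite -!fg ?subrr ?cabs0//; exact: hr'.
Qed.

Lemma derivable_cdiff f z : derivable f z 1 -> cdiff f z.
Proof.
move=> /cvg_ex[/= d hd]; apply/cdiffP; exists d => e e0.
have /fcvgrPdist_lt/(_ e%:C) := hd; rewrite ltcR => /(_ e0).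
move=> /nbhs_ballP[r /= r0 hr].
have /complex_realP[r' r'E] : r \is Num.real by exact: gtr0_real.
have r'0 : 0 < r' by move: r0; rewrite r'E ltcR.
exists r' => // w wz; have [->|nwz] := eqVneq w z.
  by rewrite !subrr mulr0 subrr cabs0 mulr0.
have wz0 : w - z != 0 by rewrite subr_eq0.
have := hr (w - z); rewrite -ball_normE /= sub0r normrN cabsE r'E ltcR => /(_ wz wz0).
rewrite cabsE ltcR /GRing.scale /= mulr1 subrK => /ltW h.
have -> : f w - f z - d * (w - z) = - ((d - (w - z)^-1 * (f w - f z)) * (w - z)).
  by rewrite mulrBl mulrAC mulVf// mul1r opprB.
by rewrite cabsN cabsM ler_wpM2r ?cabs_ge0.
Qed.

Lemma cdiff_continuous f z : cdiff f z -> {for z, continuous f}.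
Proof.
move=> [Phi cPhi fE].
have -> : f = (fun w => f z + Phi w * (w - z)).
  by apply/funext => w; rewrite -fE addrC subrK.
exact: (cvgcD (@contc_cst R (f z) z) (cvgcM cPhi (cvgcB (@contc_id R z) (@contc_cst R z z)))).
Qed.

Lemma cdiff_cst c z : cdiff (fun=> c) z.
Proof. by exists (fun=> 0) => [|w]; [exact: contc_cst|rewrite subrr mul0r]. Qed.

Lemma cdiff_id z : cdiff id z.
Proof. by exists (fun=> 1) => [|w]; [exact: contc_cst|rewrite mul1r]. Qed.

Lemma cdiffD f g z : cdiff f z -> cdiff g z -> cdiff (fun w => f w + g w) z.
Proof.
move=> [P cP fE] [Q cQ gE]; exists (fun w => P w + Q w).
  exact: (cvgcD cP cQ).
by move=> w; rewrite mulrDl -fE -gE; ring.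
Qed.

Lemma cdiffM f g z : cdiff f z -> cdiff g z -> cdiff (fun w => f w * g w) z.
Proof.
move=> df [Q cQ gE]; have cf := cdiff_continuous df; case: df => [P cP fE].
exists (fun w => P w * g z + f w * Q w).
  exact: (cvgcD (cvgcM cP (@contc_cst R (g z) z)) (cvgcM cf cQ)).
by move=> w; rewrite mulrDl mulrAC -fE -mulrA -gE; ring.
Qed.

Lemma cdiff_scale c z : cdiff (fun w => c * w) z.
Proof. by apply: cdiffM; [exact: cdiff_cst|exact: cdiff_id]. Qed.

Lemma cdiffN f z : cdiff f z -> cdiff (fun w => - f w) z.
Proof.
move=> [P cP fE]; exists (fun w => - P w); first exact: (cvgcN cP).
by move=> w; rewrite mulNr -fE; ring.
Qed.

Lemma cdiffB f g z : cdiff f z -> cdiff g z -> cdiff (fun w => f w - g w) z.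
Proof. by move=> df dg; exact: (cdiffD df (cdiffN dg)). Qed.

Lemma cdiffX f z n : cdiff f z -> cdiff (fun w => f w ^+ n) z.
Proof.
move=> df; elim: n => [|n IH].
  by rewrite (_ : (fun=> _) = fun=> 1) //; exact: cdiff_cst.
rewrite (_ : (fun w => f w ^+ n.+1) = fun w => f w * f w ^+ n); first exact: cdiffM.
by apply/funext => w; rewrite exprS.
Qed.

Lemma cdiff_sum (I : Type) (s : seq I) (F : I -> R[i] -> R[i]) z :
  (forall i, cdiff (F i) z) -> cdiff (fun w => \sum_(i <- s) F i w) z.
Proof.
move=> dF; elim: s => [|a s IH].
  rewrite (_ : (fun=> _) = fun=> 0); first exact: cdiff_cst.
  by apply/funext => w; rewrite big_nil.
rewrite (_ : (fun w => _) = fun w => F a w + \sum_(i <- s) F i w).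
  exact: cdiffD.
by apply/funext => w; rewrite big_cons.
Qed.

Lemma cdiff_comp f g z : cdiff g z -> cdiff f (g z) -> cdiff (fun w => f (g w)) z.
Proof.
move=> dg; have cg := cdiff_continuous dg; case: dg => [Q cQ gE] [P cP fE].
exists (fun w => P (g w) * Q w); last by move=> w; rewrite fE gE mulrA.
exact: (cvgcM (continuous_comp cg cP) cQ).
Qed.

Lemma cdiffV z : z != 0 -> cdiff (fun w => w^-1) z.
Proof.
move=> z0.
apply: (@cdiff_near (fun w => z^-1 - (w * z)^-1 * (w - z)) _ _ (cabs z)).
- by rewrite cabs_gt0.
- move=> w wz; have w0 : w != 0.
    by apply: contraTneq wz => ->; rewrite sub0r cabsN ltxx.
  by field; rewrite w0 z0.
- exists (fun w => - (w * z)^-1); last by move=> w; rewrite subrr mulr0 subr0; ring.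
  have zz0 : z * z != 0 by rewrite mulf_neq0.
  exact: (cvgcN (cvgcV zz0 (cvgcM (@contc_id R z) (@contc_cst R z z)))).
Qed.

Lemma cdiff_inv f z : cdiff f z -> f z != 0 -> cdiff (fun w => (f w)^-1) z.
Proof. by move=> df fz; apply: (@cdiff_comp (fun w => w^-1)) => //; exact: cdiffV. Qed.

Lemma cdiff_conj f z : cdiff f (conjc z) -> cdiff (fun w => conjc (f (conjc w))) z.
Proof.
move=> [P cP fE]; exists (fun w => conjc (P (conjc w))).
  apply/continuouscP => e e0; have /continuouscP/(_ e e0)[d d0 hd] := cP.
  by exists d => // w wz; rewrite -rmorphB cabsJ; apply: hd; rewrite -rmorphB cabsJ.
by move=> w; rewrite -rmorphB fE rmorphM rmorphB /= !conjcK.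
Qed.

End ComplexDifferentiable.

(** * Integrals over intervals *)

Section IntervalIntegral.
Context {R : realType}.
Implicit Types (f g : R -> R) (a b c k e : R).

Definition itg a b f :=
  (@lebesgue_measure R).-integrable `[a, b] (EFin \o f).

Definition Rint a b f : R := \int[@lebesgue_measure R]_(x in `[a, b]) f x.

Lemma itg_cont a b f : {in `[a, b], forall x, {for x, continuous f}} -> itg a b f.
Proof.
move=> cf; apply: continuous_compact_integrable; first exact: segment_compact.
by apply: continuous_in_subspaceT => x; rewrite inE/=; exact: cf.
Qed.

Lemma itg_cst a b k : itg a b (fun=> k).
Proof. by apply: itg_cont => x _; exact: cvg_cst. Qed.

Lemma itgD a b f g : itg a b f -> itg a b g -> itg a b (fun x => f x + g x).
Proof. by move=> h1 h2; exact: (integrableD _ h1 h2). Qed.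

Lemma itgZ a b k f : itg a b f -> itg a b (fun x => k * f x).
Proof. by move=> h; exact: (integrableZl _ k h). Qed.

Lemma itgN a b f : itg a b f -> itg a b (fun x => - f x).
Proof. by move=> h; exact: (integrableN h). Qed.

Lemma itgB a b f g : itg a b f -> itg a b g -> itg a b (fun x => f x - g x).
Proof. by move=> ? ?; apply: itgD => //; exact: itgN. Qed.

Lemma RintD a b f g : itg a b f -> itg a b g ->
  Rint a b (fun x => f x + g x) = Rint a b f + Rint a b g.
Proof. by move=> ? ?; exact: RintegralD. Qed.

Lemma RintB a b f g : itg a b f -> itg a b g ->
  Rint a b (fun x => f x - g x) = Rint a b f - Rint a b g.
Proof. by move=> ? ?; exact: RintegralB. Qed.

Lemma RintZ a b k f : itg a b f -> Rint a b (fun x => k * f x) = k * Rint a b f.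
Proof. by move=> ?; exact: RintegralZl. Qed.

Lemma Rint_cst a b k : a <= b -> Rint a b (fun=> k) = k * (b - a).
Proof.
move=> ab; rewrite /Rint Rintegral_cst//; congr (_ * _).
have /= -> := @lebesgue_measure_itv R `[a, b]; rewrite lte_fin.
by move: ab; rewrite le_eqVlt => /predU1P[->|->//]; rewrite ltxx subrr.
Qed.

Lemma le_Rint a b f g : itg a b f -> itg a b g ->
  (forall x, a <= x <= b -> f x <= g x) -> Rint a b f <= Rint a b g.
Proof. by move=> ? ? fg; apply: le_Rintegral => // x /=; rewrite in_itv/=; exact: fg. Qed.

Lemma eq_Rint a b f g : (forall x, a <= x <= b -> f x = g x) -> Rint a b f = Rint a b g.
Proof. by move=> fg; apply: eq_Rintegral => x; rewrite inE/= in_itv/=; exact: fg. Qed.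

Lemma Rint_ge0 a b f : (forall x, a <= x <= b -> 0 <= f x) -> 0 <= Rint a b f.
Proof. by move=> f0; apply: Rintegral_ge0 => x /=; rewrite in_itv/=; exact: f0. Qed.

Lemma itg_norm a b f : itg a b f -> itg a b (fun x => `|f x|).
Proof. by move=> h; exact: (integrable_norm h). Qed.

Lemma le_norm_Rint a b f : itg a b f -> `|Rint a b f| <= Rint a b (fun x => `|f x|).
Proof. by move=> ?; exact: le_normr_Rintegral. Qed.

Lemma Rint_near_cst a b f k e : a <= b -> itg a b f ->
  (forall x, a <= x <= b -> `|f x - k| <= e) ->
  `|Rint a b f - k * (b - a)| <= e * (b - a).
Proof.
move=> ab intf h; rewrite -[k * _]Rint_cst// -RintB//; last exact: itg_cst.
apply: (le_trans (le_norm_Rint _)); first by apply: itgB => //; exact: itg_cst.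
rewrite -(Rint_cst e ab); apply: le_Rint => //; last exact: itg_cst.
by apply: itg_norm; apply: itgB => //; exact: itg_cst.
Qed.

Lemma Rint_split a b c f : a <= c -> c <= b -> itg a b f ->
  Rint a b f = Rint a c f + Rint c b f.
Proof.
move=> ac cb intf; apply/eqP; rewrite addrC -subr_eq; apply/eqP.
rewrite /Rint Rintegral_itvB// ?bnd_simp//.
apply: Rintegral_itv_obnd_cbnd; apply: integrableS intf => //.
by move=> x /=; rewrite !in_itv/= => /andP[cx ->]; rewrite (le_trans ac (ltW cx)).
Qed.

End IntervalIntegral.

Section NestedIntervals.
Context {R : realType}.

Lemma nested_point (a w : nat -> R) :
  (forall k, 0 <= w k) -> (forall k, a k <= a k.+1) ->
  (forall k, a k.+1 + w k.+1 <= a k + w k) ->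
  exists l, forall k, a k <= l <= a k + w k.
Proof.
move=> w0 aS bS.
have mono j k : a j <= a (j + k)%N.
  by elim: k => [|k IH]; rewrite ?addn0// addnS (le_trans IH).
have anti j k : a (j + k)%N + w (j + k)%N <= a j + w j.
  by elim: k => [|k IH]; rewrite ?addn0// addnS (le_trans _ IH).
have ub j k : a j <= a k + w k.
  apply: (le_trans (mono j k)); rewrite addnC.
  by apply: (le_trans _ (anti k j)); rewrite lerDl.
have ubk k : ubound (range a) (a k + w k) by move=> _ [j _ <-].
exists (sup (range a)) => k; apply/andP; split.
  by apply: ub_le_sup; [exists (a 0%N + w 0%N); exact: ubk|exists k].
by apply: ge_sup; [exists (a 0%N), 0%N|exact: ubk].
Qed.

End NestedIntervals.

(** * Goursat's theorem *)

Section AdditiveRectangleFunctions.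
Context {R : realType}.
Variables (B : R -> R -> R -> R -> R) (a0 b0 c0 d0 : R).
Hypotheses (ab0 : a0 <= b0) (cd0 : c0 <= d0).
Hypothesis B_split_l : forall a m b c d, a0 <= a -> a <= m -> m <= b -> b <= b0 ->
  c0 <= c -> c <= d -> d <= d0 -> B a b c d = B a m c d + B m b c d.
Hypothesis B_split_r : forall a b c m d, a0 <= a -> a <= b -> b <= b0 ->
  c0 <= c -> c <= m -> m <= d -> d <= d0 -> B a b c d = B a b c m + B a b m d.
Hypothesis B_small : forall u v, a0 <= u <= b0 -> c0 <= v <= d0 ->
  forall e, 0 < e -> exists2 r, 0 < r & forall a b c d,
    a0 <= a -> a <= u <= b -> b <= b0 -> c0 <= c -> c <= v <= d -> d <= d0 ->
    b - a < r -> d - c < r ->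
    `|B a b c d| <= e * (b - a + (d - c)) ^+ 2.

Let W k : R := (b0 - a0) / 2 ^+ k.
Let H k : R := (d0 - c0) / 2 ^+ k.
Let Bk k (p : R * R) := B p.1 (p.1 + W k) p.2 (p.2 + H k).

Let WS k : W k = W k.+1 + W k.+1.
Proof. by rewrite /W exprS invfM; field; rewrite expf_neq0. Qed.

Let HS k : H k = H k.+1 + H k.+1.
Proof. by rewrite /H exprS invfM; field; rewrite expf_neq0. Qed.

Let W_ge0 k : 0 <= W k.
Proof. by rewrite /W divr_ge0 ?exprn_ge0// subr_ge0. Qed.

Let H_ge0 k : 0 <= H k.
Proof. by rewrite /H divr_ge0 ?exprn_ge0// subr_ge0. Qed.

Let inside k (p : R * R) :=
  [/\ a0 <= p.1, p.1 + W k <= b0, c0 <= p.2 & p.2 + H k <= d0].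

(* By additivity some quarter carries at least a quarter of the value of B. *)
Let quarters k (p : R * R) : seq (R * R) :=
  [:: p; (p.1 + W k.+1, p.2); (p.1, p.2 + H k.+1); (p.1 + W k.+1, p.2 + H k.+1)].

Let next_quarter k p : inside k p ->
  exists q, [/\ inside k.+1 q, q \in quarters k p & `|Bk k p| <= 4 * `|Bk k.+1 q|].
Proof.
move=> [pa pb pc pd]; have [w0 h0] := (W_ge0 k.+1, H_ge0 k.+1).
have [w2 h2] := (WS k, HS k).
have e : Bk k p = \sum_(q <- quarters k p) Bk k.+1 q.
  rewrite /quarters !big_cons big_nil addr0 /Bk /=.
  rewrite (B_split_l (m := p.1 + W k.+1)); try lra.
  rewrite (B_split_r (a := p.1) (m := p.2 + H k.+1)); try lra.
  rewrite (B_split_r (a := p.1 + _) (m := p.2 + H k.+1)); try lra.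
  by rewrite -!addrA -w2 -h2; lra.
have ins q : q \in quarters k p -> inside k.+1 q.
  by rewrite !inE => /or4P[] /eqP -> /=; split => /=; lra.
apply/not_existsP => no.
have {}no q : q \in quarters k p -> 4 * `|Bk k.+1 q| < `|Bk k p|.
  by move=> qin; rewrite ltNge; apply/negP => le4; apply: (no q); split => //; exact: ins.
have := ler_norm_sum (quarters k p) (Bk k.+1) xpredT; rewrite -e.
have [n1 n2 n3 n4] : [/\ 4 * `|Bk k.+1 p| < `|Bk k p|,
   4 * `|Bk k.+1 (p.1 + W k.+1, p.2)| < `|Bk k p|,
   4 * `|Bk k.+1 (p.1, p.2 + H k.+1)| < `|Bk k p| &
   4 * `|Bk k.+1 (p.1 + W k.+1, p.2 + H k.+1)| < `|Bk k p|].
  by split; apply: no; rewrite !inE eqxx ?orbT.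
by rewrite /quarters !big_cons big_nil => ?; lra.
Qed.

(** Bisection: a quarter with at least a quarter of the value, chosen again and
again, shrinks to a point near which B is negligible compared with the square of the size.
Additivity and this smallness are what Goursat's argument uses of a contour integral. *)
Lemma additive_rectangle_eq0 : B a0 b0 c0 d0 = 0.
Proof.
have W0 : W 0 = b0 - a0 by rewrite /W expr0 divr1.
have H0 : H 0 = d0 - c0 by rewrite /H expr0 divr1.
have in0 : inside 0 (a0, c0) by split; rewrite /= ?W0 ?H0; lra.
pose T := {kp : nat * (R * R) | inside kp.1 kp.2}.
have step (x : T) : exists y : T,
    [/\ (sval y).1 = (sval x).1.+1, (sval y).2 \in quarters (sval x).1 (sval x).2 &
      `|Bk (sval x).1 (sval x).2| <= 4 * `|Bk (sval x).1.+1 (sval y).2|].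
  case: x => -[k p] /= ip; have [q [iq qq Bq]] := next_quarter ip.
  by exists (exist _ (k.+1, q) iq).
have [s [s0 sS]] := dependent_choice (fun x => cid (step x)) (exist _ (0%N, (a0, c0)) in0).
have idx k : (sval (s k)).1 = k.
  by elim: k => [|k IH]; [rewrite s0|have [-> _ _] := sS k; rewrite IH].
pose p k := (sval (s k)).2.
have insp k : inside k (p k) by have := svalP (s k); rewrite /= -/(p k) idx.
have pS k : p k.+1 \in quarters k (p k) by have [_ + _] := sS k; rewrite idx.
have BS k : `|Bk k (p k)| <= 4 * `|Bk k.+1 (p k.+1)| by have [_ _] := sS k; rewrite idx.
have p0 : p 0%N = (a0, c0) by rewrite /p s0.
have [u hu] : exists u, forall k, (p k).1 <= u <= (p k).1 + W k.
  apply: nested_point => // k; have := W_ge0 k.+1; have := WS k; have := pS k; rewrite !inE.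
    by move=> /or4P[] /eqP -> /=; lra.
  by move=> /or4P[] /eqP -> /=; lra.
have [v hv] : exists v, forall k, (p k).2 <= v <= (p k).2 + H k.
  apply: nested_point => // k; have := H_ge0 k.+1; have := HS k; have := pS k; rewrite !inE.
    by move=> /or4P[] /eqP -> /=; lra.
  by move=> /or4P[] /eqP -> /=; lra.
have BSn k : `|B a0 b0 c0 d0| <= 4 ^+ k * `|Bk k (p k)|.
  elim: k => [|k IH].
    by rewrite expr0 mul1r /Bk p0 /= W0 H0 ![_ + (_ - _)]addrC !subrK.
  by rewrite exprSr -mulrA (le_trans IH)// ler_wpM2l// exprn_ge0.
have u0 : a0 <= u <= b0 by have := hu 0%N; rewrite p0 W0 /= => /andP[-> h] /=; lra.
have v0 : c0 <= v <= d0 by have := hv 0%N; rewrite p0 H0 /= => /andP[-> h] /=; lra.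
pose S := b0 - a0 + (d0 - c0).
have S0 : 0 <= S by rewrite /S; lra.
suff small e : 0 < e -> `|B a0 b0 c0 d0| <= e * S ^+ 2.
  apply/normr0_eq0/le_anti; rewrite normr_ge0 andbT.
  apply/ler_addgt0Pr => e e0; rewrite add0r.
  have S2 : 0 < S ^+ 2 + 1 by rewrite ltr_wpDl ?sqr_ge0.
  apply: (le_trans (small (e / (S ^+ 2 + 1)) _)); first by rewrite divr_gt0.
  by rewrite mulrAC ler_pdivrMr// ler_pM2l// lerDl.
move=> e0; have [r r0 hr] := B_small u0 v0 e0.
have [k kr] : exists k, S / 2 ^+ k < r.
  have [N] : exists N : nat, S / r < N%:R.
    by exists (Num.bound (S / r)); apply: archi_boundP; rewrite divr_ge0 ?(ltW r0)//.
  rewrite ltr_pdivrMr// => hN; exists N; rewrite ltr_pdivrMr ?exprn_gt0// mulrC.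
  apply: (lt_trans hN); rewrite ltr_pM2r//.
  by rewrite -natrX ltr_nat ltn_expl.
have SE : S / 2 ^+ k = W k + H k by rewrite /S /W /H mulrDl.
have [p1 p2 p3 p4] := insp k.
apply: (le_trans (BSn k)).
have /= := hr (p k).1 ((p k).1 + W k) (p k).2 ((p k).2 + H k) p1 (hu k) p2 p3 (hv k) p4.
rewrite ![_ + _ - _]addrAC !subrr !add0r -SE => /(_ _ _)/=.
have wk := W_ge0 k; have hk := H_ge0 k.
have a1 : W k < r by lra.
have a2 : H k < r by lra.
move=> /(_ a1 a2) h; apply: (le_trans (ler_wpM2l _ h)); first by rewrite exprn_ge0.
have -> : 4 = 2 ^+ 2 :> R by rewrite expr2 -natrM.
rewrite -exprM mulnC exprM expr_div_n mulrCA ler_pM2l//.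
by rewrite mulrCA divff ?mulr1// expf_neq0// expf_neq0.
Qed.

End AdditiveRectangleFunctions.

Section Goursat.
Context {R : realType}.
Implicit Types (G : R[i] -> R[i]) (a b c d x y : R).

Lemma continuous_hline c x : {for x, continuous (fun x => x +i* c : R[i])}.
Proof.
apply/cvgcP => e e0; near=> y.
have -> : (x +i* c) - (y +i* c) = (x - y)%:C :> R[i].
  by apply/eqP; rewrite eq_complex /= subrr !eqxx.
by rewrite cabsR; near: y; apply: cvgr_dist_lt.
Unshelve. all: by end_near. Qed.

Lemma continuous_vline c x : {for x, continuous (fun y => c +i* y : R[i])}.
Proof.
apply/cvgcP => e e0; near=> y.
have -> : (c +i* x) - (c +i* y) = 'i * (x - y)%:C :> R[i].
  by apply/eqP; rewrite eq_complex /=; apply/andP; split; apply/eqP; ring.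
rewrite cabsM cabsR /cabs /= expr0n expr1n add0r sqrtr1 mul1r.
by near: y; apply: cvgr_dist_lt.
Unshelve. all: by end_near. Qed.

(** Imaginary part of the contour integral of G over the boundary of the
rectangle; in it the vertical sides carry Re G, which become circle means of a real
part under the exponential. *)
Definition rect_int G a b c d : R :=
  Rint a b (fun x => Im (G (x +i* c)) - Im (G (x +i* d)))
  + Rint c d (fun y => Re (G (b +i* y)) - Re (G (a +i* y))).

Variables (G : R[i] -> R[i]) (a0 b0 : R).
Hypothesis dG : forall w, a0 <= Re w <= b0 -> cdiff G w.

Lemma itg_hline a b c : a0 <= a -> b <= b0 ->
  itg a b (fun x => Im (G (x +i* c))).
Proof.
move=> aa bb; apply: itg_cont => x; rewrite in_itv/= => /andP[ax xb].
have cG : {for (x +i* c), continuous G}.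
  by apply/cdiff_continuous/dG; rewrite /= (le_trans aa ax) (le_trans xb bb).
apply: (@continuous_comp _ _ _ (fun x => G (x +i* c)) (@Im R)).
  exact: (continuous_comp (continuous_hline (c:=c) (x:=x)) cG).
exact: Im_continuous.
Qed.

Lemma itg_vline u c d : a0 <= u -> u <= b0 ->
  itg c d (fun y => Re (G (u +i* y))).
Proof.
move=> au ub; apply: itg_cont => x _.
have cG : {for (u +i* x), continuous G}.
  by apply/cdiff_continuous/dG; rewrite /= au ub.
apply: (@continuous_comp _ _ _ (fun x => G (u +i* x)) (@Re R)).
  exact: (continuous_comp (continuous_vline (c:=u) (x:=x)) cG).
exact: Re_continuous.
Qed.

(** The affine part of G at u + i v integrates to zero over the boundary, and the
rest is small compared with the distance to u + i v. *)
Lemma rect_int_small u v : a0 <= u <= b0 ->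
  forall e, 0 < e -> exists2 r : R, 0 < r & forall a b c d,
    a0 <= a -> a <= u <= b -> b <= b0 -> c <= v <= d ->
    b - a < r -> d - c < r ->
    `|rect_int G a b c d| <= e * (b - a + (d - c)) ^+ 2.
Proof.
move=> u0 e e0.
have /cdiffP[D hD] : cdiff G (u +i* v) by exact: dG.
have e2 : 0 < e / 2 by rewrite divr_gt0.
have [r r0 hr] := hD _ e2.
exists (r / 2); first by rewrite divr_gt0.
move=> a b c d aa /andP[au ub] bb /andP[cv vd] ab cd.
pose s := b - a + (d - c).
have s0 : 0 <= s by rewrite /s; lra.
pose L w := G (u +i* v) + D * (w - (u +i* v)).
have est x y : a <= x <= b -> c <= y <= d ->
    cabs (G (x +i* y) - L (x +i* y)) <= e / 2 * s.
  move=> /andP[ax xb] /andP[cy yd].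
  have le_s : cabs ((x +i* y) - (u +i* v)) <= s.
    apply: (le_trans (cabs_le_ReIm _)); rewrite /= /s.
    by apply: lerD; rewrite ler_norml; apply/andP; split; lra.
  rewrite /L opprD addrA (le_trans (hr _ _))//; last by rewrite ler_wpM2l// ltW.
  by apply: (le_lt_trans le_s); rewrite /s; lra.
have hI : `|Rint a b (fun x => Im (G (x +i* c)) - Im (G (x +i* d)))
   - (Re D * (c - d)) * (b - a)| <= (e * s) * (b - a).
  apply: Rint_near_cst; [by lra|by apply: itgB; apply: itg_hline|].
  move=> x xab; have h1 := le_trans (Im_le_cabs _) (est x c xab _).
  have h2 := le_trans (Im_le_cabs _) (est x d xab _).
  have {}h1 := h1 ltac:(by apply/andP; split; lra).
  have {}h2 := h2 ltac:(by apply/andP; split; lra).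
  move: h1 h2; rewrite /L; clear L est hr hD; move: (G (x +i* c)) (G (x +i* d)) (G (u +i* v)) D => [g1 g1'] [g2 g2'] [g3 g3'] [D1 D2] /=.
  by rewrite !ler_norml => /andP[? ?] /andP[? ?]; apply/andP; split; lra.
have hR : `|Rint c d (fun y => Re (G (b +i* y)) - Re (G (a +i* y)))
   - (Re D * (b - a)) * (d - c)| <= (e * s) * (d - c).
  apply: Rint_near_cst; [by lra|by apply: itgB; apply: itg_vline; lra|].
  move=> y ycd; have h1 := le_trans (Re_le_cabs _) (est a y _ ycd).
  have h2 := le_trans (Re_le_cabs _) (est b y _ ycd).
  have {}h1 := h1 ltac:(by apply/andP; split; lra).
  have {}h2 := h2 ltac:(by apply/andP; split; lra).
  move: h1 h2; rewrite /L; clear L est hr hD hI; move: (G (a +i* y)) (G (b +i* y)) (G (u +i* v)) D => [g1 g1'] [g2 g2'] [g3 g3'] [D1 D2] /=.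
  by rewrite !ler_norml => /andP[? ?] /andP[? ?]; apply/andP; split; lra.
rewrite /rect_int -/s; move: hI hR; set X := Rint a b _; set Y := Rint c d _.
have -> : e * s ^+ 2 = e * s * (b - a) + e * s * (d - c) by rewrite -mulrDr expr2 mulrA.
by rewrite !ler_norml => /andP[? ?] /andP[? ?]; apply/andP; split; lra.
Qed.

Lemma rect_int_eq0 c d : a0 <= b0 -> c <= d -> rect_int G a0 b0 c d = 0.
Proof.
move=> ab cd; apply: (additive_rectangle_eq0 (B := rect_int G)) => //.
- move=> a m b c' d' aa am mb bb cc c'd' d'd; rewrite /rect_int.
  rewrite (Rint_split am mb); last by apply: itgB; apply: itg_hline.
  have ? : a0 <= m by lra.
  have ? : a0 <= b by lra.
  have ? : m <= b0 by lra.
  have ? : a <= b0 by lra.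
  by rewrite !(@RintB _ c')//; try exact: itg_vline; lra.
- move=> a b c' m d' aa a_b bb cc c'm md d'd; rewrite /rect_int.
  have ? : a0 <= b by lra.
  have ? : a <= b0 by lra.
  rewrite (Rint_split c'm md); last by apply: itgB; apply: itg_vline.
  by rewrite !(@RintB _ a)//; try exact: itg_hline; lra.
- move=> u v u0 v0 e e0; have [r r0 hr] := rect_int_small v u0 e0.
  by exists r => // a b c' d' ? ? ? _ ? _; exact: hr.
Qed.

End Goursat.

(** * The complex exponential *)

Section ComplexExponential.
Context {R : realType}.
Implicit Types (x y : R) (z w : R[i]).

Definition ei x : R[i] := cos x +i* sin x.

Definition cexp z : R[i] := (expR (Re z))%:C * ei (Im z).

Lemma eiD x y : ei (x + y) = ei x * ei y.
Proof.
rewrite /ei cosD sinD; apply/eqP; rewrite eq_complex /=.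
by apply/andP; split; apply/eqP; ring.
Qed.

Lemma ei0 : ei 0 = 1.
Proof. by rewrite /ei cos0 sin0. Qed.

Lemma cabs_ei x : cabs (ei x) = 1.
Proof. by rewrite /cabs /= cos2Dsin2 sqrtr1. Qed.

Lemma ei_neq0 x : ei x != 0.
Proof. by rewrite -cabs_eq0 cabs_ei oner_eq0. Qed.

Lemma eiDpi2 x : ei (x + pi *+ 2) = ei x.
Proof. by rewrite /ei cosD sinD cos2pi sin2pi !mulr1 !mulr0 subr0 addr0. Qed.

Lemma conj_ei x : conjc (ei x) = (ei x)^-1.
Proof.
apply: (mulfI (ei_neq0 x)); rewrite mulfV ?ei_neq0// mulcJ cabs_ei expr1n.
by [].
Qed.

Lemma ei_continuous : continuous ei.
Proof. exact: expi_continuous. Qed.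

Lemma cexpD z w : cexp (z + w) = cexp z * cexp w.
Proof.
rewrite /cexp !raddfD /= expRD eiD rmorphM.
by ring.
Qed.

Lemma cabs_cexp z : cabs (cexp z) = expR (Re z).
Proof. by rewrite cabsM cabs_ei mulr1 cabsR ger0_norm// expR_ge0. Qed.

Lemma cexp_neq0 z : cexp z != 0.
Proof. by rewrite -cabs_gt0 cabs_cexp expR_gt0. Qed.

Lemma cexp0 : cexp 0 = 1.
Proof. by rewrite /cexp /= expR0 ei0 mulr1. Qed.

Lemma first_order0 (f : R -> R) d : is_derive (0 : R) 1 f d ->
  forall e, 0 < e -> exists2 r : R, 0 < r & forall h, `|h| < r ->
    `|f h - f 0 - d * h| <= e * `|h|.
Proof.
move=> [df dE] e e0; move: df => /cvg_ex[/= l hl].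
have ld : l = d by rewrite -dE /derive; apply/esym/cvg_lim.
move: hl => /fcvgrPdist_lt/(_ e e0) /nbhs_ballP[r /= r0 hr].
exists r => // h hlt; have [->|h0] := eqVneq h 0.
  by rewrite subrr sub0r mulr0 normrN !normr0 mulr0.
have := hr h; rewrite -ball_normE /= sub0r normrN => /(_ hlt h0).
rewrite /GRing.scale /= mulr1 addr0 ld => /ltW h1.
have -> : f h - f 0 - d * h = - ((d - h^-1 * (f h - f 0)) * h).
  by rewrite mulrBl mulrAC mulVf// mul1r opprB.
by rewrite normrN normrM ler_wpM2r.
Qed.

(** The three derivatives of exp, cos and sin at 0 are used with tolerance
min 1 (e / 9); the constant 9 collects the error terms. *)
Lemma cdiff_cexp0 : cdiff cexp 0.
Proof.
apply/cdiffP; exists 1 => e e0.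
pose d := Num.min 1 (e / 9).
have d0 : 0 < d by rewrite lt_min ltr01 divr_gt0.
have d1 : d <= 1 by rewrite /d ge_min lexx.
have de : 9 * d <= e by rewrite mulrC -ler_pdivlMr// /d ge_min lexx orbT.
have [r1 r10 h1] := first_order0 (is_derive_expR 0) d0.
have [r2 r20 h2] := first_order0 (is_derive_cos 0) d0.
have [r3 r30 h3] := first_order0 (is_derive_sin 0) d0.
exists (Num.min d (Num.min r1 (Num.min r2 r3))); first by rewrite lt_min d0 lt_min r10 lt_min r20.
move=> [a b]; rewrite !subr0 lt_min => /andP[hd]; rewrite lt_min => /andP[hr1]; rewrite lt_min => /andP[hr2 hr3].
have ha := Re_le_cabs (a +i* b); have hb := Im_le_cabs (a +i* b).
rewrite /= -/(cabs (a +i* b)) in ha hb.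
have {h1} := h1 a (le_lt_trans ha hr1).
have {h2} := h2 b (le_lt_trans hb hr2).
have {h3} := h3 b (le_lt_trans hb hr3).
rewrite cexp0 expR0 cos0 sin0 oppr0 mul0r !mul1r !subr0 ?addr0 => h3 h2 h1.
have ad : `|a| <= d by rewrite (le_trans ha)// ltW.
have bd : `|b| <= d by rewrite (le_trans hb)// ltW.
apply: (le_trans (cabs_le_ReIm _)).
rewrite /cexp /ei /= !mul0r subr0 addr0 oppr0 !addr0.
set E := expR a in h1 *; set C := cos b in h2 *; set S := sin b in h3 *.
have E3 : `|E| <= 3.
  have n1 := ler_normD (E - 1 - a) (1 + a); have := ler_normD 1 a; rewrite normr1 => n2.
  have e1 : (E - 1 - a) + (1 + a) = E by ring.
  have : d * `|a| <= 1 * 1 by apply: ler_pM => //; lra.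
  by move: n1; rewrite e1; lra.
have hRe : `|E * C - 1 - a| <= 3 * (d * `|b|) + d * `|a|.
  have -> : E * C - 1 - a = E * (C - 1) + (E - 1 - a) by ring.
  by apply: (le_trans (ler_normD _ _)); rewrite normrM lerD// ler_pM.
have hIm : `|E * S - b| <= 3 * (d * `|b|) + 2 * (d * `|b|).
  have E1 : `|E - 1| <= 2 * d.
    have -> : E - 1 = (E - 1 - a) + a by ring.
    have n1 := ler_normD (E - 1 - a) a.
    have := ler_wpM2l (ltW d0) (le_trans ad d1); rewrite mulr1 => n2.
    by lra.
  have -> : E * S - b = E * (S - b) + (E - 1) * b by ring.
  have m1 : `|E * (S - b)| <= 3 * (d * `|b|) by rewrite normrM; apply: ler_pM.
  have m2 : `|(E - 1) * b| <= 2 * d * `|b| by rewrite normrM ler_wpM2r.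
  have n2 := ler_normD (E * (S - b)) ((E - 1) * b).
  by lra.
have da : d * `|a| <= d * cabs (a +i* b) by rewrite ler_wpM2l// ltW.
have db : d * `|b| <= d * cabs (a +i* b) by rewrite ler_wpM2l// ltW.
have dc : 9 * d * cabs (a +i* b) <= e * cabs (a +i* b) by rewrite ler_wpM2r// cabs_ge0.
change (`|E * C - 1 - a| + `|E * S - b| <= e * cabs (a +i* b)).
by lra.
Qed.

Lemma cdiff_cexp z : cdiff cexp z.
Proof.
rewrite (_ : cexp = fun w => cexp z * cexp (w - z)); last first.
  by apply/funext => w; rewrite -cexpD addrC subrK.
apply: cdiffM; first exact: cdiff_cst.
apply: (cdiff_comp (f := cexp)); first by apply: cdiffB; [exact: cdiff_id|exact: cdiff_cst].
by rewrite subrr; exact: cdiff_cexp0.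
Qed.

End ComplexExponential.

(** * Circle means *)

Section DominatedConvergence.
Context {R : realType}.

Lemma Rint_cvg (a b : R) (f_ : nat -> R -> R) (f g : R -> R) :
  (forall n, itg a b (f_ n)) -> itg a b f -> itg a b g ->
  (forall x, a <= x <= b -> f_ n x @[n --> \oo] --> f x) ->
  (forall n x, a <= x <= b -> `|f_ n x| <= g x) ->
  Rint a b (f_ n) @[n --> \oo] --> Rint a b f.
Proof.
move=> if_ iff ig f_f f_g; apply: fine_cvg.
rewrite fineK; last by apply: integrable_fin_num => //; exact: measurable_itv.
apply: (@dominated_cvg _ _ _ (@lebesgue_measure R) _ _
  (fun n x => (f_ n x)%:E) (EFin \o f) (EFin \o g)) => //=.
- by move=> n; exact: measurable_int (if_ n).
- move=> x; rewrite in_itv/= => xab; apply: cvg_EFin; first by apply: nearW.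
  exact: (f_f x xab).
Qed.

End DominatedConvergence.

Section CircleMeans.
Context {R : realType}.
Implicit Types (K g : R[i] -> R[i]) (f : R[i] -> R) (z t : R[i]).

Definition twopi : R := pi *+ 2.

Lemma twopi_gt0 : 0 < twopi.
Proof. exact: pi2_gt0. Qed.

Definition circ f : R := Rint 0 twopi (fun x => f (ei x)).
Definition itc f := itg 0 twopi (fun x => f (ei x)).

Definition ccont f := forall z, cabs z = 1 -> {for z, continuous f}.

Lemma itc_ccont f : ccont f -> itc f.
Proof.
move=> cf; apply: itg_cont => x _.
apply: (@continuous_comp _ _ _ ei f); first exact: ei_continuous.
by apply: cf; rewrite cabs_ei.
Qed.

(** Goursat's theorem for K o exp on the rectangle over [0, 2 pi]: the horizontal
sides cancel by periodicity, and the vertical sides are the two circle means. *)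
Lemma annulus_mean_const K (r1 r2 : R) : 0 < r1 -> r1 <= r2 ->
  (forall z, r1 <= cabs z <= r2 -> cdiff K z) ->
  circ (fun z => Re (K (r1%:C * z))) = circ (fun z => Re (K (r2%:C * z))).
Proof.
move=> r10 r12 dK; have r20 := lt_le_trans r10 r12.
pose G w := K (cexp w).
have eln (r : R) : 0 < r -> expR (ln r) = r by move=> r0; rewrite lnK ?posrE.
have le12 : ln r1 <= ln r2 by rewrite ler_ln.
have dG w : ln r1 <= Re w <= ln r2 -> cdiff G w.
  move=> /andP[h1 h2]; apply: cdiff_comp; first exact: cdiff_cexp.
  by apply: dK; rewrite cabs_cexp -{1}(eln r1)// -{1}(eln r2)// !ler_expR h1 h2.
have GE (r x : R) : 0 < r -> G (ln r +i* x) = K (r%:C * ei x).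
  by move=> r0; rewrite /G /cexp /= eln.
have := rect_int_eq0 dG le12 (ltW twopi_gt0).
rewrite /rect_int.
rewrite [X in X + _](_ : _ = 0) ?add0r; last first.
  rewrite (@eq_Rint _ _ _ _ (fun=> 0)); last first.
    by move=> x _; rewrite /G /cexp /= -(add0r twopi) eiDpi2 subrr.
  by rewrite Rint_cst// mul0r.
rewrite RintB; [|exact: (itg_vline dG)|exact: (itg_vline dG)].
move=> /eqP; rewrite subr_eq0 => /eqP e.
apply/esym; move: e; rewrite /circ.
under eq_Rint do rewrite GE//.
by under [X in _ = X -> _]eq_Rint do rewrite GE//.
Qed.

Lemma closed_disc_bounded K :
  (forall z, cabs z <= 1 -> {for z, continuous K}) ->
  exists M : R, forall r x, 0 <= r <= 1 -> 0 <= x <= twopi -> cabs (K (r%:C * ei x)) <= M.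
Proof.
move=> cK; pose f (rx : R * R) := cabs (K (rx.1%:C * ei rx.2)).
have [] := @compact_EVT_max _ _ f (`[0, 1] `*` `[0, twopi]).
- by exists (0, 0); split; rewrite /= in_itv/= lexx ?ler01 ?ltW ?twopi_gt0.
- by apply: compact_setX; exact: segment_compact.
- apply: continuous_in_subspaceT => -[r x]; rewrite inE => -[/=].
  rewrite !in_itv/= => /andP[r0 r1] _.
  have cKz : {for (r%:C * ei x), continuous K}.
    by apply: cK; rewrite cabsM cabs_ei mulr1 cabsR ger0_norm.
  apply: (@continuous_comp _ _ _ (fun rx : R * R => K (rx.1%:C * ei rx.2)) (@cabs R)); last first.
    exact: cabs_continuous.
  apply: (@continuous_comp _ _ _ (fun rx : R * R => rx.1%:C * ei rx.2 : R[i]) K) => //.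
  apply: (@cvgcM _ _ _ _ (fun rx : R * R => rx.1%:C : R[i]) (fun rx : R * R => ei rx.2)).
    apply: (@continuous_comp _ _ _ (fst : R * R -> R) (fun x : R => x%:C : R[i])); first exact: cvg_fst.
    exact: RtoC_continuous.
  apply: (@continuous_comp _ _ _ (snd : R * R -> R) (fun x : R => ei x)); first exact: cvg_snd.
  exact: ei_continuous.
- move=> [r0 x0] _ hM; exists (f (r0, x0)) => r x r01 x01.
  by apply: (hM (r, x)); rewrite inE; split; rewrite /= in_itv.
Qed.

Lemma itc_ReK K (r : R) : (forall z, cabs z <= 1 -> {for z, continuous K}) ->
  0 <= r <= 1 -> itc (fun z => Re (K (r%:C * z))).
Proof.
move=> cK /andP[r0 r1]; apply: itc_ccont => z z1.
apply: (@continuous_comp _ _ _ (fun z => K (r%:C * z)) (@Re R)); last exact: Re_continuous.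
apply: (@continuous_comp _ _ _ (fun z => r%:C * z : R[i]) K).
  exact: (cvgcM (@contc_cst R r%:C z) (@contc_id R z)).
by apply: cK; rewrite cabsM z1 mulr1 cabsR ger0_norm.
Qed.

Lemma circle_mean_cvg K (r_ : nat -> R) (r : R) :
  (forall z, cabs z <= 1 -> {for z, continuous K}) ->
  (forall n, 0 <= r_ n <= 1) -> 0 <= r <= 1 -> r_ n @[n --> \oo] --> r ->
  circ (fun z => Re (K ((r_ n)%:C * z))) @[n --> \oo]
    --> circ (fun z => Re (K (r%:C * z))).
Proof.
move=> cK r_01 /[dup] r01 /andP[r0 r1] r_r.
have [M hM] := closed_disc_bounded cK.
apply: (@Rint_cvg _ _ _ _ _ (fun=> M)).
- by move=> n; exact: itc_ReK.
- exact: itc_ReK.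
- exact: itg_cst.
- move=> x _.
  have hr : (r_ n)%:C @[n --> \oo] --> (r%:C : R[i]).
    exact: (cvg_continuous_at r_r (@RtoC_continuous R r)).
  have hz : (r_ n)%:C * ei x @[n --> \oo] --> (r%:C * ei x : R[i]).
    exact: (cvgcM hr (cvgc_cst \oo (ei x))).
  have cKz : {for (r%:C * ei x), continuous K}.
    by apply: cK; rewrite cabsM cabs_ei mulr1 cabsR ger0_norm.
  have hK : K ((r_ n)%:C * ei x) @[n --> \oo] --> K (r%:C * ei x).
    exact: (cvg_continuous_at hz cKz).
  exact: (cvg_continuous_at hK (@Re_continuous R (K (r%:C * ei x)))).
- by move=> n x x01; apply: (le_trans (Re_le_cabs _)); exact: hM.
Qed.

End CircleMeans.

(** * The mean value property and the Poisson formula *)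

Section PoissonFormula.
Context {R : realType}.
Implicit Types (K g : R[i] -> R[i]) (z t : R[i]) (r : R).

Lemma eq_circ (f g : R[i] -> R) : (forall z, cabs z = 1 -> f z = g z) -> circ f = circ g.
Proof. by move=> fg; apply: eq_Rint => x _; apply: fg; rewrite cabs_ei. Qed.

Lemma circ_cst (k : R) : circ (fun=> k) = twopi * k.
Proof. by rewrite /circ Rint_cst ?ltW ?twopi_gt0// subr0 mulrC. Qed.

Lemma itcD (f g : R[i] -> R) : itc f -> itc g -> itc (fun z => f z + g z).
Proof. by move=> ? ?; exact: itgD. Qed.

Lemma itcB (f g : R[i] -> R) : itc f -> itc g -> itc (fun z => f z - g z).
Proof. by move=> ? ?; exact: itgB. Qed.

Lemma itcZ (k : R) (f : R[i] -> R) : itc f -> itc (fun z => k * f z).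
Proof. by move=> ?; exact: itgZ. Qed.

Lemma circD (f g : R[i] -> R) : itc f -> itc g ->
  circ (fun z => f z + g z) = circ f + circ g.
Proof. by move=> ? ?; exact: RintD. Qed.

Lemma circB (f g : R[i] -> R) : itc f -> itc g ->
  circ (fun z => f z - g z) = circ f - circ g.
Proof. by move=> ? ?; exact: RintB. Qed.

Lemma circZ (k : R) (f : R[i] -> R) : itc f -> circ (fun z => k * f z) = k * circ f.
Proof. by move=> ?; exact: RintZ. Qed.

Lemma le_circ (f g : R[i] -> R) : itc f -> itc g ->
  (forall z, cabs z = 1 -> f z <= g z) -> circ f <= circ g.
Proof. by move=> ? ? fg; apply: le_Rint => // x _; apply: fg; rewrite cabs_ei. Qed.

Lemma circ_ge0 (f : R[i] -> R) : (forall z, cabs z = 1 -> 0 <= f z) -> 0 <= circ f.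
Proof. by move=> f0; apply: Rint_ge0 => x _; apply: f0; rewrite cabs_ei. Qed.

(** Circle means are constant on the open annulus and continuous up to its
boundary circles. *)
Lemma circle_mean_endpoints K (a b : R) : (forall z, cabs z <= 1 -> {for z, continuous K}) ->
  0 <= a -> a < b -> b <= 1 ->
  (forall z, a < cabs z < b -> cdiff K z) ->
  circ (fun z => Re (K (a%:C * z))) = circ (fun z => Re (K (b%:C * z))).
Proof.
move=> cK a0 ab b1 dK; pose M r := circ (fun z => Re (K (r%:C * z))).
have Mc u v : a < u -> u < b -> a < v -> v < b -> M u = M v.
  wlog uv : u v / u <= v.
    by move=> h; have [/h//|/ltW /h h' ? ? ? ?] := leP u v; rewrite h'.
  move=> au ub av vb; apply: annulus_mean_const => //; first by exact: le_lt_trans au.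
  by move=> z /andP[uz zv]; apply: dK; rewrite (lt_le_trans au uz) (le_lt_trans zv vb).
have lim_M c d (s := fun n : nat => c + (d - c) * n.+1%:R^-1) :
    0 <= c <= 1 -> (forall n, a < s n < b) -> a < d < b -> M c = M d.
  move=> c01 sab /andP[ad db].
  have s_c : s n @[n --> \oo] --> c.
    rewrite -[X in _ --> X]addr0 -[X in _ --> _ + X](mulr0 (d - c)).
    apply: cvgD; first exact: cvg_cst.
    by apply: cvgMr; exact: cvg_harmonic.
  have := circle_mean_cvg cK _ c01 s_c; rewrite -/(M c) => /(_ _)/cvg_unique; apply => //.
    by move=> n; have /andP[h1 h2] := sab n; rewrite (le_trans a0 (ltW h1)) (le_trans (ltW h2) b1).
  rewrite (_ : (fun n => _) = fun=> M d); first exact: cvg_cst.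
  by apply/funext => n; have /andP[h1 h2] := sab n; exact: Mc.
have inv01 n : 0 < (n.+1%:R^-1 : R) <= 1.
  by rewrite invr_gt0 ltr0n/= invf_le1 ?ltr0n// ler1n.
pose m := (a + b) / 2.
have am : a < m by rewrite /m; lra.
have mb : m < b by rewrite /m; lra.
have e1 : M a = M m.
  apply: lim_M; [by apply/andP; split; lra| |by rewrite am].
  move=> n; have := inv01 n; move: (n.+1%:R^-1) => i /andP[i0 i1].
  have h1 : 0 < (m - a) * i by rewrite mulr_gt0 ?subr_gt0.
  have h2 : (m - a) * i <= m - a by rewrite ger_pMr ?subr_gt0.
  by apply/andP; split; lra.
have e2 : M b = M m.
  apply: lim_M; [by apply/andP; split; lra| |by rewrite am].
  move=> n; have := inv01 n; move: (n.+1%:R^-1) => i /andP[i0 i1].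
  have h1 : 0 < (b - m) * i by rewrite mulr_gt0 ?subr_gt0.
  have h2 : (b - m) * i <= b - m by rewrite ger_pMr ?subr_gt0.
  by apply/andP; split; lra.
by rewrite -/(M a) -/(M b) e1 e2.
Qed.

(** The exceptional circle lets K be a difference quotient, of which only continuity
is known at its centre. *)
Lemma mean_value K r : (forall z, cabs z <= 1 -> {for z, continuous K}) ->
  (forall z, cabs z <= 1 -> cabs z != r -> cdiff K z) ->
  circ (fun z => Re (K z)) = twopi * Re (K 0).
Proof.
move=> cK dK.
have -> : circ (fun z => Re (K z)) = circ (fun z => Re (K (1%:C * z))).
  by apply: eq_circ => z _; rewrite mul1r.
have <- : circ (fun z => Re (K (0%:C * z))) = twopi * Re (K 0).
  by rewrite -circ_cst; apply: eq_circ => z _; rewrite mul0r.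
apply/esym; case: (boolP (0 < r < 1)) => [/andP[r0 r1]|r01].
  rewrite (@circle_mean_endpoints _ 0 r)//; last 2 first.
  - exact: ltW.
  - by move=> z /andP[_ zr]; apply: dK; rewrite ?lt_eqF// (le_trans (ltW zr))// ltW.
  apply: circle_mean_endpoints => //; first exact: ltW.
  by move=> z /andP[rz z1]; apply: dK; rewrite ?gt_eqF// ltW.
apply: circle_mean_endpoints => // z /andP[z0 z1]; apply: dK; first exact: ltW.
by apply: contraNneq r01 => <-; rewrite z0.
Qed.

Lemma holomorphic_mean_value g : (forall z, cabs z <= 1 -> cdiff g z) ->
  circ (fun z => Re (g z)) = twopi * Re (g 0).
Proof.
move=> dg; apply: (@mean_value _ 0); last by move=> z z1 _; exact: dg.
by move=> z z1; apply/cdiff_continuous/dg.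
Qed.

Definition poisson_kernel t z : R := (1 - cabs t ^+ 2) / cabs (z - t) ^+ 2.

Lemma poisson_kernelE t z : cabs z = 1 -> cabs t < 1 ->
  (poisson_kernel t z)%:C = (1 - t * conjc t) * z / ((z - t) * (1 - conjc t * z)).
Proof.
move=> z1 t1.
have zz : z * conjc z = 1 by rewrite mulcJ z1 expr1n.
have z0 : z != 0 by rewrite -cabs_eq0 z1 oner_eq0.
have zt : z - t != 0.
  by rewrite subr_eq0; apply: contraTneq t1 => <-; rewrite z1 ltxx.
have cz : conjc z = z^-1 by apply: (mulfI z0); rewrite zz mulfV.
have zt' : 1 - conjc t * z != 0.
  have -> : 1 - conjc t * z = z * conjc (z - t) by rewrite rmorphB /= mulrBr zz mulrC.
  by rewrite mulf_neq0// conjc_eq0.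
have -> : (poisson_kernel t z)%:C = (1 - t * conjc t) / ((z - t) * conjc (z - t)).
  by rewrite !mulcJ /poisson_kernel rmorphM fmorphV rmorphB rmorph1.
rewrite rmorphB /= cz.
by field; apply/and3P; split; [exact: zt'|exact: zt|exact: z0].
Qed.

(** With k = g (1 - |t|^2) / (1 - conj t z), on the circle the Poisson kernel times
g is z k(z) / (z - t).  Subtracting k(t) from k leaves a function to which the mean
value property applies, with mean 0; what remains, z k(t) / (z - t), is on the circle
the conjugate of a holomorphic function. *)
Lemma poisson_formula g t : (forall z, cabs z <= 1 -> cdiff g z) -> cabs t < 1 ->
  circ (fun z => poisson_kernel t z * Re (g z)) = twopi * Re (g t).
Proof.
move=> dg t1.
have den z : cabs z <= 1 -> 1 - conjc t * z != 0.
  move=> z1; rewrite subr_eq0; apply/negP => /eqP/(congr1 (@cabs R)).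
  rewrite cabs1 cabsM cabsJ => /esym/eqP; apply/negP; rewrite lt_eqF//.
  by apply: (le_lt_trans _ t1); rewrite ler_piMr// cabs_ge0.
pose q z := (1 - conjc t * z)^-1.
have dq z : cabs z <= 1 -> cdiff q z.
  move=> z1; apply: (cdiff_inv (f := fun z => 1 - conjc t * z)); last exact: den.
  apply: cdiffB; first exact: cdiff_cst.
  exact: cdiff_scale.
pose k z := g z * ((1 - t * conjc t) * q z).
have dk z : cabs z <= 1 -> cdiff k z.
  move=> z1; apply: cdiffM; first exact: dg.
  by apply: cdiffM; [exact: cdiff_cst|exact: dq].
have kt : k t = g t.
  rewrite /k /q [conjc t * t]mulrC mulfV ?mulr1//.
  by rewrite mulrC den// ltW.
have [Phi cPhi PhiE] := dk t (ltW t1).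
pose K z := z * (if z == t then Phi t else (k z - k t) / (z - t)).
have KE z : K z = z * Phi z.
  rewrite /K; case: ifPn => [/eqP ->//|zt].
  by rewrite PhiE mulfK// subr_eq0.
have dK z : cabs z <= 1 -> z != t -> cdiff K z.
  move=> z1 zt; have zt0 : 0 < cabs (z - t) by rewrite cabs_gt0 subr_eq0.
  apply: (@cdiff_near _ (fun z => z * ((k z - k t) * (z - t)^-1)) _ _ _ zt0).
    move=> w wz; rewrite /K; case: ifPn => // /eqP wt; move: wz; rewrite wt.
    by rewrite cabsB ltxx.
  apply: cdiffM; first exact: cdiff_id.
  apply: cdiffM; first by apply: cdiffB; [exact: dk|exact: cdiff_cst].
  apply: (cdiff_inv (f := fun w => w - t)); last by rewrite subr_eq0.
  by apply: cdiffB; [exact: cdiff_id|exact: cdiff_cst].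
have cK z : cabs z <= 1 -> {for z, continuous K}.
  move=> z1; have [->|zt] := eqVneq z t; last exact/cdiff_continuous/dK.
  rewrite (_ : K = fun z => z * Phi z); last exact/funext.
  exact: (cvgcM (contc_id t) cPhi).
have mK : circ (fun z => Re (K z)) = 0.
  rewrite (@mean_value _ (cabs t))//; first by rewrite /K mul0r mulr0.
  by move=> z z1 zt; apply: dK => //; apply: contraNneq zt => ztE; rewrite ztE.
have itK : itc (fun z => Re (K z)).
  by apply: itc_ccont => z z1; apply: continuous_Re; apply: cK; rewrite z1.
(* the holomorphic function with the real part of k(t) z / (z - t) on the circle *)
pose L z := conjc (k t) * q z.
have dL z : cabs z <= 1 -> cdiff L z.
  by move=> z1; apply: cdiffM; [exact: cdiff_cst|exact: dq].
have mL : circ (fun z => Re (L z)) = twopi * Re (g t).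
  rewrite holomorphic_mean_value// /L /q mulr0 subr0 invr1 mulr1 kt.
  by case: (g t).
have itL : itc (fun z => Re (L z)).
  by apply: itc_ccont => z z1; apply/continuous_Re/cdiff_continuous/dL; rewrite z1.
rewrite -mL -[RHS]add0r -mK -circD//; apply: eq_circ => z z1.
have zz : z * conjc z = 1 by rewrite mulcJ z1 expr1n.
have z0 : z != 0 by rewrite -cabs_eq0 z1 oner_eq0.
have cz : conjc z = z^-1 by apply: (mulfI z0); rewrite zz mulfV.
have zt : z != t by apply: contraTneq t1 => ztE; rewrite -ztE z1 ltxx.
have zt0 : z - t != 0 by rewrite subr_eq0.
have LE : Re (L z) = Re (k t * (z / (z - t))).
  have -> : z / (z - t) = conjc (q z).
    rewrite /q fmorphV rmorphB rmorph1 rmorphM /= conjcK cz -{1}(mulr1 z).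
    have -> : 1 - t / z = (z - t) / z by rewrite mulrBl mulfV.
    by rewrite invf_div mulr1.
  by rewrite /L; case: (k t) (q z) => [a b] [c d] /=; ring.
rewrite LE -raddfD /=.
have -> : poisson_kernel t z * Re (g z) = Re ((poisson_kernel t z)%:C * g z).
  by case: (g z) => a b /=; ring.
rewrite poisson_kernelE// /K (negbTE zt); congr Re.
rewrite /k /q; field; apply/and3P; split; [exact: zt0|exact/den/ltW|by apply: den; rewrite z1].
Qed.

End PoissonFormula.

(** * The maximum principle and square means *)

Section CircleContinuous.
Context {R : realType}.
Implicit Types (f g : R[i] -> R) (k : R[i] -> R[i]) (z t : R[i]).

Lemma ccontD f g : ccont f -> ccont g -> ccont (fun z => f z + g z).
Proof. by move=> cf cg z z1; exact: (cvgD (cf z z1) (cg z z1)). Qed.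

Lemma ccontM f g : ccont f -> ccont g -> ccont (fun z => f z * g z).
Proof. by move=> cf cg z z1; exact: (cvgM (cf z z1) (cg z z1)). Qed.

Lemma ccont_cst (a : R) : ccont (fun=> a).
Proof. by move=> z z1; exact: cvg_cst. Qed.

Lemma ccontN f : ccont f -> ccont (fun z => - f z).
Proof. by move=> cf z z1; exact: (cvgN (cf z z1)). Qed.

Lemma ccontB f g : ccont f -> ccont g -> ccont (fun z => f z - g z).
Proof. by move=> cf cg; apply: ccontD => //; exact: ccontN. Qed.

Lemma ccontX f n : ccont f -> ccont (fun z => f z ^+ n).
Proof.
move=> cf; elim: n => [|n IH].
  by rewrite (_ : (fun=> _) = fun=> 1); [exact: ccont_cst|apply/funext => z; rewrite expr0].
by rewrite (_ : (fun z => _) = fun z => f z * f z ^+ n); [exact: ccontM|apply/funext => z; rewrite exprS].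
Qed.

Lemma ccontV f : ccont f -> (forall z, cabs z = 1 -> f z != 0) -> ccont (fun z => (f z)^-1).
Proof. by move=> cf f0 z z1; exact: (cvgV (f0 z z1) (cf z z1)). Qed.

Lemma ccont_Re k : (forall z, cabs z = 1 -> {for z, continuous k}) ->
  ccont (fun z => Re (k z)).
Proof. by move=> ck z z1; apply/continuous_Re/ck. Qed.

Lemma ccont_cabs k : (forall z, cabs z = 1 -> {for z, continuous k}) ->
  ccont (fun z => cabs (k z)).
Proof. by move=> ck z z1; apply/continuous_cabs/ck. Qed.

Lemma ccont_poisson_kernel t : cabs t < 1 -> ccont (poisson_kernel t).
Proof.
move=> t1; apply: ccontM; first exact: ccont_cst.
apply: ccontV.
  apply: ccontX; apply: ccont_cabs => z _.
  exact: (cvgcB (contc_id z) (contc_cst t z)).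
move=> z z1; rewrite expf_neq0// cabs_eq0 subr_eq0.
by apply: contraTneq t1 => <-; rewrite z1 ltxx.
Qed.

Lemma quadratic_CS (A B C : R) : (forall l, 0 <= A - 2 * l * B + l ^+ 2 * C) -> 0 <= C ->
  B ^+ 2 <= A * C.
Proof.
move=> h C0; have [C00|C1] := eqVneq C 0.
  have [->|B0] := eqVneq B 0; first by rewrite expr0n C00 mulr0.
  have := h ((A + 1) / (2 * B)); rewrite C00 mulr0 addr0.
  have -> : 2 * ((A + 1) / (2 * B)) * B = A + 1 by field.
  by lra.
have Cp : 0 < C by rewrite lt_def C1.
have := h (B / C); have -> : A - 2 * (B / C) * B + (B / C) ^+ 2 * C = (A * C - B ^+ 2) / C by field.
by rewrite pmulr_lge0 ?invr_gt0// subr_ge0.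
Qed.

Lemma circ_CS f g : ccont f -> ccont g ->
  (circ (fun z => f z * g z)) ^+ 2 <= circ (fun z => f z ^+ 2) * circ (fun z => g z ^+ 2).
Proof.
move=> cf cg; apply: quadratic_CS; last by apply: circ_ge0 => z _; exact: sqr_ge0.
move=> l; have i1 := itc_ccont (ccontX (n:=2) cf).
have i2 := itc_ccont (ccontM cf cg); have i3 := itc_ccont (ccontX (n:=2) cg).
have -> : circ (fun z => f z ^+ 2) - 2 * l * circ (fun z => f z * g z) + l ^+ 2 * circ (fun z => g z ^+ 2)
  = circ (fun z => (f z - l * g z) ^+ 2).
  rewrite -!circZ// -circB//; last exact: itcZ.
  rewrite -circD; [|by apply: itcB => //; exact: itcZ|exact: itcZ].
  by apply: eq_circ => z _; ring.
by apply: circ_ge0 => z _; exact: sqr_ge0.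
Qed.

End CircleContinuous.

Section MaximumPrinciple.
Context {R : realType}.
Implicit Types (g : R[i] -> R[i]) (z t : R[i]).

Definition chol g := forall z, cabs z <= 1 -> cdiff g z.

Lemma chol_cont g z : chol g -> cabs z <= 1 -> {for z, continuous g}.
Proof. by move=> dg z1; apply/cdiff_continuous/dg. Qed.

Lemma chol_dil g (r : R) : chol g -> 0 <= r <= 1 -> chol (fun z => g (r%:C * z)).
Proof.
move=> dg /andP[r0 r1] z z1; apply: (@cdiff_comp R g (fun z => r%:C * z)).
  exact: cdiff_scale.
by apply: dg; rewrite cabsM cabsR ger0_norm// mulr_ile1// cabs_ge0.
Qed.

Lemma ccont_chol_cabs g : chol g -> ccont (fun z => cabs (g z)).
Proof. by move=> dg; apply: ccont_cabs => z z1; apply: (chol_cont dg); rewrite z1. Qed.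

Lemma ccont_chol_Re g : chol g -> ccont (fun z => Re (g z)).
Proof. by move=> dg; apply: ccont_Re => z z1; apply: (chol_cont dg); rewrite z1. Qed.

Lemma poisson_kernel_ge0 t z : cabs t < 1 -> 0 <= poisson_kernel t z.
Proof.
move=> t1; rewrite divr_ge0 ?sqr_ge0// subr_ge0.
by rewrite -(expr1n _ 2) lerXn2r ?nnegrE ?cabs_ge0// ltW.
Qed.

Lemma poisson_kernel_mean t : cabs t < 1 -> circ (poisson_kernel t) = twopi.
Proof.
move=> t1; have := @poisson_formula R (fun=> 1) t (fun z _ => cdiff_cst 1 z) t1.
by rewrite /= mulr1 => <-; apply: eq_circ => z _; rewrite mulr1.
Qed.

Definition phase (c : R[i]) : R[i] := if c == 0 then 1 else conjc c / (cabs c)%:C.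

Lemma Re_phase c : Re (phase c * c) = cabs c.
Proof.
rewrite /phase; case: eqVneq => [->|c0]; first by rewrite mulr0 cabs0.
rewrite mulrAC [conjc c * c]mulrC mulcJ -fmorphV -rmorphM expr2 mulfK//.
by rewrite cabs_eq0.
Qed.

Lemma cabs_phase c : cabs (phase c) = 1.
Proof.
rewrite /phase; case: eqVneq => [_|c0]; first by rewrite cabs1.
by rewrite cabsM cabsV cabsJ cabsR ger0_norm ?cabs_ge0// mulfV// cabs_eq0.
Qed.

(** The phase turns |g(t)| into the real part of a holomorphic function, to which the
Poisson formula applies. *)
Lemma maximum_principle g (M : R) t : chol g ->
  (forall z, cabs z = 1 -> cabs (g z) <= M) -> cabs t <= 1 -> cabs (g t) <= M.
Proof.
move=> dg gM; rewrite le_eqVlt => /predU1P[|t1]; first exact: gM.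
pose G z := phase (g t) * g z.
have dG : chol G by move=> z z1; apply: cdiffM; [exact: cdiff_cst|exact: dg].
rewrite -(ler_pM2l (@twopi_gt0 R)) -Re_phase -(poisson_formula dG t1).
rewrite -{1}(poisson_kernel_mean t1) mulrC -circZ; last exact/itc_ccont/ccont_poisson_kernel.
apply: le_circ.
- apply: itc_ccont; apply: ccontM; [exact: ccont_poisson_kernel|exact: ccont_chol_Re].
- by apply: itcZ; apply/itc_ccont/ccont_poisson_kernel.
- move=> z z1; rewrite [M * _]mulrC ler_wpM2l ?poisson_kernel_ge0//.
  apply: (le_trans (ler_norm _)); apply: (le_trans (Re_le_cabs _)).
  by rewrite /G cabsM cabs_phase mul1r gM.
Qed.

End MaximumPrinciple.

Section SquareMeans.
Context {R : realType}.
Implicit Types (g : R[i] -> R[i]) (z t : R[i]) (r s : R).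

Definition mean2 g r : R := circ (fun z => cabs (g (r%:C * z)) ^+ 2).

(** On |z| = u the function g(r z) conj(g(s / conj z)), holomorphic in z, is
g(r u z') conj(g((s / u) z')) for z = u z'.  Its mean is the same for u = 1 and for
u = sqrt (s / r), where the two radii agree. *)
Lemma mean2_polar g r s : chol g -> 0 < r -> r <= s -> s <= 1 ->
  circ (fun z => Re (g (r%:C * z) * conjc (g (s%:C * z)))) = mean2 g (Num.sqrt (r * s)).
Proof.
move=> dg r0 rs s1; have s0 := lt_le_trans r0 rs.
pose c := Num.sqrt (s / r).
have c1 : 1 <= c by rewrite -[leLHS]sqrtr1 ler_wsqrtr// ler_pdivlMr// mul1r.
have c0 : 0 < c := lt_le_trans ltr01 c1.
have c2 : c ^+ 2 = s / r by rewrite sqr_sqrtr// divr_ge0// ltW.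
have rc : r * c = Num.sqrt (r * s).
  rewrite -[LHS]ger0_norm ?mulr_ge0 ?ltW// -sqrtr_sqr exprMn c2; congr Num.sqrt.
  by field; rewrite gt_eqF.
have sc : s / c = Num.sqrt (r * s).
  by rewrite -rc; apply: (mulIf (lt0r_neq0 c0)); rewrite divfK ?gt_eqF// -mulrA -expr2 c2 mulrC divfK// gt_eqF.
have q1 : Num.sqrt (r * s) <= 1.
  by rewrite -[leRHS]sqrtr1 ler_wsqrtr// mulr_ile1// ?(ltW r0) ?(ltW s0)// (le_trans rs).
pose K z := g (r%:C * z) * conjc (g (conjc (s%:C * z^-1))).
have dK z : 1 <= cabs z <= c -> cdiff K z.
  move=> /andP[z1 zc]; have z0 : z != 0 by rewrite -cabs_gt0 (lt_le_trans ltr01).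
  apply: cdiffM.
    apply: (@cdiff_comp R g (fun z => r%:C * z)).
      exact: cdiff_scale.
    apply: dg; rewrite cabsM cabsR gtr0_norm//; apply: le_trans q1; rewrite -rc.
    by rewrite ler_wpM2l// ltW.
  apply: (@cdiff_comp R (fun v => conjc (g (conjc v))) (fun z => s%:C * z^-1)).
    by apply: cdiffM; [exact: cdiff_cst|exact: cdiffV].
  apply: cdiff_conj; apply: dg; rewrite cabsJ cabsM cabsR gtr0_norm// cabsV.
  have zp : 0 < cabs z := lt_le_trans ltr01 z1.
  by apply: mulr_ile1 => //; rewrite ?(ltW s0) ?invr_ge0 ?(ltW zp) ?invf_le1.
have := annulus_mean_const ltr01 c1 dK.
have KE z : cabs z = 1 -> forall u, 0 < u -> K (u%:C * z) = g ((r * u)%:C * z) * conjc (g ((s / u)%:C * z)).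
  move=> z1 u u0; rewrite /K; congr (g _ * conjc (g _)); first by rewrite rmorphM mulrA.
  have z0 : z != 0 by rewrite -cabs_eq0 z1 oner_eq0.
  have zV : conjc z^-1 = z.
    apply: (mulfI (x := conjc z)); first by rewrite conjc_eq0.
    by rewrite -rmorphM mulfV// rmorph1 mulrC mulcJ z1 expr1n.
  have -> : s%:C * (u%:C * z)^-1 = (s / u)%:C * z^-1 by rewrite rmorphM fmorphV invfM mulrA.
  by rewrite rmorphM; congr (_ * _); [exact: conjc_real|exact: zV].
rewrite (@eq_circ _ _ (fun z => Re (g (r%:C * z) * conjc (g (s%:C * z))))); last first.
  by move=> z z1; rewrite KE// mulr1 divr1.
move=> ->; apply: eq_circ => z z1; rewrite KE// rc sc mulcJ.
by [].
Qed.

Lemma itc_mean2 g r : chol g -> 0 <= r <= 1 -> itc (fun z => cabs (g (r%:C * z)) ^+ 2).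
Proof. by move=> dg r01; apply/itc_ccont/ccontX/ccont_chol_cabs/chol_dil. Qed.

Lemma mean2_dist g r s : chol g -> 0 < r -> r <= s -> s <= 1 ->
  circ (fun z => cabs (g (r%:C * z) - g (s%:C * z)) ^+ 2)
  = mean2 g r + mean2 g s - 2 * mean2 g (Num.sqrt (r * s)).
Proof.
move=> dg r0 rs s1; rewrite -mean2_polar//.
have r01 : 0 <= r <= 1 by rewrite ltW//= (le_trans rs).
have s01 : 0 <= s <= 1 by rewrite s1 andbT (le_trans (ltW r0)).
have cK : ccont (fun z => Re (g (r%:C * z) * conjc (g (s%:C * z)))).
  apply: ccont_Re => z z1.
  have h1 : {for z, continuous (fun z => g (r%:C * z))}.
    by apply: (chol_cont (chol_dil dg r01)); rewrite z1.
  have h2 : {for z, continuous (fun z => g (s%:C * z))}.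
    by apply: (chol_cont (chol_dil dg s01)); rewrite z1.
  have h3 : {for z, continuous (fun z => conjc (g (s%:C * z)))}.
    exact: (cvg_continuous_at h2 (@conjc_continuous R _)).
  exact: (cvgcM h1 h3).
rewrite -circZ; last exact: itc_ccont.
rewrite /mean2 -circD; [|exact: itc_mean2|exact: itc_mean2].
rewrite -circB; last 2 first.
- by apply: itcD; exact: itc_mean2.
- by apply: itcZ; exact: itc_ccont.
apply: eq_circ => z _; rewrite !sqr_cabs.
by case: (g _) (g _) => [a b] [c d] /=; ring.
Qed.

(** By [mean2_dist] the square mean is midpoint convex as a function of log r.  If it
decreased somewhere, it would be unbounded as r tends to 0. *)
Lemma mean2_mono g r s : chol g -> 0 < r -> r <= s -> s <= 1 -> mean2 g r <= mean2 g s.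
Proof.
move=> dg r0; rewrite le_eqVlt => /predU1P[->//|rs] s1.
rewrite leNgt; apply/negP => lt_sr; have s0 := lt_trans r0 rs.
pose q := r / s; have q0 : 0 < q by rewrite divr_gt0.
have q1 : q < 1 by rewrite ltr_pdivrMr// mul1r.
pose x k := s * q ^+ k.
have x0 k : 0 < x k by rewrite mulr_gt0 ?exprn_gt0.
have xS k : x k.+1 <= x k by rewrite /x exprS mulrCA ger_pMl ?ltW// mulr_gt0 ?exprn_gt0.
have x1 k : x k <= 1.
  by elim: k => [|k IH]; [rewrite /x expr0 mulr1|rewrite (le_trans (xS k))].
have xm k : Num.sqrt (x k.+2 * x k) = x k.+1.
  rewrite (_ : x k.+2 * x k = (x k.+1) ^+ 2); last by rewrite /x !exprS; ring.
  by rewrite sqrtr_sqr gtr0_norm.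
have conv k : 2 * mean2 g (x k.+1) <= mean2 g (x k.+2) + mean2 g (x k).
  have := @mean2_dist g (x k.+2) (x k) dg (x0 _) (le_trans (xS _) (xS _)) (x1 k).
  rewrite xm => e; rewrite -subr_ge0 -e.
  by apply: circ_ge0 => z _; exact: sqr_ge0.
pose d := mean2 g r - mean2 g s.
have d0 : 0 < d by rewrite subr_gt0.
have inc k : mean2 g (x k) + d <= mean2 g (x k.+1).
  elim: k => [|k IH]; last by have := conv k; lra.
  have -> : x 0%N = s by rewrite /x expr0 mulr1.
  have -> : x 1%N = r by rewrite /x expr1 mulrC divfK// gt_eqF.
  by rewrite /d; lra.
have lin k : k%:R * d <= mean2 g (x k).
  elim: k => [|k IH]; last by have := inc k; rewrite -natr1 mulrDl mul1r; lra.
  by rewrite mul0r; apply: circ_ge0 => z _; exact: sqr_ge0.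
have [M hM] := closed_disc_bounded (fun z => chol_cont dg (z:=z)).
have ub k : mean2 g (x k) <= twopi * M ^+ 2.
  rewrite -circ_cst; apply: le_Rint.
  - by apply: itc_mean2 => //; rewrite ltW// x1.
  - exact: itg_cst.
  - move=> t t01; have xk : 0 <= x k <= 1 by rewrite x1 ltW.
    have h := hM _ _ xk t01; rewrite lerXn2r// ?nnegrE ?cabs_ge0//.
    exact: le_trans (cabs_ge0 _) h.
have M2 : 0 <= twopi * M ^+ 2 / d.
  by rewrite divr_ge0 ?(ltW d0)// mulr_ge0 ?sqr_ge0// ltW// twopi_gt0.
have := archi_boundP M2.
rewrite ltr_pdivrMr// ltNge => /negP; apply.
exact: (le_trans (lin _) (ub _)).
Qed.

End SquareMeans.

(** * Fejer approximation by real parts of polynomials *)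

Section FejerApproximation.
Context {R : realType}.
Implicit Types (v : R[i] -> R) (z w s : R[i]).

Lemma circle_ei z : cabs z = 1 -> exists2 x : R, 0 <= x <= twopi & z = ei x.
Proof.
case: z => a b ab; have ab2 : a ^+ 2 + b ^+ 2 = 1.
  by have := sqr_cabs (a +i* b); rewrite ab expr1n /= => <-.
have a1 : -1 <= a <= 1.
  by rewrite -ler_norml -[leRHS]sqrtr1 -sqrtr_sqr ler_wsqrtr// -ab2 lerDl sqr_ge0.
have sE : Num.sqrt (1 - a ^+ 2) = `|b|.
  by rewrite -ab2 addrC addKr sqrtr_sqr.
have c0 := acos_ge0 a1; have cpi := acos_lepi a1; have pi0 := @pi_gt0 R.
have [b0|b0] := leP 0 b.
  exists (acos a); first by rewrite /twopi; apply/andP; split; [|rewrite mulr2n]; lra.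
  by rewrite /ei acosK// sin_acos// sE ger0_norm.
exists (twopi - acos a); first by rewrite /twopi mulr2n; apply/andP; split; lra.
rewrite /ei /twopi cosB sinB cos2pi sin2pi acosK// sin_acos// sE ltr0_norm//.
by apply/eqP; rewrite eq_complex /=; apply/andP; split; apply/eqP; ring.
Qed.

(** F - e is negative where D vanishes, so C can be the maximum of the quotient of
the positive part of F - e by D, with a denominator kept away from 0 where that
numerator vanishes. *)
Lemma compact_domination (T : topologicalType) (A : set T) (F D : T -> R) (e : R) :
  A !=set0 -> compact A ->
  (forall x, A x -> {for x, continuous F}) -> (forall x, A x -> {for x, continuous D}) ->
  (forall x, A x -> 0 <= D x) -> (forall x, A x -> D x = 0 -> F x = 0) -> 0 < e ->
  exists2 C : R, 0 <= C & forall x, A x -> F x <= e + C * D x.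
Proof.
move=> A0 cA cF cD D0 DF e0.
pose den x := D x + Num.max (e - F x) 0.
have den0 x : A x -> 0 < den x.
  move=> Ax; rewrite /den; have [Dx0|Dx] := eqVneq (D x) 0.
    by rewrite Dx0 (DF _ Ax Dx0) subr0 add0r lt_max e0.
  by rewrite ltr_wpDr ?le_max ?lexx ?orbT// lt_def Dx D0.
pose h x := Num.max (F x - e) 0 / den x.
have ch x : A x -> {for x, continuous h}.
  move=> Ax; have cst0 : {for x, continuous (fun=> 0 : R)} by exact: cvg_cst.
  have cste : {for x, continuous (fun=> e : R)} by exact: cvg_cst.
  have c1 : {for x, continuous (fun y => Num.max (F y - e) 0)}.
    exact: (continuous_max (cvgB (cF x Ax) cste) cst0).
  have c2 : {for x, continuous (fun y => Num.max (e - F y) 0)}.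
    exact: (continuous_max (cvgB cste (cF x Ax)) cst0).
  have c3 : {for x, continuous den} by exact: (cvgD (cD x Ax) c2).
  have c4 : {for x, continuous (fun y => (den y)^-1)}.
    have d0 : den x != 0 by rewrite gt_eqF// den0.
    exact: (cvgV d0 c3).
  exact: (cvgM c1 c4).
have [c Ac hc] : exists2 c, c \in A & forall t, t \in A -> h t <= h c.
  apply: compact_EVT_max => //.
  by apply: continuous_in_subspaceT => x; rewrite inE => Ax; exact: ch.
exists (h c).
  by apply: divr_ge0; [rewrite le_max lexx orbT|rewrite ltW// den0// -inE].
move=> x Ax; have [Fe|Fe] := leP (F x) e.
  rewrite (le_trans Fe)// lerDl mulr_ge0 ?D0//.
  by apply: divr_ge0; [rewrite le_max lexx orbT|rewrite ltW// den0// -inE].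
have := hc x; rewrite inE => /(_ Ax); rewrite {1}/h /den.
have -> : Num.max (F x - e) 0 = F x - e by apply/max_idPl; lra.
have e2 : Num.max (e - F x) 0 = 0 by apply/max_idPr; lra.
have := den0 x Ax; rewrite /den e2 addr0 => Dx.
by rewrite ler_pdivrMr//; lra.
Qed.

(** Uniform continuity in a form that can be integrated against the Fejer kernel:
the modulus of continuity is bounded by a quantity with an explicit moment. *)
Lemma circle_domination v (e : R) : ccont v -> 0 < e ->
  exists2 C : R, 0 <= C & forall z s, cabs z = 1 -> cabs s = 1 ->
    `|v s - v z| <= e + C * (1 - Re (conjc z * s)).
Proof.
move=> cv e0.
pose F (p : R * R) := `|v (ei p.2) - v (ei p.1)|.
pose D (p : R * R) := 1 - Re (conjc (ei p.1) * ei p.2).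
have ce1 (p : R * R) : {for p, continuous (fun p : R * R => ei p.1)}.
  case: p => a b; have c : (fun p : R * R => p.1) @ (a, b) --> a by exact: cvg_fst.
  exact: (cvg_continuous_at c (@ei_continuous R a)).
have ce2 (p : R * R) : {for p, continuous (fun p : R * R => ei p.2)}.
  case: p => a b; have c : (fun p : R * R => p.2) @ (a, b) --> b by exact: cvg_snd.
  exact: (cvg_continuous_at c (@ei_continuous R b)).
have cvv x : {for ei x, continuous v} by apply: cv; rewrite cabs_ei.
have [||||||C C0 hC] := @compact_domination _ (`[0, twopi] `*` `[0, twopi]) F D e _ _ _ _ _ _ e0.
- by exists (0, 0); split; rewrite /= in_itv/= lexx ltW// twopi_gt0.
- by apply: compact_setX; exact: segment_compact.
- move=> p _.
  have c1 : {for p, continuous (fun p : R * R => v (ei p.1))}.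
    exact: (cvg_continuous_at (ce1 p) (cvv p.1)).
  have c2 : {for p, continuous (fun p : R * R => v (ei p.2))}.
    exact: (cvg_continuous_at (ce2 p) (cvv p.2)).
  exact: (cvg_norm (cvgB c2 c1)).
- move=> p _.
  have c1 : {for p, continuous (fun p : R * R => conjc (ei p.1))}.
    exact: (cvg_continuous_at (ce1 p) (@conjc_continuous R _)).
  have c2 : {for p, continuous (fun p : R * R => conjc (ei p.1) * ei p.2)}.
    exact: (cvgcM c1 (ce2 p)).
  have c3 := continuous_Re c2.
  have c4 : {for p, continuous (fun=> 1 : R)} by exact: cvg_cst.
  exact: (cvgB c4 c3).
- move=> p _; rewrite subr_ge0 (le_trans (ler_norm _))// (le_trans (Re_le_cabs _))//.
  by rewrite cabsM cabsJ !cabs_ei mulr1.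
- move=> p _ /eqP; rewrite subr_eq0 => /eqP ReE.
  set c := conjc (ei p.1) * ei p.2 in ReE.
  have c1 : cabs c = 1 by rewrite cabsM cabsJ !cabs_ei mulr1.
  have Im0 : Im c = 0.
    have := sqr_cabs c; rewrite c1 -ReE expr1n => /eqP.
    by rewrite -subr_eq0 opprD addrA subrr sub0r oppr_eq0 sqrf_eq0 => /eqP.
  have cE : c = 1 by case: (c) ReE Im0 => a b /= <- ->.
  rewrite /F; have -> : ei p.2 = ei p.1.
    by rewrite -[LHS]mul1r -[1](mulfV (ei_neq0 p.1)) -conj_ei -mulrA -/c cE mulr1.
  by rewrite subrr normr0.
exists C => // z s /circle_ei[x x01 ->] /circle_ei[y y01 ->].
by apply: (hC (x, y)); split; rewrite /= in_itv.
Qed.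

Definition fejer_coef (n k : nat) : R := if k is 0%N then 1 else 2 * (1 - k%:R / n.+1%:R).

(** The Fejer kernel is the real part of this polynomial on the circle, hence its
means are values at the centre. *)
Definition fejer n w : R[i] := \sum_(k < n.+1) (fejer_coef n k)%:C * w ^+ k.

Lemma cdiff_fejer n z : cdiff (fejer n) z.
Proof.
apply: (@cdiff_sum R 'I_n.+1 (index_enum _) (fun k w => (fejer_coef n k)%:C * w ^+ k)) => k.
by apply: cdiffM; [exact: cdiff_cst|apply: cdiffX; exact: cdiff_id].
Qed.

Lemma fejer0 n : fejer n 0 = 1.
Proof.
rewrite /fejer big_ord_recl /= expr0 mulr1 big1 ?addr0// => k _.
by rewrite exprS mul0r mulr0.
Qed.

(** Induction on n: passing from n to n + 1 adds the same cross terms to both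
sides. *)
Lemma fejer_sqr n w : cabs w = 1 ->
  n.+1%:R * Re (fejer n w) = cabs (\sum_(k < n.+1) w ^+ k) ^+ 2.
Proof.
move=> w1; have ww k : w ^+ k * conjc (w ^+ k) = 1 by rewrite mulcJ cabsX w1 !expr1n.
have step (a b : R[i]) : cabs (a + b) ^+ 2 = cabs a ^+ 2 + 2 * Re (a * conjc b) + cabs b ^+ 2.
  by rewrite !sqr_cabs; case: a b => [a a'] [b b'] /=; ring.
have ReE m : m.+1%:R * Re (fejer m w)
    = m.+1%:R + 2 * \sum_(k < m) (m - k)%:R * Re (w ^+ k.+1).
  rewrite /fejer big_ord_recl /= expr0 mulr1 raddfD /= mulrDr mulr1; congr (_ + _).
  rewrite (raddf_sum (@Re R)) !mulr_sumr; apply: eq_bigr => k _.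
  rewrite /fejer_coef /bump /= add1n.
  have -> : Re ((2 * (1 - k.+1%:R / m.+1%:R))%:C * w ^+ k.+1)
     = 2 * (1 - k.+1%:R / m.+1%:R) * Re (w ^+ k.+1).
    by case: (w ^+ k.+1) => a b /=; ring.
  have -> : (m - k)%:R = m.+1%:R - k.+1%:R :> R by rewrite -natrB ?subSS// ltnS ltnW.
  by field; rewrite nat1r pnatr_eq0.
elim: n => [|n IH].
  by rewrite mul1r /fejer !big_ord1 !expr0 cabs1 mulr1 expr1n.
rewrite big_ord_recr /= step -IH !ReE cabsX w1 !expr1n.
have -> : Re ((\sum_(i < n.+1) w ^+ i) * conjc (w ^+ n.+1)) = \sum_(k < n.+1) Re (w ^+ k.+1).
  rewrite mulr_suml (raddf_sum (@Re R)) (reindex_inj rev_ord_inj) /=; apply: eq_bigr => k _.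
  rewrite subSS; have kn : (k <= n)%N by rewrite -ltnS.
  have -> : w ^+ n.+1 = w ^+ (n - k) * w ^+ k.+1 by rewrite -exprD addnS subnK.
  rewrite rmorphM /= mulrA ww mul1r.
  by case: (w ^+ k.+1).
have -> : \sum_(k < n.+1) (n.+1 - k)%:R * Re (w ^+ k.+1)
   = \sum_(k < n) (n - k)%:R * Re (w ^+ k.+1) + \sum_(k < n.+1) Re (w ^+ k.+1).
  rewrite !big_ord_recr /= subSn// subnn mul1r addrA -big_split /=; congr (_ + _).
  apply: eq_bigr => k _; rewrite subSn; last exact: ltnW.
  by rewrite -natr1 mulrDl mul1r.
by rewrite -[n.+2%:R]natr1; ring.
Qed.

Lemma fejer_ge0 n w : cabs w = 1 -> 0 <= Re (fejer n w).
Proof.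
by move=> /(fejer_sqr n) e; rewrite -(pmulr_rge0 _ (ltr0Sn R n)) e sqr_ge0.
Qed.

Lemma chol_fejer_rot n z : chol (fun s => fejer n (conjc z * s)).
Proof.
move=> s _; apply: (@cdiff_comp R (fejer n) (fun s => conjc z * s)); last exact: cdiff_fejer.
exact: cdiff_scale.
Qed.

Lemma fejer_mean n z : circ (fun s => Re (fejer n (conjc z * s))) = twopi.
Proof.
by rewrite (holomorphic_mean_value (chol_fejer_rot n z)) mulr0 fejer0 /= mulr1.
Qed.

Lemma fejer_moment n z : cabs z = 1 ->
  circ (fun s => Re (fejer n (conjc z * s)) * (1 - Re (conjc z * s)))
  = twopi / n.+1%:R.
Proof.
move=> z1.
have [q dq qE] : exists2 q : R[i] -> R[i], (forall w, cdiff q w) &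
    forall w, fejer n w = 1 + w * q w /\ q 0 = (1 * 2 * (1 - n.+1%:R^-1))%:C.
  exists (fun w => \sum_(k < n) (fejer_coef n k.+1)%:C * w ^+ k).
    move=> w; apply: (@cdiff_sum R 'I_n (index_enum _) (fun k w => (fejer_coef n k.+1)%:C * w ^+ k)) => k.
    by apply: cdiffM; [exact: cdiff_cst|apply: cdiffX; exact: cdiff_id].
  move=> w; split.
    rewrite /fejer big_ord_recl /= expr0 mulr1 mulr_sumr; congr (_ + _).
    by apply: eq_bigr => k _; rewrite mulrCA -exprS.
  case: n => [|n]; first by rewrite big_ord0 invr1 subrr mulr0.
  rewrite big_ord_recl /= expr0 mulr1 big1 ?addr0 ?mul1r//.
  by move=> k _; rewrite exprS mul0r mulr0.
(* on the circle Re h (w) is Re (fejer n w) (1 - Re w), since conj w = 1 / w there *)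
pose h w := fejer n w - (2^-1)%:C * (fejer n w * w + q w + w).
have dh w : cdiff h w.
  apply: cdiffB; first exact: cdiff_fejer.
  apply: cdiffM; first exact: cdiff_cst.
  apply: cdiffD; last exact: cdiff_id.
  apply: cdiffD => //; apply: cdiffM; [exact: cdiff_fejer|exact: cdiff_id].
have dhz : chol (fun s => h (conjc z * s)).
  move=> s _; apply: (@cdiff_comp R h (fun s => conjc z * s)) => //.
  exact: cdiff_scale.
have := holomorphic_mean_value dhz; rewrite mulr0 /h fejer0 (qE 0).2 mulr0 add0r addr0.
have -> : Re (1 - (2^-1)%:C * (1 * 2 * (1 - n.+1%:R^-1))%:C) = n.+1%:R^-1 :> R.
  rewrite /= mul0r subr0 mul1r mulKf ?pnatr_eq0//.
  by rewrite opprB addrCA subrr addr0.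
move=> <-; apply: eq_circ => s s1.
set w := conjc z * s; have w1 : cabs w = 1 by rewrite cabsM cabsJ z1 s1 mulr1.
have [wE _] := qE w.
have ww : w * conjc w = 1 by rewrite mulcJ w1 expr1n.
have -> : q w = (fejer n w - 1) * conjc w by rewrite wE addrC addKr mulrAC ww mul1r.
have alg (a b : R[i]) : Re a * (1 - Re b) =
    Re (a - (2^-1)%:C * (a * b + (a - 1) * conjc b + b)).
  by case: a b => [a a'] [b b'] /=; field.
exact: alg.
Qed.

Definition circ_moment v k : R[i] :=
  circ (fun s => Re (conjc s ^+ k) * v s) +i* circ (fun s => Im (conjc s ^+ k) * v s).

(** The convolution of v with the Fejer kernel, up to the imaginary part. *)
Definition fejer_poly n v z : R[i] :=
  \sum_(k < n.+1) (fejer_coef n k / twopi)%:C * circ_moment v k * z ^+ k.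

Lemma cdiff_fejer_poly n v z : cdiff (fejer_poly n v) z.
Proof.
apply: (@cdiff_sum R 'I_n.+1 (index_enum _)
  (fun k z => (fejer_coef n k / twopi)%:C * circ_moment v k * z ^+ k)) => k.
by apply: cdiffM; [exact: cdiff_cst|apply: cdiffX; exact: cdiff_id].
Qed.

Lemma circ_sum (I : Type) (r : seq I) (f : I -> R[i] -> R) : (forall k, ccont (f k)) ->
  circ (fun s => \sum_(k <- r) f k s) = \sum_(k <- r) circ (f k) /\
  ccont (fun s => \sum_(k <- r) f k s).
Proof.
move=> cf; elim: r => [|a r [IH1 IH2]].
  rewrite big_nil (_ : (fun=> _) = fun=> 0); last by apply/funext => s; rewrite big_nil.
  by split; [rewrite circ_cst mulr0|exact: ccont_cst].
rewrite big_cons -IH1 (_ : (fun s => _) = fun s => f a s + \sum_(k <- r) f k s); last first.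
  by apply/funext => s; rewrite big_cons.
by split; [rewrite circD//; exact: itc_ccont|exact: ccontD].
Qed.

Lemma fejer_polyE n v z : ccont v ->
  twopi * Re (fejer_poly n v z)
  = circ (fun s => Re (fejer n (z * conjc s)) * v s).
Proof.
move=> cv.
have cs k : forall s, cabs s = 1 -> {for s, continuous (fun s => conjc s ^+ k)}.
  move=> s _; elim: k => [|k IH].
    by rewrite (_ : (fun=> _) = fun=> 1); [exact: contc_cst|apply/funext => t; rewrite expr0].
  rewrite (_ : (fun t => _) = fun t => conjc t * conjc t ^+ k).
    exact: (cvgcM (@conjc_continuous R s) IH).
  by apply/funext => t; rewrite exprS.
have cRe k : ccont (fun s => Re (conjc s ^+ k) * v s).
  by apply: ccontM => //; apply: ccont_Re; exact: cs.
have cIm k : ccont (fun s => Im (conjc s ^+ k) * v s).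
  apply: ccontM => // s s1; exact: (cvg_continuous_at (cs k s s1) (@Im_continuous R _)).
pose f k s := fejer_coef n k * (Re (z ^+ k) * (Re (conjc s ^+ k) * v s)
   - Im (z ^+ k) * (Im (conjc s ^+ k) * v s)).
have cf k : ccont (f k).
  apply: ccontM; first exact: ccont_cst.
  by apply: ccontB; apply: ccontM => //; exact: ccont_cst.
have -> : circ (fun s => Re (fejer n (z * conjc s)) * v s) = circ (fun s => \sum_(k < n.+1) f k s).
  apply: eq_circ => s _; rewrite /fejer (raddf_sum (@Re R)) mulr_suml.
  apply: eq_bigr => k _; rewrite /f exprMn.
  by case: (z ^+ k) (conjc s ^+ k) => [a a'] [b b'] /=; ring.
rewrite (@circ_sum _ _ (fun k : 'I_n.+1 => f k) (fun k => cf k)).1.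
rewrite /fejer_poly (raddf_sum (@Re R)) mulr_sumr; apply: eq_bigr => k _.
have cR1 := itc_ccont (cRe k); have cI1 := itc_ccont (cIm k).
rewrite /f circZ; last by apply: itcB; exact: itcZ.
rewrite circB; [|exact: itcZ|exact: itcZ].
rewrite !circZ// /circ_moment.
have t0 : twopi != 0 :> R by rewrite gt_eqF// twopi_gt0.
by move: (@twopi R) t0 => T t0; case: (z ^+ k) => a b /=; field.
Qed.

Lemma fejer_conj n w : fejer n (conjc w) = conjc (fejer n w).
Proof.
rewrite /fejer (rmorph_sum (@conjc R)); apply: eq_bigr => i _.
by rewrite rmorphM rmorphXn; congr (_ * _); rewrite /= oppr0.
Qed.

Lemma fejer_approx v (e : R) : ccont v -> 0 < e ->
  exists2 p : R[i] -> R[i], (forall z, cdiff p z) &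
    forall z, cabs z = 1 -> `|Re (p z) - v z| <= e.
Proof.
move=> cv e0; have e2 : 0 < e / 2 by rewrite divr_gt0.
have [C C0 hC] := circle_domination cv e2.
have [n hn] : exists n : nat, C / n.+1%:R <= e / 2.
  have C2 : 0 <= C / (e / 2) by rewrite divr_ge0// ltW.
  exists (Num.bound (C / (e / 2))); have := archi_boundP C2.
  rewrite ltr_pdivrMr// => h; rewrite ler_pdivrMr ?ltr0Sn// mulrC -natr1 mulrDl mul1r.
  by apply: ltW; rewrite (lt_trans h)// ltrDl.
exists (fejer_poly n v); first exact: cdiff_fejer_poly.
move=> z z1; have tp := @twopi_gt0 R.
pose k s := Re (fejer n (conjc z * s)).
have ck : ccont k by apply: (ccont_chol_Re (chol_fejer_rot n z)).
have kE s : Re (fejer n (z * conjc s)) = k s.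
  rewrite /k; have -> : z * conjc s = conjc (conjc z * s) by rewrite rmorphM /= conjcK.
  rewrite fejer_conj.
  by case: (fejer _ _).
rewrite -(ler_pM2l tp) -[twopi in leLHS](gtr0_norm tp) -normrM mulrBr fejer_polyE//.
have -> : circ (fun s => Re (fejer n (z * conjc s)) * v s) = circ (fun s => k s * v s).
  by apply: eq_circ => s _; rewrite kE.
have -> : twopi * v z = circ (fun s => v z * k s).
  by rewrite circZ; [rewrite fejer_mean mulrC|exact: itc_ccont].
have i1 := itc_ccont (ccontM ck cv); have i2 := itcZ (v z) (itc_ccont ck).
rewrite -circB//.
have c3 : ccont (fun s => 1 - Re (conjc z * s)).
  apply: ccontB; first exact: ccont_cst.
  by apply: ccont_Re => s _; exact: (cvgcM (contc_cst (conjc z) s) (contc_id s)).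
have i3 := itc_ccont (ccontM ck c3).
apply: (@le_trans _ _ (circ (fun s => (e / 2) * k s + C * (k s * (1 - Re (conjc z * s)))))).
  apply: (le_trans (le_norm_Rint (itcB i1 i2))).
  apply: (@le_circ R (fun s => `|k s * v s - v z * k s|)).
  - exact: itg_norm (itcB i1 i2).
  - by apply: itcD; apply: itcZ => //; exact: itc_ccont.
  - move=> s s1; have k0 : 0 <= k s by apply: fejer_ge0; rewrite cabsM cabsJ z1 s1 mulr1.
    have -> : k s * v s - v z * k s = k s * (v s - v z) by ring.
    rewrite normrM ger0_norm//; have := ler_wpM2l k0 (hC z s z1 s1).
    by rewrite mulrDr [e / 2 * _]mulrC [C * (k s * _)]mulrCA.
rewrite circD; [|by apply: itcZ; exact: itc_ccont|exact: itcZ].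
rewrite !circZ//; last exact: itc_ccont.
rewrite fejer_mean fejer_moment//.
have -> : e / 2 * twopi + C * (twopi / n.+1%:R) = twopi * (e / 2 + C / n.+1%:R) by ring.
by rewrite ler_pM2l// [leRHS]splitr lerD2l.
Qed.

End FejerApproximation.

(** * Factorization and means of the modulus *)

Section OuterFactor.
Context {R : realType}.
Implicit Types (f g : R[i] -> R[i]) (z t : R[i]) (r s e : R).

Lemma chol_bounded f : chol f -> exists M : R, forall z, cabs z = 1 -> cabs (f z) <= M.
Proof.
move=> df; have [M hM] := closed_disc_bounded (fun z => chol_cont df (z:=z)).
exists M => z /circle_ei[x x01 ->].
by have := hM 1 x; rewrite mul1r; apply => //; rewrite ler01 lexx.
Qed.

(** E = exp (q) with 2 Re q within h of log (|f| + e/2) + h on the circle.  Here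
2 h = log (1 + (e/2) / (M + e/2)) with M a bound of |f|, so that the relative error is
an absolute error of at most e/2. *)
Lemma outer_factor f e : chol f -> 0 < e -> exists E : R[i] -> R[i],
  [/\ chol E, forall z, E z != 0 & forall z, cabs z = 1 ->
    cabs (f z) <= cabs (E z) ^+ 2 <= cabs (f z) + e].
Proof.
move=> df e0; have [M hM] := chol_bounded df.
pose d := e / 2; have d0 : 0 < d by rewrite divr_gt0.
have M0 : 0 <= M by apply: (le_trans (cabs_ge0 (f 1))); apply: hM; rewrite cabs1.
have Md : 0 < M + d by rewrite ltr_wpDl.
pose u := 1 + d / (M + d).
have u1 : 1 < u by rewrite ltrDl divr_gt0.
have u0 : 0 < u by rewrite (lt_trans _ u1).
pose h := ln u / 2; have h0 : 0 < h by rewrite divr_gt0// ln_gt0.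
have cv : ccont (fun z => ln (cabs (f z) + d)).
  have c1 : ccont (fun z => cabs (f z) + d).
    by apply: ccontD; [exact: ccont_chol_cabs|exact: ccont_cst].
  move=> z z1; apply: (cvg_continuous_at (c1 z z1)); apply: continuous_ln.
  by rewrite ltr_wpDl// cabs_ge0.
have [p dp hp] := fejer_approx cv h0.
pose q z := (2^-1)%:C * (p z + h%:C).
have dq z : cdiff q z.
  by apply: cdiffM; [exact: cdiff_cst|apply: cdiffD; [exact: dp|exact: cdiff_cst]].
exists (fun z => cexp (q z)); split.
- by move=> z _; apply: (cdiff_comp (f := cexp)); [exact: dq|exact: cdiff_cexp].
- by move=> z; exact: cexp_neq0.
- move=> z z1; rewrite cabs_cexp -expRM_natl.
  have -> : 2 * Re (q z) = Re (p z) + h.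
    by rewrite /q; case: (p z) => a b /=; field.
  have fd : 0 < cabs (f z) + d by rewrite ltr_wpDl// cabs_ge0.
  have := hp z z1; rewrite ler_norml => /andP[l1 l2]; apply/andP; split.
    apply: (@le_trans _ _ (cabs (f z) + d)); first by rewrite lerDl ltW.
    by rewrite -[leLHS]lnK ?posrE// ler_expR; lra.
  apply: (@le_trans _ _ (expR (ln (cabs (f z) + d) + ln u))).
    by rewrite ler_expR; rewrite /h in l2 *; lra.
  rewrite expRD !lnK ?posrE// /u mulrDr mulr1.
  have : (cabs (f z) + d) * (d / (M + d)) <= d.
    by rewrite mulrCA ger_pMr// ler_pdivrMr// mul1r lerD2r hM.
  by rewrite /d; lra.
Qed.

Definition mean1 f r : R := circ (fun z => cabs (f (r%:C * z))).

Lemma itc_mean1 f r : chol f -> 0 <= r <= 1 -> itc (fun z => cabs (f (r%:C * z))).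
Proof. by move=> df r01; apply/itc_ccont/ccont_chol_cabs/chol_dil. Qed.

Lemma mean2_1 f : mean2 f 1 = circ (fun z => cabs (f z) ^+ 2).
Proof. by apply: eq_circ => z _; rewrite mul1r. Qed.

Lemma mean1_1 f : mean1 f 1 = circ (fun z => cabs (f z)).
Proof. by apply: eq_circ => z _; rewrite mul1r. Qed.

Lemma sqrt_bounds r : 0 < r -> r <= 1 -> [/\ 0 < Num.sqrt r, Num.sqrt r <= 1 & r <= Num.sqrt r].
Proof.
move=> r0 r1; have s1 : Num.sqrt r <= 1 by rewrite -[leRHS]sqrtr1 ler_wsqrtr.
split => //; first by rewrite sqrtr_gt0.
by rewrite -[leLHS](sqr_sqrtr (ltW r0)) expr2 ler_piMr// sqrtr_ge0.
Qed.

Lemma mean2_drop g r : chol g -> 0 < r -> r <= 1 ->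
  circ (fun z => cabs (g (r%:C * z) - g z) ^+ 2) <= mean2 g 1 - mean2 g (Num.sqrt r).
Proof.
move=> dg r0 r1; have [s0 s1 rs] := sqrt_bounds r0 r1.
have := mean2_dist dg r0 r1 (lexx 1); rewrite mulr1.
have -> : circ (fun z => cabs (g (r%:C * z) - g (1%:C * z)) ^+ 2) =
   circ (fun z => cabs (g (r%:C * z) - g z) ^+ 2).
  by apply: eq_circ => z _; rewrite mul1r.
by move=> ->; have := mean2_mono dg r0 rs s1; lra.
Qed.

Section Factorization.
Variables (f E : R[i] -> R[i]) (A : R).
Hypotheses (df : chol f) (dE : chol E) (E0 : forall z, E z != 0).
Hypothesis fE : forall z, cabs z = 1 -> cabs (f z) <= cabs (E z) ^+ 2.
Hypothesis EA : mean2 E 1 <= A.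

Let K z := f z * (E z)^-1.

Let dK : chol K.
Proof. by move=> z z1; apply: cdiffM; [exact: df|apply: cdiff_inv => //; exact: dE]. Qed.

Let fEK z : f z = E z * K z.
Proof. by rewrite /K mulrC divfK. Qed.

(* maximum principle for f / E^2 *)
Let fE_in z : cabs z <= 1 -> cabs (f z) <= cabs (E z) ^+ 2.
Proof.
move=> z1; pose Q z := K z * (E z)^-1.
have dQ : chol Q by move=> w w1; apply: cdiffM; [exact: dK|apply: cdiff_inv => //; exact: dE].
have cE w : 0 < cabs (E w) by rewrite cabs_gt0.
have QE w : cabs (Q w) = cabs (f w) / cabs (E w) ^+ 2.
  by rewrite /Q /K !cabsM cabsV -mulrA -invfM expr2.
have := @maximum_principle R Q 1 z dQ _ z1; rewrite QE ler_pdivrMr ?exprn_gt0// mul1r; apply.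
by move=> w w1; rewrite QE ler_pdivrMr ?exprn_gt0// mul1r fE.
Qed.

Let A_ge0 : 0 <= A.
Proof. by apply: le_trans EA; apply: circ_ge0 => z _; exact: sqr_ge0. Qed.

Let mean1_le s : 0 < s -> s <= 1 -> mean1 f s <= mean2 E s.
Proof.
move=> s0 s1; have s01 : 0 <= s <= 1 by rewrite ltW.
apply: le_circ; [exact: itc_mean1|exact: itc_mean2|].
move=> z z1; apply: fE_in; rewrite cabsM z1 mulr1 cabsR gtr0_norm//.
Qed.

Lemma factor_mean1_le s : 0 < s -> s <= 1 -> mean1 f s <= A.
Proof.
move=> s0 s1; apply: (le_trans (mean1_le s0 s1)); apply: le_trans EA.
exact: mean2_mono.
Qed.

Let K2_le : mean2 K 1 <= A.
Proof.
apply: le_trans (factor_mean1_le ltr01 (lexx 1)); rewrite mean2_1 mean1_1.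
apply: le_circ.
- exact/itc_ccont/ccontX/ccont_chol_cabs.
- exact/itc_ccont/ccont_chol_cabs.
move=> z z1; have cE : 0 < cabs (E z) by rewrite cabs_gt0.
rewrite /K cabsM cabsV exprMn exprVn ler_pdivrMr ?exprn_gt0// expr2.
by rewrite ler_wpM2l ?cabs_ge0// fE.
Qed.

Let mean1_CS s : 0 < s -> s <= 1 -> mean1 f s ^+ 2 <= A * mean2 K s.
Proof.
move=> s0 s1; have s01 : 0 <= s <= 1 by rewrite ltW.
have cE := ccont_chol_cabs (chol_dil dE s01).
have cK := ccont_chol_cabs (chol_dil dK s01).
have -> : mean1 f s = circ (fun z => cabs (E (s%:C * z)) * cabs (K (s%:C * z))).
  by apply: eq_circ => z _; rewrite -cabsM -fEK.
apply: (le_trans (circ_CS cE cK)); apply: ler_wpM2r.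
  by apply: circ_ge0 => z _; exact: sqr_ge0.
by apply: le_trans EA; exact: mean2_mono.
Qed.

(** f_r - f = E (K_r - K) + K_r (E_r - E).  By Cauchy-Schwarz and [mean2_drop] the
two terms are controlled by the increase of the square means of K and of E, and both
increases are bounded by that of the means of |f|. *)
Lemma factor_dist r : 0 < r -> r <= 1 ->
  (circ (fun z => cabs (f (r%:C * z) - f z))) ^+ 2 <= 6 * A * (A - mean1 f (Num.sqrt r)).
Proof.
move=> r0 r1; have [s0 s1 rs] := sqrt_bounds r0 r1; set s := Num.sqrt r in s0 s1 rs *.
have r01 : 0 <= r <= 1 by rewrite ltW.
have dEr := chol_dil dE r01; have dKr := chol_dil dK r01.
have dED : chol (fun z => E (r%:C * z) - E z) by move=> z z1; apply: cdiffB; [exact: dEr|exact: dE].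
have dKD : chol (fun z => K (r%:C * z) - K z) by move=> z z1; apply: cdiffB; [exact: dKr|exact: dK].
have cE := ccont_chol_cabs dE; have cKr := ccont_chol_cabs dKr.
have cED := ccont_chol_cabs dED; have cKD := ccont_chol_cabs dKD.
set a := mean1 f s.
pose X := circ (fun z => cabs (E z) * cabs (K (r%:C * z) - K z)).
pose Y := circ (fun z => cabs (K (r%:C * z)) * cabs (E (r%:C * z) - E z)).
have X0 : 0 <= X by apply: circ_ge0 => z _; rewrite mulr_ge0// cabs_ge0.
have Y0 : 0 <= Y by apply: circ_ge0 => z _; rewrite mulr_ge0// cabs_ge0.
have XY : circ (fun z => cabs (f (r%:C * z) - f z)) <= X + Y.
  rewrite -circD; [|exact/itc_ccont/ccontM|exact/itc_ccont/ccontM].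
  apply: le_circ.
  - apply/itc_ccont/ccont_chol_cabs => z z1; apply: cdiffB; last exact: df.
    exact: (chol_dil df r01 z1).
  - by apply/itc_ccont/ccontD; exact: ccontM.
  - move=> z _; rewrite !fEK.
    have -> : E (r%:C * z) * K (r%:C * z) - E z * K z =
       E z * (K (r%:C * z) - K z) + K (r%:C * z) * (E (r%:C * z) - E z) by ring.
    by rewrite -!cabsM cabsD.
have aA : a <= A by exact: factor_mean1_le.
have a0 : 0 <= a by apply: circ_ge0 => z _; exact: cabs_ge0.
have X2 : X ^+ 2 <= 2 * A * (A - a).
  apply: (le_trans (circ_CS cE cKD)); rewrite -mean2_1.
  have D0 : 0 <= circ (fun z => cabs (K (r%:C * z) - K z) ^+ 2).
    by apply: circ_ge0 => z _; exact: sqr_ge0.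
  apply: (le_trans (ler_wpM2r D0 EA)).
  apply: (le_trans (ler_wpM2l A_ge0 (mean2_drop dK r0 r1))); rewrite -/s.
  have := mean1_CS s0 s1; have := ler_wpM2l A_ge0 K2_le; rewrite -/a.
  have : 0 <= (A - a) ^+ 2 by exact: sqr_ge0.
  by lra.
have Y2 : Y ^+ 2 <= A * (A - a).
  apply: (le_trans (circ_CS cKr cED)).
  have D0 : 0 <= circ (fun z => cabs (E (r%:C * z) - E z) ^+ 2).
    by apply: circ_ge0 => z _; exact: sqr_ge0.
  apply: (le_trans (ler_wpM2r D0 (le_trans (mean2_mono dK r0 r1 (lexx 1)) K2_le))).
  apply: ler_wpM2l => //; apply: (le_trans (mean2_drop dE r0 r1)); rewrite -/s.
  by have := mean1_le s0 s1; have := EA; rewrite -/a; lra.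
apply: (@le_trans _ _ ((X + Y) ^+ 2)).
  by rewrite lerXn2r// ?nnegrE ?addr_ge0//; apply: circ_ge0 => z _; exact: cabs_ge0.
have : 0 <= (X - Y) ^+ 2 by exact: sqr_ge0.
by lra.
Qed.

End Factorization.

Lemma approx_factor f e : chol f -> 0 < e ->
  (forall s, 0 < s -> s <= 1 -> mean1 f s <= mean1 f 1 + e) /\
  (forall r, 0 < r -> r <= 1 ->
    (circ (fun z => cabs (f (r%:C * z) - f z))) ^+ 2
      <= 6 * (mean1 f 1 + e) * (mean1 f 1 + e - mean1 f (Num.sqrt r))).
Proof.
move=> df e0; have tp := @twopi_gt0 R.
have [E [dE E0 fE]] := outer_factor df (divr_gt0 e0 tp).
have fE1 z : cabs z = 1 -> cabs (f z) <= cabs (E z) ^+ 2 by move=> /fE/andP[].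
have EA : mean2 E 1 <= mean1 f 1 + e.
  have -> : e = circ (fun=> e / twopi) by rewrite circ_cst mulrC divfK// gt_eqF.
  have i1 := itc_ccont (ccont_chol_cabs df).
  have i2 : itc (fun=> e / twopi : R) by apply: itc_ccont; exact: ccont_cst.
  rewrite mean2_1 mean1_1 -circD//; apply: le_circ.
  - exact/itc_ccont/ccontX/ccont_chol_cabs.
  - exact: itcD.
  - by move=> z /fE/andP[].
split=> s s0 s1; first exact: (factor_mean1_le df dE E0 fE1 EA).
exact: (factor_dist df dE E0 fE1 EA).
Qed.

Lemma mean1_mono1 f s : chol f -> 0 < s -> s <= 1 -> mean1 f s <= mean1 f 1.
Proof.
move=> df s0 s1; apply/ler_addgt0Pr => e e0.
by have [h _] := approx_factor df e0; exact: h.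
Qed.

(** Let e tend to 0 in [approx_factor]. *)
Lemma mean1_dist f r : chol f -> 0 < r -> r <= 1 ->
  (circ (fun z => cabs (f (r%:C * z) - f z))) ^+ 2
    <= 6 * mean1 f 1 * (mean1 f 1 - mean1 f (Num.sqrt r)).
Proof.
move=> df r0 r1; have [s0 s1 rs] := sqrt_bounds r0 r1.
set A := mean1 f 1; set a := mean1 f (Num.sqrt r).
have A0 : 0 <= A by apply: circ_ge0 => z _; exact: cabs_ge0.
have a0 : 0 <= a by apply: circ_ge0 => z _; exact: cabs_ge0.
apply/ler_addgt0Pr => e e0.
pose d := Num.min 1 (e / (6 * (2 * A + 1))).
have den : 0 < 6 * (2 * A + 1) by lra.
have d0 : 0 < d by rewrite lt_min ltr01 divr_gt0.
have d1 : d <= 1 by rewrite ge_min lexx.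
have de : d * (6 * (2 * A + 1)) <= e by rewrite -ler_pdivlMr// ge_min lexx orbT.
have [_ /(_ r r0 r1)] := approx_factor df d0; rewrite -/A -/a => h.
apply: (le_trans h).
have : 0 <= d * a by rewrite mulr_ge0// ltW.
have : d * d <= d * 1 by rewrite ler_wpM2l// ltW.
by lra.
Qed.

End OuterFactor.

(** * Limits of rapidly Cauchy sequences *)

Section RapidlyCauchy.
Context {R : realType}.
Variables (a b : R) (f_ : nat -> R -> R) (M : R).
Hypothesis if_ : forall k, itg a b (f_ k).
Hypothesis sum_le : forall n,
  \sum_(0 <= k < n) Rint a b (fun x => `|f_ k.+1 x - f_ k x|) <= M.

Local Notation mu := (@lebesgue_measure R).

(* f_ preceded by 0, so that its increments sum to f_ *)
Let p k := if k is k'.+1 then f_ k' else fun=> 0.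
Let d k x := `|p k.+1 x - p k x|.

Let itg_p k : itg a b (p k).
Proof. by case: k => [|k]; [exact: (itg_cst a b 0)|exact: if_]. Qed.

Let itg_d k : itg a b (d k).
Proof. by apply: itg_norm; exact: itgB. Qed.

Let d_ge0 k x : 0 <= d k x.
Proof. exact: normr_ge0. Qed.

Let G x := (\sum_(k <oo) (d k x)%:E)%E.

Let int_G : mu.-integrable `[a, b] G.
Proof.
apply/integrableP; split.
  apply: (@ge0_emeasurable_sum _ _ _ _ (fun k x => (d k x)%:E) xpredT) => [k x _ _|k _].
    by rewrite lee_fin.
  exact: measurable_int (itg_d k).
have absG x : (`|G x| = G x)%E.
  by apply: gee0_abs; apply: nneseries_ge0 => n _ _; rewrite lee_fin.
under eq_integral do rewrite absG.
rewrite integral_nneseries//; last 2 first.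
- by move=> k; exact: measurable_int (itg_d k).
- by move=> k x _; rewrite lee_fin.
apply: (@le_lt_trans _ _ (Rint a b (fun x => `|f_ 0%N x|) + M)%:E); last exact: ltry.
apply: lime_le.
  by apply: is_cvg_ereal_nneg_natsum => k _; apply: integral_ge0 => x _; rewrite lee_fin.
apply: nearW => n.
have dE k : (\int[mu]_(x in `[a, b]) (d k x)%:E = (Rint a b (d k))%:E)%E.
  by rewrite /Rint fineK//; apply: integrable_fin_num => //; exact: itg_d.
under eq_bigr do rewrite dE; rewrite sumEFin lee_fin.
have R0 k : 0 <= Rint a b (d k) by apply: Rint_ge0.
apply: (@le_trans _ _ (\sum_(0 <= k < n.+1) Rint a b (d k))).
  by rewrite [leRHS]big_nat_recr//= lerDl.
rewrite big_nat_recl// lerD//.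
by rewrite le_eqVlt; apply/orP; left; apply/eqP/eq_Rint => x _; rewrite /d /= subr0.
Qed.

Let f_tele n x : f_ n x = \sum_(0 <= k < n.+1) (p k.+1 x - p k x).
Proof. by rewrite telescope_sumr// subr0. Qed.

Let f_le_G n x : (`|(f_ n x)%:E| <= G x)%E.
Proof.
rewrite f_tele; apply: (@le_trans _ _ (\sum_(0 <= k < n.+1) (d k x)%:E)%E).
  by rewrite sumEFin lee_fin ler_norm_sum.
by apply: nneseries_lim_ge => k _ _; rewrite lee_fin.
Qed.

Let f_cvg x : G x \is a fin_num -> cvgn (fun n => f_ n x).
Proof.
move=> Gx; have : cvgn (series (fun k => p k.+1 x - p k x)).
  apply: normed_cvg; apply: nondecreasing_is_cvgn.
    by apply: nondecreasing_series => k _ _ /=.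
  exists (fine (G x)) => _ [n _ <-] /=; rewrite -lee_fin fineK// /series /= -sumEFin.
  by apply: nneseries_lim_ge => k _ _; rewrite lee_fin.
have E : (fun n => f_ n x) = (fun n => series (fun k => p k.+1 x - p k x) n.+1).
  by apply/funext => n; rewrite f_tele.
rewrite E => /cvg_ex[l hl]; apply/cvg_ex; exists l.
by rewrite (cvg_shiftS (series _)).
Qed.

(** Completeness of L^1.  The integrable function G, the sum of the moduli of the
increments, dominates the sequence and makes it converge wherever G is finite. *)
Lemma rapid_limit : exists u : R -> R, itg a b u /\
  Rint a b (fun x => `|f_ n x - u x|) @[n --> \oo] --> 0.
Proof.
have mI : @measurable _ (g_sigma_algebraType R.-ocitv.-measurable) `[a, b] by exact: measurable_itv.
pose u x := fine (limn_esup (fun n => (f_ n x)%:E)).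
have mfn n := @measurable_int _ _ _ mu _ _ (if_ n).
have mu_ : measurable_fun `[a, b] (EFin \o u).
  apply/measurable_EFinP; rewrite /u.
  apply: (@measurableT_comp _ _ _ _ _ _ fine _ (fun x => limn_esup (fun n => (f_ n x)%:E))) => //.
  exact: (measurable_fun_limn_esup mfn).
have aecvg : {ae mu, forall x, `[a, b]%classic x -> (f_ n x)%:E @[n --> \oo] --> (u x)%:E}.
  have := integrable_ae mI int_G.
  apply: filterS => x h xab; have := f_cvg (h xab) => /cvg_ex[l fl].
  have flE : (f_ n x)%:E @[n --> \oo] --> l%:E by apply: cvg_EFin => //; exact: nearW.
  by rewrite /u (cvg_limn_einf_sup flE).2.
have aele : {ae mu, forall x n, `[a, b]%classic x -> (`|(f_ n x)%:E| <= G x)%E}.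
  by apply: aeW => x n _; exact: f_le_G.
have [iu + _] := dominated_convergence mI mfn mu_ aecvg int_G aele.
move=> h; exists u; split => //.
by apply: fine_cvg.
Qed.

End RapidlyCauchy.

(** * Scalar functions of class H^1 *)

Section HardyOne.
Context {R : realType}.
Implicit Types (g : R[i] -> R[i]) (z t : R[i]) (r s e : R).

Definition dhol g := forall z, cabs z < 1 -> cdiff g z.

Definition hardy1 g := dhol g /\
  exists M : R, forall r, 0 < r -> r < 1 -> mean1 g r <= M.

Lemma chol_dhol_dil g r : dhol g -> 0 <= r < 1 -> chol (fun z => g (r%:C * z)).
Proof.
move=> dg /andP[r0 r1] z z1; apply: (@cdiff_comp R g (fun z => r%:C * z)).
  exact: cdiff_scale.
apply: dg; rewrite cabsM cabsR ger0_norm//; apply: le_lt_trans r1.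
by rewrite ler_piMr.
Qed.

Lemma mean1_dil g r s : mean1 (fun z => g (r%:C * z)) s = mean1 g (r * s).
Proof. by apply: eq_circ => z _; rewrite rmorphM mulrA. Qed.

Lemma mean1_mono g r s : dhol g -> 0 < r -> r <= s -> s < 1 -> mean1 g r <= mean1 g s.
Proof.
move=> dg r0 rs s1; have s0 := lt_le_trans r0 rs.
have dgs : chol (fun z => g (s%:C * z)) by apply: chol_dhol_dil => //; rewrite ltW.
have e : s * (r / s) = r by rewrite mulrC divfK// gt_eqF.
have := mean1_mono1 dgs (s := r / s).
rewrite !mean1_dil mulr1 e; apply; first exact: divr_gt0.
by rewrite ler_pdivrMr// mul1r.
Qed.

(** The means of |g| increase to a finite supremum, so their increments, which bound
the L^1 distance of two dilates by [mean1_dist], tend to 0. *)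
Lemma hardy1_cauchy g e : hardy1 g -> 0 < e -> exists s, [/\ 0 < s, s < 1 &
  forall r u, s <= r -> r <= u -> u < 1 ->
    circ (fun z => cabs (g (r%:C * z) - g (u%:C * z))) <= e].
Proof.
move=> [dg [M gM]] e0.
pose S : set R := [set mean1 g r | r in [set r | 0 < r < 1]].
have half01 : 0 < (2^-1 : R) < 1 by rewrite invr_gt0 ltr0n invf_lt1 ?ltr1n.
have S0 : S !=set0 by exists (mean1 g 2^-1); exists 2^-1.
have hS : has_sup S by split => //; exists M => _ [r /andP[r0 r1] <-]; exact: gM.
set A := sup S; have leA r : 0 < r -> r < 1 -> mean1 g r <= A.
  by move=> r0 r1; apply: sup_upper_bound => //; exists r => //=; rewrite r0.
have m0 r : 0 <= mean1 g r by apply: circ_ge0 => z _; exact: cabs_ge0.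
have A0 : 0 <= A by move/andP: half01 => [h0 h1]; exact: le_trans (m0 _) (leA _ h0 h1).
pose d := e ^+ 2 / (6 * (A + 1)).
have A1 : 0 < 6 * (A + 1) by lra.
have d0 : 0 < d by rewrite divr_gt0// exprn_gt0.
have [_ [s /andP[s0 s1] <-] hs] := sup_adherent d0 hS.
exists s; split => // r u sr ru u1; have r0 := lt_le_trans s0 sr.
have u0 := lt_le_trans r0 ru.
have dgu : chol (fun z => g (u%:C * z)) by apply: chol_dhol_dil => //; rewrite ltW.
have q0 : 0 < r / u by rewrite divr_gt0.
have q1 : r / u <= 1 by rewrite ler_pdivrMr// mul1r.
have [sq0 sq1 sqq] := sqrt_bounds q0 q1.
have := mean1_dist dgu q0 q1; rewrite !mean1_dil mulr1.
have -> : circ (fun z => cabs (g (u%:C * ((r / u)%:C * z)) - g (u%:C * z)))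
    = circ (fun z => cabs (g (r%:C * z) - g (u%:C * z))).
  apply: eq_circ => z _; congr (cabs (g _ - _)).
  by rewrite mulrA -rmorphM [u * _]mulrC divfK// gt_eqF.
set X := circ _ => hX.
have X0 : 0 <= X by apply: circ_ge0 => z _; exact: cabs_ge0.
rewrite -(ler_pXn2r (n:=2))// ?nnegrE//; last exact: ltW.
apply: (le_trans hX).
have uA := leA u u0 u1.
have us : mean1 g s <= mean1 g (u * Num.sqrt (r / u)).
  apply: mean1_mono => //.
    apply: (le_trans sr); have -> : r = u * (r / u) by rewrite mulrC divfK// gt_eqF.
    rewrite ler_wpM2l ?(ltW u0)//.
    by have -> : u * (r / u) / u = r / u by rewrite [u * _]mulrC mulfK// gt_eqF.
  by apply: (le_lt_trans _ u1); rewrite ler_piMr// ltW.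
have de : 6 * (A + 1) * d = e ^+ 2 by rewrite mulrC divfK// gt_eqF.
have h1 : mean1 g u - mean1 g (u * Num.sqrt (r / u)) <= d by rewrite -/A in hs; lra.
apply: (@le_trans _ _ (6 * mean1 g u * d)).
  by rewrite ler_wpM2l// mulr_ge0.
rewrite -de ler_wpM2r// ?ltW//.
by lra.
Qed.

Definition disc_radius (n : nat) : R := 1 - n.+2%:R^-1.

Lemma disc_radius_bounds n : 0 < disc_radius n < 1.
Proof.
rewrite /disc_radius subr_gt0 invf_lt1 ?ltr0n// ltr1n /=.
by rewrite ltrBlDr ltrDl invr_gt0 ltr0n.
Qed.

Lemma disc_radius_le m n : (m <= n)%N -> disc_radius m <= disc_radius n.
Proof. by move=> mn; rewrite lerD2l lerN2 lef_pV2 ?posrE ?ltr0n// ler_nat !ltnS. Qed.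

Lemma disc_radius_ge s : s < 1 -> exists m, s <= disc_radius m.
Proof.
move=> s1; have h : 0 < 1 - s by rewrite subr_gt0.
have := archi_boundP (x := (1 - s)^-1); rewrite invr_ge0 ltW// => /(_ isT).
set m := Num.bound _ => hm; exists m.
rewrite /disc_radius lerBrDr -lerBrDl invf_ple ?posrE ?ltr0n//.
by rewrite ltW// (lt_trans hm)// ltr_nat ltnW.
Qed.

Lemma hardy1_radii g : hardy1 g -> exists r_ : nat -> R,
  [/\ forall k, 0 < r_ k < 1, r_ k @[k --> \oo] --> (1 : R) &
    forall n, \sum_(0 <= k < n) circ (fun z => cabs (g ((r_ k.+1)%:C * z) - g ((r_ k)%:C * z))) <= 2].
Proof.
move=> hg.
have /choice[m hm] : forall k : nat, exists m : nat, forall r u,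
    disc_radius m <= r -> r <= u -> u < 1 ->
    circ (fun z => cabs (g (r%:C * z) - g (u%:C * z))) <= 2^-1 ^+ k.
  move=> k; have [|s [s0 s1 hs]] := @hardy1_cauchy g (2^-1 ^+ k) hg.
    by rewrite exprn_gt0// invr_gt0 ltr0n.
  have [m sm] := disc_radius_ge s1; exists m => r u mr; apply: hs.
  exact: le_trans mr.
pose N k := (\sum_(0 <= j < k.+1) (m j).+1)%N.
have NS k : (N k <= N k.+1)%N by rewrite /N [leqRHS]big_nat_recr//= leq_addr.
have mN k : (m k <= N k)%N by rewrite /N big_nat_recr//= (leq_trans (leqnSn _))// leq_addl.
have kN k : (k <= N k)%N.
  elim: k => [//|k IH]; rewrite /N big_nat_recr//= -/(N k) addnS ltnS.
  by rewrite (leq_trans IH)// leq_addr.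
exists (fun k => disc_radius (N k)); split.
- by move=> k; exact: disc_radius_bounds.
- apply: (@squeeze_cvgr _ _ _ _ disc_radius (fun=> 1)).
  + near=> k; rewrite disc_radius_le//=; have /andP[_ /ltW] := disc_radius_bounds (N k).
    exact.
  + rewrite -[X in _ --> X]subr0; apply: cvgB; first exact: cvg_cst.
    by rewrite (cvg_shiftS (fun n => n.+1%:R^-1 : R)); exact: cvg_harmonic.
  + exact: cvg_cst.
- move=> n; apply: (@le_trans _ _ (\sum_(0 <= k < n) 2^-1 ^+ k)).
    apply: ler_sum => k _.
    have /andP[_ lt1] := disc_radius_bounds (N k.+1).
    have := hm k _ _ (disc_radius_le (mN k)) (disc_radius_le (NS k)) lt1.
    apply: le_trans; rewrite le_eqVlt; apply/orP; left; apply/eqP/eq_circ => z _.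
    exact: cabsB.
  have -> : \sum_(0 <= k < n) (2^-1 : R) ^+ k = 2 - 2 * 2^-1 ^+ n.
    elim: n => [|n IH]; first by rewrite big_nil expr0; lra.
    by rewrite big_nat_recr//= IH exprS; lra.
  by rewrite lerBlDr lerDl mulr_ge0// exprn_ge0// invr_ge0.
Unshelve. all: by end_near. Qed.

Lemma itg_mul_bounded (a b C : R) (k u : R -> R) : continuous k ->
  (forall x, a <= x <= b -> `|k x| <= C) -> itg a b u -> itg a b (fun x => k x * u x).
Proof.
move=> ck kC iu.
have mI : @measurable _ (g_sigma_algebraType R.-ocitv.-measurable) `[a, b] by exact: measurable_itv.
have mk : measurable_fun (`[a, b] : set (g_sigma_algebraType R.-ocitv.-measurable)) k.
  by apply: measurable_funTS; exact: continuous_measurable_fun.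
have iCu : itg a b (fun x => C * `|u x|) by apply: itgZ; exact: itg_norm.
apply: (le_integrable mI _ _ iCu).
  apply/measurable_EFinP; apply: measurable_funM => //.
  by apply/measurable_EFinP; exact: measurable_int iu.
move=> x; rewrite /= in_itv/= => xab; rewrite lee_fin normrM [leRHS]ger0_norm.
  by rewrite ler_wpM2r// kC.
by rewrite mulr_ge0// (le_trans (normr_ge0 _) (kC _ xab)).
Qed.

Lemma poisson_kernel_bound t (x : R) : cabs t < 1 ->
  `|poisson_kernel t (ei x)| <= 2 / (1 - cabs t).
Proof.
move=> t1; rewrite ger0_norm ?poisson_kernel_ge0//.
have d0 : 0 < 1 - cabs t by rewrite subr_gt0.
have dist : 1 - cabs t <= cabs (ei x - t).
  have := cabsD (ei x - t) t; rewrite subrK cabs_ei; lra.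
have dd : 0 < cabs (ei x - t) := lt_le_trans d0 dist.
rewrite /poisson_kernel ler_pdivrMr ?exprn_gt0// mulrAC ler_pdivlMr//.
have := cabs_ge0 t; set a := cabs t in t1 d0 dist *; set b := cabs (ei x - t) in dist dd *.
move=> a0; have : (1 - a) * (1 - a) <= b * b by apply: ler_pM => //; exact: ltW.
have : (1 + a) * ((1 - a) * (1 - a)) <= 2 * ((1 - a) * (1 - a)).
  by rewrite ler_wpM2r ?mulr_ge0 ?ltW//; lra.
by rewrite !expr2; lra.
Qed.

Lemma continuous_poisson_kernel_ei t : cabs t < 1 -> continuous (fun x : R => poisson_kernel t (ei x)).
Proof.
move=> t1 x; apply: (@continuous_comp _ _ _ (fun x : R => ei x) (poisson_kernel t)).
  exact: ei_continuous.
by apply: ccont_poisson_kernel => //; rewrite cabs_ei.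
Qed.

(** The dilates satisfy the Poisson formula, and both sides pass to the limit because
the kernel is bounded. *)
Lemma hardy1_poisson g : hardy1 g -> exists u : R -> R, itg 0 twopi u /\
  forall t, cabs t < 1 ->
    Rint 0 twopi (fun x => poisson_kernel t (ei x) * u x) = twopi * Re (g t).
Proof.
move=> hg; have [r_ [r01 r_1 sumr]] := hardy1_radii hg; have [dg _] := hg.
pose f_ k x := Re (g ((r_ k)%:C * ei x)).
have dgr k : chol (fun z => g ((r_ k)%:C * z)).
  by apply: chol_dhol_dil => //; have /andP[/ltW -> ->] := r01 k.
have if_ k : itg 0 twopi (f_ k) := itc_ccont (ccont_chol_Re (dgr k)).
have sum_le n : \sum_(0 <= k < n) Rint 0 twopi (fun x => `|f_ k.+1 x - f_ k x|) <= 2.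
  apply: le_trans (sumr n); apply: ler_sum => k _; apply: le_Rint.
  - by apply: itg_norm; exact: itgB.
  - apply: (itc_ccont (f := fun z => cabs (g ((r_ k.+1)%:C * z) - g ((r_ k)%:C * z)))).
    by apply: ccont_chol_cabs => z z1; apply: cdiffB; exact: dgr.
  - by move=> x _; rewrite /f_ -raddfB; exact: Re_le_cabs.
have [u [iu fu]] := rapid_limit if_ sum_le.
exists u; split => // t t1.
pose k x := poisson_kernel t (ei x).
have ck : continuous k by exact: continuous_poisson_kernel_ei.
have kC x : `|k x| <= 2 / (1 - cabs t) by exact: poisson_kernel_bound.
have lim1 : Rint 0 twopi (fun x => k x * f_ n x) @[n --> \oo] --> Rint 0 twopi (fun x => k x * u x).
  apply/cvgrPdist_lt => e e0.
  set C := 2 / (1 - cabs t) in kC.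
  have C0 : 0 < C by rewrite divr_gt0// subr_gt0.
  have /cvgrPdist_lt/(_ (e / C))-/(_ (divr_gt0 e0 C0)) := fu.
  apply: filterS => n; rewrite sub0r normrN => hn.
  have ifu : itg 0 twopi (fun x => `|f_ n x - u x|) by apply: itg_norm; exact: itgB.
  have ik (v : R -> R) : itg 0 twopi v -> itg 0 twopi (fun x => k x * v x).
    by apply: itg_mul_bounded => // x _; exact: kC.
  rewrite -RintB; [|exact: ik|exact: ik].
  apply: (le_lt_trans (le_norm_Rint (itgB (ik _ iu) (ik _ (if_ n))))).
  apply: (@le_lt_trans _ _ (Rint 0 twopi (fun x => C * `|f_ n x - u x|))).
    apply: le_Rint; [by apply/itg_norm/itgB; exact: ik|exact: itgZ|].
    by move=> x _; rewrite -mulrBr normrM distrC ler_wpM2r// kC.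
  rewrite RintZ//; move: hn; rewrite ltr_pdivlMr// mulrC; apply: le_lt_trans.
  by rewrite ler_wpM2l// ?ler_norm// ltW.
have lim2 : Rint 0 twopi (fun x => k x * f_ n x) @[n --> \oo] --> twopi * Re (g t).
  have e n : Rint 0 twopi (fun x => k x * f_ n x) = twopi * Re (g ((r_ n)%:C * t)).
    exact: (poisson_formula (dgr n) t1).
  rewrite (_ : (fun n => _) = fun n => twopi * Re (g ((r_ n)%:C * t))); last first.
    by apply/funext => n; exact: e.
  apply: cvgMr.
  have c1 : (r_ n)%:C * t @[n --> \oo] --> (1%:C * t : R[i]).
    have c0 : (r_ n)%:C @[n --> \oo] --> (1%:C : R[i]).
      exact: (cvg_continuous_at r_1 (@RtoC_continuous R 1)).
    exact: (cvgcM c0 (cvgc_cst \oo t)).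
  rewrite mul1r in c1.
  have cg : {for t, continuous (fun z => Re (g z))}.
    by apply: continuous_Re; apply: cdiff_continuous; exact: dg.
  exact: (cvg_continuous_at c1 cg).
exact: (cvg_unique _ lim1 lim2).
Qed.

End HardyOne.

(** * Lebesgue points and approximate identities *)

Section LebesguePoints.
Context {R : realType}.
Implicit Types (a b x y e h C : R) (u v K : R -> R).
Local Notation mu := (@lebesgue_measure R).

Definition lebesgue_point a b u x := forall e, 0 < e -> exists2 r : R, 0 < r &
  forall s, 0 < s -> s < r ->
    Rint a b ((fun y => `|u y - u x|) \_ (ball x s)) <= e * s.

Lemma measurable_itvL a b :
  @measurable _ (g_sigma_algebraType R.-ocitv.-measurable) `[a, b].
Proof. exact: measurable_itv. Qed.

Lemma measurable_ballL x s :
  @measurable _ (g_sigma_algebraType R.-ocitv.-measurable) (ball x s : set R).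
Proof. by rewrite ball_itv; exact: measurable_itv. Qed.

Lemma itg_restrict_ball a b v x s : itg a b v -> itg a b (v \_ (ball x s)).
Proof.
move=> iv; have : mu.-integrable `[a, b] ((EFin \o v) \_ (ball x s)).
  apply: (integrable_restrict mu (measurable_ballL x s) (measurable_itvL a b) (EFin \o v)).1.
  apply: integrableS iv; [exact: measurable_itvL| |exact: subIsetl].
  by apply: measurableI; [exact: measurable_itvL|exact: measurable_ballL].
by rewrite restrict_EFin.
Qed.

Lemma ae_lebesgue_point a b u : itg a b u ->
  {ae mu, forall x, a < x < b -> lebesgue_point a b u x}.
Proof.
move=> iu; pose w := u \_ `[a, b].
have iw : mu.-integrable setT (EFin \o w).
  have := (@integrable_mkcond _ _ _ mu _ (EFin \o u) (measurable_itvL a b)).1 iu.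
  by rewrite restrict_EFin.
have lw : locally_integrable setT w by apply: open_integrable_locally => //; exact: openT.
have [N [mN N0 sub]] := lebesgue_differentiation lw; exists N; split => //.
apply: subset_trans sub; apply: subsetC => x /= lx /andP[ax xb] e e0.
have e2 : (0 < (e / 2)%:E)%E by rewrite lte_fin divr_gt0.
have [r /= r0 hr] : \forall s \near (0 : R)^'+, (davg w x s < (e / 2)%:E)%E.
  exact: (lx _ (open_ereal_lt' e2)).
exists (Num.min r (Num.min (x - a) (b - x))); first by rewrite !lt_min r0 !subr_gt0 ax.
move=> s s0; rewrite !lt_min => /and3P[sr sa sb].
have := hr s; rewrite /= sub0r normrN gtr0_norm// => /(_ sr s0).
rewrite /davg /iavg lebesgue_measure_ball ?(ltW s0)// => h.
have sub : ball x s `<=` `[a, b]%classic.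
  move=> y; rewrite ball_itv /= !in_itv /= => /andP[y1 y2]; apply/andP; split; lra.
have abx : `[a, b]%classic x by rewrite /= in_itv/= !ltW.
rewrite /Rint -Rintegral_mkcondr setIidr//.
set I := (\int[mu]_(y in ball x s) _)%E in h.
have IE : (I = \int[mu]_(y in ball x s) (`|u y - u x|)%:E)%E.
  apply: eq_integral => y; rewrite inE => yB.
  rewrite /= /shift /w /patch !mem_set//.
  exact: sub.
have I0 : (0 <= I)%E by apply: integral_ge0 => y _; exact: abse_ge0.
have If : I \is a fin_num.
  rewrite IE; apply: integrable_fin_num; first exact: measurable_ballL.
  have iv : itg a b (fun y => `|u y - u x|).
    by apply: itg_norm; apply: itgB => //; exact: itg_cst.
  exact: (integrableS (measurable_itvL a b) (measurable_ballL x s) _ iv).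
rewrite /Rintegral -IE -lee_fin fineK//.
move: h; rewrite -(fineK If) inver mulrn_eq0/= gt_eqF// -EFinM !lte_fin lee_fin.
rewrite mulrC ltr_pdivrMr ?mulrn_wgt0// => /ltW.
by rewrite -mulr_natr; lra.
Qed.

(** A bump of height C / h and quadratic decay is at most a sum of dyadic steps
of total mass 16 C, and each step is controlled by an average over a ball. *)
Lemma approximate_identity a b u x C e : a < x < b -> itg a b u -> lebesgue_point a b u x ->
  0 < C -> 0 < e -> exists2 h0, 0 < h0 & forall h K, 0 < h -> h < h0 ->
    (forall y, a <= y <= b -> 0 <= K y) ->
    (forall y, a <= y <= b -> K y * h <= C) ->
    (forall y, a <= y <= b -> K y * (y - x) ^+ 2 <= C * h) ->
    itg a b (fun y => K y * `|u y - u x|) ->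
    Rint a b (fun y => K y * `|u y - u x|) <= e.
Proof.
move=> axb iu lx C0 e0.
pose v y := `|u y - u x|.
have iv : itg a b v by apply: itg_norm; apply: itgB => //; exact: itg_cst.
have v0 y : 0 <= v y by exact: normr_ge0.
set V := Rint a b v; have V0 : 0 <= V by apply: Rint_ge0 => y _.
have eC : 0 < e / (16 * C) by rewrite divr_gt0// mulr_gt0.
have [r r0 hr] := lx _ eC.
pose h1 := e * r ^+ 2 / (32 * C * (V + 1)).
have V1 : 0 < V + 1 by rewrite ltr_wpDl.
have den : 0 < 32 * C * (V + 1) by rewrite !mulr_gt0.
have h10 : 0 < h1 by rewrite !mulr_gt0 ?invr_gt0// exprn_gt0.
exists (Num.min (r / 4) h1); first by rewrite lt_min h10 divr_gt0.
move=> h K h0; rewrite lt_min => /andP[hr4 hh1] K0 Kh Kth iKv.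
(* dyadic radii 2^j h, up to the first one that reaches r / 4 *)
have [J [Jr JR]] : exists J : nat, r / 4 <= 2 ^+ J * h /\ 2 ^+ J * h < r.
  have [N hN] : exists N : nat, r / 4 <= 2 ^+ N * h.
    have h4 : 0 <= r / 4 / h by rewrite !divr_ge0// ltW.
    exists (Num.bound (r / 4 / h)); have := archi_boundP h4.
    rewrite ltr_pdivrMr// => lt1; apply: (le_trans (ltW lt1)).
    by rewrite ler_wpM2r ?(ltW h0)// -natrX ler_nat ltnW// ltn_expl.
  have exN : exists N, (fun N => r / 4 <= 2 ^+ N * h) N by exists N.
  exists (ex_minn exN); case: ex_minnP => -[|m] mr mmin.
    by split => //; rewrite expr0 mul1r (lt_trans hr4)// ltr_pdivrMr// ltr_pMr// ltr1n.
  split => //; have : 2 ^+ m * h < r / 4.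
    by rewrite ltNge; apply/negP => /mmin; rewrite ltnn.
  by rewrite exprS; lra.
pose c j : R := 4 * C / (4 ^+ j * h).
have c0 j : 0 <= c j by rewrite divr_ge0 ?mulr_ge0 ?exprn_ge0// ltW.
pose F y := \sum_(0 <= j < J.+1) c j * (v \_ (ball x (2 ^+ j * h))) y.
have iF j : itg a b (fun y => c j * (v \_ (ball x (2 ^+ j * h))) y).
  by apply: itgZ; exact: itg_restrict_ball.
have sum_iF n : itg a b (fun y => \sum_(0 <= j < n) c j * (v \_ (ball x (2 ^+ j * h))) y) /\
    Rint a b (fun y => \sum_(0 <= j < n) c j * (v \_ (ball x (2 ^+ j * h))) y) =
    \sum_(0 <= j < n) c j * Rint a b (v \_ (ball x (2 ^+ j * h))).
  elim: n => [|n [IH1 IH2]].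
    rewrite big_nil (_ : (fun y => _) = fun=> 0); last by apply/funext => y; rewrite big_nil.
    split; first exact: itg_cst.
    by rewrite Rint_cst ?mul0r//; have /andP[h2 h3] := axb; rewrite ltW// (lt_trans h2).
  rewrite (_ : (fun y => _) = fun y => (\sum_(0 <= j < n) c j * (v \_ (ball x (2 ^+ j * h))) y)
     + c n * (v \_ (ball x (2 ^+ n * h))) y); last first.
    by apply/funext => y; rewrite big_nat_recr.
  split; first exact: itgD.
  by rewrite RintD// IH2 big_nat_recr//= RintZ//; exact: itg_restrict_ball.
have bound y : a <= y <= b -> K y * v y <= F y + (16 * C * h / r ^+ 2) * v y.
  move=> yab; have F0 j : 0 <= c j * (v \_ (ball x (2 ^+ j * h))) y.
    by rewrite mulr_ge0// /patch; case: ifP.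
  have Fj j : (j <= J)%N -> `|y - x| < 2 ^+ j * h -> c j * v y <= F y.
    move=> jJ yj; rewrite /F (bigD1_seq j) ?iota_uniq ?mem_index_iota//=.
    rewrite {1}/patch mem_set; last by rewrite /ball /= distrC.
    by rewrite lerDl sumr_ge0.
  have R0 : 0 <= 16 * C * h / r ^+ 2 * v y.
    by rewrite mulr_ge0// divr_ge0 ?exprn_ge0 ?mulr_ge0// ltW.
  have sq_abs : `|y - x| ^+ 2 = (y - x) ^+ 2 by rewrite real_normK// num_real.
  have [far|near_] := leP (2 ^+ J * h) `|y - x|.
    have F00 : 0 <= F y by apply: sumr_ge0.
    apply: (@le_trans _ _ (16 * C * h / r ^+ 2 * v y)); last by rewrite lerDr.
    rewrite ler_wpM2r// ler_pdivlMr ?exprn_gt0//.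
    have rr : r ^+ 2 <= 16 * (y - x) ^+ 2.
      have : (r / 4) ^+ 2 <= `|y - x| ^+ 2.
        by rewrite lerXn2r ?nnegrE ?divr_ge0 ?(ltW r0)// (le_trans Jr).
      by rewrite sq_abs expr_div_n; lra.
    apply: (le_trans (ler_wpM2l (K0 y yab) rr)).
    by have := Kth y yab; lra.
  have exj : exists j, (fun j => `|y - x| < 2 ^+ j * h) j by exists J.
  case: (ex_minnP exj) => j yj jmin.
  have jJ : (j <= J)%N by apply: jmin.
  apply: (@le_trans _ _ (F y)); last by rewrite lerDl.
  apply: le_trans (Fj j jJ yj); rewrite ler_wpM2r// /c.
  rewrite ler_pdivlMr ?mulr_gt0 ?exprn_gt0//.
  case: j yj jmin jJ => [|j] yj jmin jJ.
    by rewrite expr0 mul1r (le_trans (Kh y yab))// ler_peMl ?ler1n// ltW.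
  have yj' : 2 ^+ j * h <= `|y - x|.
    by rewrite leNgt; apply/negP => /jmin; rewrite ltnn.
  have : (2 ^+ j * h) ^+ 2 <= (y - x) ^+ 2.
    by rewrite -sq_abs lerXn2r ?nnegrE ?mulr_ge0 ?exprn_ge0 ?(ltW h0).
  rewrite exprMn -exprM mulnC exprM (_ : 2 ^+ 2 = 4 :> R); last by rewrite expr2 -natrM.
  move=> le1; have le2 := le_trans (ler_wpM2l (K0 y yab) le1) (Kth y yab).
  rewrite -(ler_pM2r h0) exprS.
  by move: le2; rewrite expr2; lra.
have [iFs FE] := sum_iF J.+1.
apply: (@le_trans _ _ (Rint a b (fun y => F y + (16 * C * h / r ^+ 2) * v y))).
  apply: le_Rint => //; first by apply: itgD => //; exact: itgZ.
rewrite RintD//; last exact: itgZ.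
rewrite RintZ// -/V FE [e](splitr e) lerD//.
  apply: (@le_trans _ _ (\sum_(0 <= j < J.+1) (e / 4) * 2^-1 ^+ j)).
    apply: ler_sum_nat => j /andP[_ jJ].
    have rj : 2 ^+ j * h < r.
      apply: le_lt_trans JR; rewrite ler_wpM2r ?(ltW h0)//.
      by rewrite -!natrX ler_nat leq_exp2l.
    have hj : 0 < 2 ^+ j * h by rewrite mulr_gt0// exprn_gt0.
    apply: (le_trans (ler_wpM2l (c0 j) (hr _ hj rj))).
    rewrite le_eqVlt; apply/orP; left; apply/eqP; rewrite /c.
    have -> : 4 ^+ j = 2 ^+ j * 2 ^+ j :> R by rewrite -exprMn -natrM.
    have p2 : 2 ^+ j != 0 :> R by rewrite expf_neq0.
    rewrite exprVn; field.
    by rewrite p2 !gt_eqF.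
  rewrite -mulr_sumr.
  have -> : \sum_(0 <= j < J.+1) (2^-1 : R) ^+ j = 2 - 2 * 2^-1 ^+ J.+1.
    elim: (J.+1) => [|n IH]; first by rewrite big_nil expr0; lra.
    by rewrite big_nat_recr//= IH exprS; lra.
  have : 0 <= (e / 4) * 2^-1 ^+ J.+1 by rewrite mulr_ge0 ?divr_ge0 ?exprn_ge0 ?invr_ge0// ltW.
  by lra.
rewrite mulrAC ler_pdivrMr ?exprn_gt0//.
move: hh1; rewrite /h1 ltr_pdivlMr// => hh1.
have : C * h * V <= C * h * (V + 1) by rewrite ler_wpM2l ?mulr_ge0 ?ltW// ltrDl.
by lra.
Qed.

End LebesguePoints.

(** * Radial limits *)

Section FatouRadialLimits.
Context {R : realType}.
Implicit Types (x y r e : R) (u : R -> R) (g : R[i] -> R[i]).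
Local Notation mu := (@lebesgue_measure R).

Lemma onemcos_half x : 1 - cos x = 2 * sin (x / 2) ^+ 2.
Proof.
have -> : cos x = cos (x / 2 + x / 2) by rewrite -splitr.
by rewrite cosD -!expr2; have := cos2Dsin2 (x / 2); lra.
Qed.

Lemma sqr_le_onemcos_near : exists2 d : R, 0 < d &
  forall x, `|x| < d -> x ^+ 2 <= 8 * (1 - cos x).
Proof.
have h0 : 0 < (2^-1 : R) by rewrite invr_gt0.
have [r r0 hr] := first_order0 (is_derive_sin 0) h0.
exists r => // x xr.
have xr2 : `|x / 2| < r.
  by rewrite normrM [`|2^-1|]gtr0_norm//; have := normr_ge0 x; lra.
have := hr (x / 2) xr2; rewrite sin0 cos0 subr0 mul1r.
rewrite onemcos_half => h.
have h2 : `|x / 4| <= `|sin (x / 2)|.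
  have := ler_normD (x / 2 - sin (x / 2)) (sin (x / 2)); rewrite subrK distrC.
  by rewrite !normrM ![`|_^-1|]gtr0_norm// in h *; lra.
have : (x / 4) ^+ 2 <= sin (x / 2) ^+ 2.
  by rewrite -[leLHS]real_normK ?num_real// -[leRHS]real_normK ?num_real// lerXn2r ?nnegrE.
by rewrite expr_div_n; lra.
Qed.

(** x is interior to the interval, so 1 - cos (y - x) vanishes only at y = x; near that
point it is quadratic, and elsewhere compactness gives a lower bound. *)
Lemma sqr_le_onemcos x : 0 < x < twopi -> exists2 B, 0 < B &
  forall y, 0 <= y <= twopi -> (y - x) ^+ 2 <= B * (1 - cos (y - x)).
Proof.
move=> /andP[x0 x1]; have [d d0 hd] := sqr_le_onemcos_near.
have cc (y : R) : {for y, continuous (fun y => cos (y - x))}.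
  apply: (@continuous_comp _ _ _ (fun y => y - x) (@cos R)); last exact: continuous_cos.
  by apply: cvgB; [exact: cvg_id|exact: cvg_cst].
have D0 y : 0 <= 1 - cos (y - x) by rewrite subr_ge0 cos_le1.
have [|||||||C C0 hC] := @compact_domination R R `[0, twopi] (fun y => `|y - x|)
   (fun y => 1 - cos (y - x)) (d / 2).
- by exists 0; rewrite /= in_itv/= lexx ltW// twopi_gt0.
- exact: segment_compact.
- by move=> y _; apply: cvg_norm; apply: cvgB; [exact: cvg_id|exact: cvg_cst].
- by move=> y _; apply: cvgB; [exact: cvg_cst|exact: cc].
- by move=> y _; exact: D0.
- move=> y; rewrite /= in_itv/= => /andP[y0 y1] /eqP.
  rewrite onemcos_half mulf_eq0 pnatr_eq0/= sqrf_eq0 => s0.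
  have lt2 : `|y - x| < twopi by rewrite ltr_norml; apply/andP; split; lra.
  apply: contraTeq s0 => n0; have n1 : 0 < `|y - x| by rewrite lt_def n0 normr_ge0.
  have sp : 0 < sin (`|y - x| / 2).
    by apply: sin_gt0_pi; move: lt2; rewrite /twopi mulr2n => ?; apply/andP; split; lra.
  case: (leP 0 (y - x)) sp => yx; first by rewrite ger0_norm// => /gt_eqF ->.
  by rewrite ltr0_norm// mulNr sinN oppr_gt0 => /lt_eqF ->.
- exact: divr_gt0.
have tp := @twopi_gt0 R.
exists (8 + twopi ^+ 2 * (C / (d / 2))).
  by rewrite ltr_pwDl// mulr_ge0 ?sqr_ge0// divr_ge0// ltW// divr_gt0.
move=> y yin; have [near_|far] := ltP `|y - x| d.
  apply: (le_trans (hd _ near_)); rewrite ler_wpM2r// lerDl.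
  by rewrite mulr_ge0 ?sqr_ge0// divr_ge0// ltW// divr_gt0.
have yin' : `[0, twopi]%classic y by rewrite /= in_itv.
have := hC y yin' => h; have C1 : d / 2 <= C * (1 - cos (y - x)) by lra.
apply: (@le_trans _ _ (twopi ^+ 2 * 1)).
  rewrite mulr1 -[leLHS]real_normK ?num_real// lerXn2r ?nnegrE ?(ltW tp)//.
  by move: yin => /andP[y0 y1]; rewrite ler_norml; apply/andP; split; lra.
rewrite mulrDl; apply: (@le_trans _ _ (twopi ^+ 2 * (C / (d / 2)) * (1 - cos (y - x)))).
  rewrite -mulrA ler_wpM2l ?sqr_ge0// mulrAC ler_pdivlMr ?divr_gt0//.
  by rewrite mul1r.
by rewrite lerDr mulr_ge0.
Qed.

Lemma poisson_kernel_polar r x y :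
  poisson_kernel (r%:C * ei x) (ei y) =
  (1 - r ^+ 2) / ((1 - r) ^+ 2 + 2 * r * (1 - cos (y - x))).
Proof.
rewrite /poisson_kernel cabsM cabs_ei mulr1 cabsR real_normK ?num_real//.
congr (_ / _); rewrite sqr_cabs /ei /= cosB.
have ex := cos2Dsin2 x; have ey := cos2Dsin2 y.
rewrite !mul0r subr0 addr0.
apply: (@eq_trans _ _ ((cos y ^+ 2 + sin y ^+ 2) + r ^+ 2 * (cos x ^+ 2 + sin x ^+ 2)
   - 2 * r * (cos y * cos x + sin y * sin x))); first by ring.
by rewrite ex ey; ring.
Qed.

(** With h = 1 - r, the kernel has height at most 2 / h and decays quadratically, because
its denominator is at least a multiple of (y - x)^2. *)
Lemma poisson_radial_cvg u x : 0 < x < twopi -> itg 0 twopi u -> lebesgue_point 0 twopi u x ->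
  Rint 0 twopi (fun y => poisson_kernel (r%:C * ei x) (ei y) * u y) @[r --> (1 : R)^'-]
   --> twopi * u x.
Proof.
move=> xin iu lx; have [B B0 hB] := sqr_le_onemcos xin.
pose C := 2 + 2 * B; have C0 : 0 < C by rewrite /C; lra.
apply/cvgrPdist_le => e e0.
have [h0 h00 hh] := approximate_identity xin iu lx C0 e0.
near=> r.
have r1 : r < 1 by near: r; exact: nbhs_left_lt.
have r2 : 2^-1 < r by near: r; apply: nbhs_left_gt; lra.
have rh : 1 - h0 < r by near: r; apply: nbhs_left_gt; lra.
have r0 : 0 < r by lra.
have t1 : cabs (r%:C * ei x) < 1 by rewrite cabsM cabs_ei mulr1 cabsR gtr0_norm.
pose K y := poisson_kernel (r%:C * ei x) (ei y).
have cK : continuous K by exact: continuous_poisson_kernel_ei.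
have KC y : `|K y| <= 2 / (1 - cabs (r%:C * ei x)) by exact: poisson_kernel_bound.
have K0 y : 0 <= K y by exact: poisson_kernel_ge0.
have iK (v : R -> R) : itg 0 twopi v -> itg 0 twopi (fun y => K y * v y).
  by apply: itg_mul_bounded => // y _; exact: KC.
have iv : itg 0 twopi (fun y => `|u y - u x|).
  by apply: itg_norm; apply: itgB => //; exact: itg_cst.
have KE y : K y * ((1 - r) ^+ 2 + 2 * r * (1 - cos (y - x))) = 1 - r ^+ 2.
  rewrite /K poisson_kernel_polar divfK// gt_eqF// ltr_pwDl ?exprn_gt0 ?subr_gt0//.
  by rewrite !mulr_ge0// ?(ltW r0)// subr_ge0 cos_le1.
have Ktw : Rint 0 twopi K = twopi by exact: (poisson_kernel_mean t1).
have -> : twopi * u x = Rint 0 twopi (fun y => K y * u x).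
  have iK1 : itg 0 twopi K by apply: itg_cont => y _; exact: cK.
  have -> : twopi * u x = u x * Rint 0 twopi K by rewrite Ktw mulrC.
  by rewrite -RintZ//; apply: eq_Rint => y _; rewrite mulrC.
rewrite -RintB; [|exact/iK/itg_cst|exact: iK].
apply: (le_trans (le_norm_Rint _)).
  by apply: itgB; [exact/iK/itg_cst|exact: iK].
rewrite (@eq_Rint _ _ _ _ (fun y => K y * `|u y - u x|)); last first.
  by move=> y _; rewrite -mulrBr normrM ger0_norm// distrC.
have c01 y : 0 <= 1 - cos (y - x) by rewrite subr_ge0 cos_le1.
apply: (hh (1 - r) K) => //; [lra|lra| | |exact: iK].
- move=> y _; have q := KE y; rewrite mulrDr in q.
  have pos : 0 <= K y * (2 * r * (1 - cos (y - x))) by rewrite mulr_ge0// !mulr_ge0// ltW.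
  have h1 : 0 < 1 - r by lra.
  have h2 : (1 - r) * (1 + r) <= (1 - r) * 2 by rewrite ler_pM2l//; lra.
  rewrite -(ler_pM2r h1) -mulrA -expr2.
  apply: (@le_trans _ _ (2 * (1 - r))); first by lra.
  by rewrite ler_pM2r// /C; lra.
- move=> y yin; have q := KE y; rewrite mulrDr in q.
  have h1 : 0 < 1 - r by lra.
  have h2 : (1 - r) * (1 + r) <= (1 - r) * 2 by rewrite ler_pM2l//; lra.
  have pos : 0 <= K y * (1 - r) ^+ 2 by rewrite mulr_ge0// sqr_ge0.
  have Kc : K y * (1 - cos (y - x)) <= 2 * (1 - r).
    have : K y * (1 - cos (y - x)) <= (2 * r) * (K y * (1 - cos (y - x))).
      have p := mulr_ge0 (K0 y) (c01 y); apply: ler_peMl => //.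
      by move: r2; clear; lra.
    by lra.
  apply: (le_trans (ler_wpM2l (K0 y) (hB y yin))).
  rewrite mulrCA; apply: (le_trans (ler_wpM2l (ltW B0) Kc)).
  by rewrite mulrA ler_pM2r// /C; lra.
Unshelve. all: by end_near. Qed.

(** The imaginary part of g is the real part of - i g, so [hardy1_poisson] represents
both parts. *)
Lemma hardy1_boundary g : hardy1 g -> exists u v : R -> R,
  [/\ itg 0 twopi u, itg 0 twopi v,
     forall t, cabs t < 1 ->
       Rint 0 twopi (fun x => poisson_kernel t (ei x) * u x) = twopi * Re (g t) /\
       Rint 0 twopi (fun x => poisson_kernel t (ei x) * v x) = twopi * Im (g t) &
     {ae mu, forall x, 0 < x < twopi ->
       g (r%:C * ei x) @[r --> (1 : R)^'-] --> u x +i* v x}].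
Proof.
move=> hg; have [u [iu Pu]] := hardy1_poisson hg.
have hg' : hardy1 (fun z => - 'i * g z).
  have [dg [M gM]] := hg; split.
    by move=> z z1; apply: cdiffM; [exact: cdiff_cst|exact: dg].
  exists M => r r0 r1; apply: le_trans (gM r r0 r1).
  rewrite le_eqVlt; apply/orP; left; apply/eqP/eq_circ => z _.
  by rewrite cabsM cabsN {1}/cabs /= expr0n expr1n add0r sqrtr1 mul1r.
have [v [iv Pv]] := hardy1_poisson hg'.
exists u, v; split => //.
  move=> t t1; split; first exact: Pu.
  by rewrite Pv//; congr (_ * _); case: (g t) => a b /=; ring.
have Pv' t : cabs t < 1 ->
    Rint 0 twopi (fun x => poisson_kernel t (ei x) * v x) = twopi * Im (g t).
  by move=> t1; rewrite Pv//; congr (_ * _); case: (g t) => a b /=; ring.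
have [N1 [mN1 N10 sub1]] := ae_lebesgue_point iu; have [N2 [mN2 N20 sub2]] := ae_lebesgue_point iv.
exists (N1 `|` N2); split; first exact: measurableU.
  by apply: null_set_setU.
move=> x /= nx; apply: contrapT => /not_orP[n1 n2]; apply: nx => xin.
have l1 : lebesgue_point 0 twopi u x by apply: contrapT => h; apply: n1; apply: sub1 => /= /(_ xin).
have l2 : lebesgue_point 0 twopi v x by apply: contrapT => h; apply: n2; apply: sub2 => /= /(_ xin).
have tp := @twopi_gt0 R.
have lim (w : R -> R) (p : R[i] -> R) : itg 0 twopi w -> lebesgue_point 0 twopi w x ->
    (forall t, cabs t < 1 -> Rint 0 twopi (fun x => poisson_kernel t (ei x) * w x) = twopi * p t) ->
    p (r%:C * ei x) @[r --> (1 : R)^'-] --> w x.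
  move=> iw lw Pw; have h := poisson_radial_cvg xin iw lw.
  have h2 : twopi^-1 * Rint 0 twopi (fun y => poisson_kernel (r%:C * ei x) (ei y) * w y)
      @[r --> (1 : R)^'-] --> twopi^-1 * (twopi * w x) by exact: cvgMr.
  rewrite mulKf ?gt_eqF// in h2; apply: cvg_trans h2; apply: near_eq_cvg; near=> r.
  rewrite Pw ?mulKf ?gt_eqF//.
  have r0 : 0 < r by near: r; apply: nbhs_left_gt.
  have r1 : r < 1 by near: r; exact: nbhs_left_lt.
  by rewrite cabsM cabs_ei mulr1 cabsR gtr0_norm.
have c1 := lim u _ iu l1 Pu; have c2 := lim v _ iv l2 Pv'.
have c3 : (Re (g (r%:C * ei x)))%:C + 'i * (Im (g (r%:C * ei x)))%:C
   @[r --> (1 : R)^'-] --> (u x)%:C + 'i * (v x)%:C.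
  have d1 : (Re (g (r%:C * ei x)))%:C @[r --> (1 : R)^'-] --> ((u x)%:C : R[i]).
    exact: (cvg_continuous_at c1 (@RtoC_continuous R (u x))).
  have d2 : (Im (g (r%:C * ei x)))%:C @[r --> (1 : R)^'-] --> ((v x)%:C : R[i]).
    exact: (cvg_continuous_at c2 (@RtoC_continuous R (v x))).
  exact: (cvgcD d1 (cvgcM (cvgc_cst _ 'i) d2)).
have e a b : a%:C + 'i * b%:C = a +i* b :> R[i].
  by apply/eqP; rewrite eq_complex /=; apply/andP; split; apply/eqP; ring.
rewrite -e; apply: cvg_trans c3; apply: near_eq_cvg; near=> r.
by rewrite e; case: (g _).
Unshelve. all: by end_near. Qed.

End FatouRadialLimits.

(** * Integrals of arbitrary functions *)

Section IntegralsOfArbitraryFunctions.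
Context d (T : measurableType d) (R : realType) (mu : {measure set T -> \bar R}).
Implicit Types (E D : set T) (f g : T -> \bar R).
Import HBNNSimple.

(** The integral of a nonnegative function is the supremum over simple functions below
it; restricting a simple function to the full set E does not change its integral. *)
Lemma ge0_integralT_le_ae E f g : measurable E -> mu (~` E) = 0%E ->
  (forall x, 0 <= f x)%E -> (forall x, 0 <= g x)%E -> (forall x, E x -> f x <= g x)%E ->
  (\int[mu]_x f x <= \int[mu]_x g x)%E.
Proof.
move=> mE E0 f0 g0 fg; rewrite !ge0_integralTE//.
apply: ge_ereal_sup => _ [k kf <-]; apply: ereal_sup_ubound.
exists (proj_nnsfun k mE) => [x /=|].
  rewrite mindicE; case: (boolP (x \in E)) => [|_]; last by rewrite mulr0.
  by rewrite inE mulr1 => Ex; exact: le_trans (kf x) (fg x Ex).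
transitivity (\int[mu]_(x in setT `\` ~` E) (k x)%:E)%E.
  by rewrite setTD setCK (integral_nnsfun _ mE) (mrestrict k mE).
rewrite -[RHS]integralT_nnsfun; apply/esym/ge0_negligible_integral => //.
- exact: measurableC.
- exact/measurable_EFinP.
- by move=> x _; rewrite lee_fin.
Qed.

Lemma integral_le_ae E D1 D2 f g : measurable E -> mu (~` E) = 0%E ->
  (forall x, E x -> (f \_ D1) x <= (g \_ D2) x)%E ->
  (\int[mu]_(x in D1) f x <= \int[mu]_(x in D2) g x)%E.
Proof.
move=> mE E0 fg; rewrite integral_mkcond [leRHS]integral_mkcond.
rewrite integralE [leRHS]integralE; apply: leeB; apply: (@ge0_integralT_le_ae E) => //.
- by move=> x Ex; rewrite !funeposE ge_max !le_max fg// lexx orbT.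
- by move=> x Ex; rewrite !funenegE ge_max !le_max leeN2 fg// lexx orbT.
Qed.

Lemma integral_full_subset E D f : measurable E -> mu (~` E) = 0%E -> E `<=` D ->
  (\int[mu]_(x in D) f x = \int[mu]_(x in E) f x)%E.
Proof.
move=> mE E0 ED; apply/eqP; rewrite eq_le; apply/andP.
by split; apply: (integral_le_ae mE E0) => x Ex; rewrite /patch !mem_set//; exact: ED.
Qed.

End IntegralsOfArbitraryFunctions.

(** * The circle as a Borel set *)

Section BorelMaps.
Context {R : realType}.

Lemma continuous_measurable_borel (T : ptopologicalType) (f : T -> R) : continuous f ->
  measurable_fun (setT : set (borel T)) (f : borel T -> R).
Proof.
move=> cf; apply: (measurability _ (RGenOInfty.measurableE R)) => _ [_ [x ->] <-].
rewrite setTI; apply: sub_sigma_algebra; apply: open_comp => //.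
Qed.

Lemma measurable_inv_real : measurable_fun setT (fun x : R => x^-1).
Proof.
rewrite (_ : setT = [set 0] `|` ~` [set 0]); last by rewrite setUCr.
apply/measurable_funU => //; first exact: measurableC.
split; first exact: measurable_fun_set1.
apply: open_continuous_measurable_fun.
  by rewrite openC; apply: (@accessible_closed_set1 R); exact: hausdorff_accessible.
by move=> x; rewrite inE => /eqP x0; exact: inv_continuous.
Qed.

(** Inverse of [ei] on the open interval ]0, 2 pi[, by the half-angle formula
cot (x / 2) = sin x / (1 - cos x). *)
Definition carg (s : borel R[i]) : R :=
  pi - 2 * atan (Im s * (1 - Re s)^-1).

Lemma measurable_carg : measurable_fun setT carg.
Proof.
have mRe := continuous_measurable_borel (@Re_continuous R).
have mIm := continuous_measurable_borel (@Im_continuous R).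
apply: measurable_funB => //; apply: measurable_funM => //.
apply: (@measurableT_comp _ _ _ _ _ _ (@atan R)).
  by apply: continuous_measurable_fun => x; exact: continuous_atan.
apply: measurable_funM => //.
apply: (@measurableT_comp _ _ _ _ _ _ (fun x : R => x^-1)); first exact: measurable_inv_real.
by apply: measurable_funB.
Qed.

Lemma carg_ei (x : R) : 0 < x < twopi -> carg (ei x) = x.
Proof.
move=> /andP[x0]; rewrite /twopi mulr2n => x1.
have xE : x = 2 * (x / 2) by rewrite mulrC divfK.
have sx : 0 < sin (x / 2) by apply: sin_gt0_pi; apply/andP; split; lra.
rewrite /carg; have -> : Im (ei x) * (1 - Re (ei x))^-1 = tan (pi / 2 - x / 2).
  rewrite /= onemcos_half /tan cosB sinB cos_pihalf sin_pihalf !mul0r !mul1r add0r subr0.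
  have -> : sin x = 2 * (sin (x / 2) * cos (x / 2)).
    by rewrite {1}(splitr x) sinD; ring.
  by field; rewrite gt_eqF.
rewrite tanK; last by rewrite in_itv/=; apply/andP; split; lra.
by lra.
Qed.

Lemma measurable_ei : measurable_fun setT (ei : measurableTypeR R -> borel R[i]).
Proof. exact: measurable_expi. Qed.

Lemma measurable_circle : measurable (@circle R : set (borel R[i])).
Proof.
have -> : (@circle R : set (borel R[i])) = (fun s : borel R[i] => cabs s) @^-1` [set 1] by [].
rewrite -[X in measurable X]setTI.
exact: (continuous_measurable_borel (@cabs_continuous R)).
Qed.

Lemma sigma_eq0 (A : set (borel R[i])) : measurable A ->
  (@lebesgue_measure R).-negligible ((ei : measurableTypeR R -> borel R[i]) @^-1` A `&` `[0, twopi]) ->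
  sigma R A = 0%E.
Proof.
move=> mA [N [mN N0 sub]].
have mB : measurable ((@expi R) @^-1` A `&` `[0, pi *+ 2]).
  apply: measurableI; last exact: measurable_itv.
  by rewrite -[X in measurable X]setTI; exact: measurable_expi.
rewrite /sigma /distribution /pushforward /= /uniform_prob integral_uniform_pdf.
apply: null_set_integral => //.
  by apply/measurable_EFinP; apply: measurable_funTS; exact: measurable_uniform_pdf.
by apply: (subset_measure0 mB mN) => //; exact: sub.
Qed.

Lemma ei_neq1 (x : R) : 0 < x < twopi -> ei x != 1.
Proof.
rewrite /twopi mulr2n => /andP[x0 x1]; apply/negP => /eqP/(congr1 (@Re R)) /= c1.
have := onemcos_half x; rewrite c1 subrr => /esym/eqP.
rewrite mulf_eq0 pnatr_eq0/= sqrf_eq0 gt_eqF//.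
by apply: sin_gt0_pi; apply/andP; split; lra.
Qed.

(** The circle without the point 1 and without the image of N: the points where an
exceptional set of parameters has been removed. *)
Definition arc (N : set (measurableTypeR R)) : set (borel R[i]) :=
  ei @` (`]0, twopi[ `\` N).

Lemma arc_ei N (x : R) : 0 < x < twopi -> ~ N x -> arc N (ei x).
Proof. by move=> x0 Nx; exists x => //; split => //=; rewrite in_itv. Qed.

Lemma arcP N s : arc N s -> exists x : R, [/\ 0 < x < twopi, s = ei x & ~ N x].
Proof. by move=> [x [/=]]; rewrite in_itv/= => x0 Nx <-; exists x. Qed.

Lemma arc_circle N : arc N `<=` @circle R.
Proof. by move=> s /arcP[x [_ -> _]]; exact: cabs_ei. Qed.

Lemma measurable_arc N : measurable N -> measurable (arc N).
Proof.
move=> mN.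
suff -> : arc N = (@circle R) `&` ~` [set (1 : R[i])] `&` carg @^-1` (~` N).
  apply: measurableI.
    apply: measurableI; first exact: measurable_circle.
    apply: sub_sigma_algebra; rewrite /= openC.
    by apply: (@accessible_closed_set1 R[i]); exact: hausdorff_accessible.
  by rewrite -[X in measurable X]setTI; apply: measurable_carg => //; exact: measurableC.
apply/seteqP; split => [s /arcP[x [x0 -> Nx]]|s [[s1 sn1] nN]].
  split; last by rewrite /= carg_ei.
  by split; [exact: cabs_ei|exact/eqP/ei_neq1].
have [x /andP[x0 x1] sE] := circle_ei s1.
have xn0 : x != 0 by apply/negP => /eqP x00; apply: sn1; rewrite sE x00 /= ei0.
have xn1 : x != twopi.
  by apply/negP => /eqP x11; apply: sn1; rewrite sE x11 -[twopi]add0r eiDpi2 ei0.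
have xin : 0 < x < twopi by rewrite !lt_def xn0 x0 eq_sym xn1 x1.
rewrite sE; apply: arc_ei => // Nx; apply: nN.
by rewrite /= sE carg_ei.
Qed.

Lemma sigma_arcC N : measurable N -> lebesgue_measure N = 0%E -> sigma R (~` arc N) = 0%E.
Proof.
move=> mN N0; apply: sigma_eq0; first by apply: measurableC; exact: measurable_arc.
exists (N `|` ([set 0] `|` [set twopi])); split.
- by apply: measurableU => //; apply: measurableU.
- apply: null_set_setU => //; first exact: measurableU.
  by apply: null_set_setU => //; exact: lebesgue_measure_set1.
- move=> x [/= nE]; rewrite in_itv/= => /andP[x0 x1].
  have [x00|x00] := eqVneq x 0; first by right; left.
  have [x11|x11] := eqVneq x twopi; first by right; right.
  left; apply: contrapT => nN; apply: nE; apply: arc_ei => //.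
  by rewrite !lt_def x00 x0 eq_sym x11 x1.
Qed.

End BorelMaps.

(** * Integration over the circle *)

Section SigmaIntegral.
Context {R : realType}.
Implicit Types (N : set (measurableTypeR R)).
Local Notation mu := (@lebesgue_measure R).

Lemma arc_patch_ei N (h : borel R[i] -> \bar R) (x : R) : 0 <= x <= twopi ->
  (h \_ (arc N)) (ei x) = ((h \o ei) \_ (`]0, twopi[ `\` N)) x.
Proof.
move=> /andP[x0 x1]; rewrite /patch.
suff -> : (ei x \in arc N) = (x \in `]0, twopi[ `\` N) by [].
apply/idP/idP => /set_mem H; apply/mem_set; last by exists x.
have [y [y0 e Ny]] := arcP H.
have e1 : ei x != 1 by rewrite e ei_neq1.
have xn0 : x != 0 by apply: contraNneq e1 => ->; rewrite ei0.
have xn1 : x != twopi by apply: contraNneq e1 => ->; rewrite -[twopi]add0r eiDpi2 ei0.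
have xin : 0 < x < twopi by rewrite !lt_def xn0 x0 eq_sym xn1 x1.
split; first by rewrite /= in_itv.
by rewrite -(carg_ei xin) e carg_ei.
Qed.

Lemma ge0_sigma_integral N (h : borel R[i] -> \bar R) : measurable N ->
  measurable_fun (arc N) h -> (forall s, arc N s -> 0 <= h s)%E ->
  (\int[sigma R]_(s in arc N) h s =
    twopi^-1%:E * \int[mu]_(x in `]0%R, twopi[ `\` N) h (ei x))%E.
Proof.
move=> mN mh h0; have mA := measurable_arc mN.
have m1 : measurable_fun setT (h \_ (arc N)).
  by apply/(measurable_restrictT _ mA).
rewrite integral_mkcond ge0_integral_pushforward//; last first.
  by move=> s _; rewrite /patch; case: ifPn => // /set_mem; exact: h0.
rewrite preimage_setT integral_uniform//; last 2 first.
- exact: (measurableT_comp m1 measurable_ei).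
- by move=> x; rewrite /= /patch; case: ifPn => // /set_mem; exact: h0.
rewrite subr0; congr (_ * _)%E.
rewrite (_ : `]0, twopi[ `\` N = `[0, twopi] `&` (`]0, twopi[ `\` N)); last first.
  by rewrite setIDA setIidr//; exact: subset_itv_oo_cc.
rewrite integral_mkcondr; apply: eq_integral => x; rewrite inE/= in_itv/=; exact: arc_patch_ei.
Qed.

(** On the arc, l is w composed with the Borel map [carg]. *)
Lemma measurable_fun_arc N (l : borel R[i] -> R) (w : R -> R) : measurable N ->
  measurable_fun `[0, twopi] w ->
  (forall x, 0 < x < twopi -> ~ N x -> l (ei x) = w x) -> measurable_fun (arc N) l.
Proof.
move=> mN mw lw; have mA := measurable_arc mN.
have m1 : measurable_fun (arc N) (w \o carg).
  apply: (@measurable_comp _ _ _ (borel R[i]) (measurableTypeR R) _ `[0, twopi]) => //.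
    move=> _ [s /arcP[x [x0 -> _]] <-]; rewrite /= in_itv/= carg_ei//.
    by case/andP: x0 => ? ?; rewrite !ltW.
  by apply: measurable_funTS; exact: measurable_carg.
apply: eq_measurable_fun m1 => s; rewrite inE => /arcP[x [x0 -> Nx]].
by rewrite /= carg_ei// lw.
Qed.

Lemma sigma_integral N (l : borel R[i] -> R) (w : R -> R) : measurable N ->
  mu N = 0%E -> itg 0 twopi w ->
  (forall x, 0 < x < twopi -> ~ N x -> l (ei x) = w x) ->
  (sigma R).-integrable (arc N) (EFin \o l) /\
  (\int[sigma R]_(s in arc N) (l s)%:E = (Rint 0 twopi w / twopi)%:E)%E.
Proof.
move=> mN N0 iw lw; have mA := measurable_arc mN.
have ml : measurable_fun (arc N) l.
  apply: (measurable_fun_arc mN _ lw); apply/measurable_EFinP.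
  by have /integrableP[] := iw.
have tp0 : twopi != 0 :> R by rewrite gt_eqF// twopi_gt0.
have mD : @measurable _ (measurableTypeR R) (`]0, twopi[ `\` N).
  by apply: measurableD.
have DI : `]0, twopi[ `\` N `<=` `[0, twopi].
  by move=> x [/= xi _]; exact: subset_itv_oo_cc xi.
have iwD : mu.-integrable (`]0, twopi[ `\` N) (EFin \o w).
  by apply: integrableS iw.
have eD (k : R -> \bar R) : (\int[mu]_(x in `]0%R, twopi[ `\` N) k (l (ei x)) =
    \int[mu]_(x in `]0%R, twopi[ `\` N) k (w x))%E.
  by apply: eq_integral => x; rewrite inE => -[/=]; rewrite in_itv/= => x0 Nx; rewrite lw.
have mEl : measurable_fun (arc N) (EFin \o l) by exact/measurable_EFinP.
split.
  apply/integrableP; split => //.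
  rewrite ge0_sigma_integral//; last exact: measurableT_comp.
  rewrite (eD (fun y => `|y%:E|%E)); apply: lte_mul_pinfty => //.
  - by rewrite lee_fin invr_ge0 ltW// twopi_gt0.
  - by have /integrableP[] := iwD.
rewrite integralE !ge0_sigma_integral//; last 2 first.
- exact: measurable_funeneg.
- exact: measurable_funepos.
under eq_integral do rewrite funeposE /=.
under [X in (_ - _ * X)%E]eq_integral do rewrite funenegE /=.
rewrite (eD (fun y => maxe y%:E 0)) (eD (fun y => maxe (- y%:E) 0)%E).
have -> : (\int[mu]_(x in `]0%R, twopi[ `\` N) maxe (w x)%:E 0 =
  \int[mu]_(x in `]0%R, twopi[ `\` N) ((EFin \o w)^\+ x))%E.
  by apply: eq_integral => x _; rewrite funeposE.
have -> : (\int[mu]_(x in `]0%R, twopi[ `\` N) maxe (- (w x)%:E) 0 =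
  \int[mu]_(x in `]0%R, twopi[ `\` N) ((EFin \o w)^\- x))%E.
  by apply: eq_integral => x _; rewrite funenegE.
have f1 : (\int[mu]_(x in `]0%R, twopi[ `\` N) ((EFin \o w)^\+ x) \is a fin_num)%E.
  by apply: integrable_pos_fin_num.
have f2 : (\int[mu]_(x in `]0%R, twopi[ `\` N) ((EFin \o w)^\- x) \is a fin_num)%E.
  by apply: integrable_neg_fin_num.
rewrite -muleBr//; last by apply: fin_num_adde_defl; rewrite fin_numN.
rewrite -integralE EFinM muleC; congr (_ * _)%E.
rewrite /Rint /Rintegral fineK; last exact: integrable_fin_num.
rewrite (@negligible_integral _ _ _ mu `[0%R, twopi] (N `|` ([set 0%R] `|` [set twopi])))//.
- rewrite setUC -setDDl setUC -setDDl; congr (integral _ (_ `\` _) _).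
  rewrite eqEsubset; split => x /=; rewrite !in_itv/=.
    move=> /andP[x0 x1]; split; first split; first by rewrite !ltW.
      by move=> xE; move: x1; rewrite xE ltxx.
    by move=> xE; move: x0; rewrite xE ltxx.
  move=> [[/andP[x0 x1] /eqP n1] /eqP n0].
  by rewrite !lt_def n0 x0 eq_sym n1 x1.
- by apply: measurableU => //; apply: measurableU.
- apply: null_set_setU => //; first exact: measurableU.
  by apply: null_set_setU => //; exact: lebesgue_measure_set1.
Qed.

End SigmaIntegral.

(** * Borel maps as limits of continuous maps *)

HB.instance Definition _ (T U : ptopologicalType) := Pointed.on (T * U)%type.

Section BorelLimits.
Context {R : realType}.

Lemma measurable_borel_continuous_on (T S : ptopologicalType) (O E : set T)
    (g : T -> S) :
  open O -> E `<=` O -> measurable (E : set (borel T)) ->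
  (forall x, O x -> {for x, continuous g}) ->
  measurable_fun (E : set (borel T)) (g : borel T -> borel S).
Proof.
move=> oO EO mE cg; apply: (@measurability _ _ (borel T) (borel S) E g open) => //=.
move=> _ [U oU <-].
have -> : E `&` g @^-1` U = E `&` (O `&` g @^-1` U).
  by rewrite setIA (setIidl EO).
apply: measurableI => //; apply: sub_sigma_algebra; rewrite /= openE => x [Ox Ux].
apply: filterI; first exact: open_nbhs_nbhs.
exact: (cg x Ox U (open_nbhs_nbhs (conj oU Ux))).
Qed.

Lemma complex_invn_lt (e : R[i]) : 0 < e -> exists m : nat, m.+1%:R^-1 < e.
Proof.
move=> e0; have /complex_realP[d ed] : e \is Num.real by exact: gtr0_real.
have d0 : 0 < d by move: e0; rewrite ed ltcR.
exists (Num.truncn d^-1); rewrite ed.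
have -> : ((Num.truncn d^-1).+1%:R^-1 : R[i]) = ((Num.truncn d^-1).+1%:R^-1)%:C.
  by rewrite fmorphV/= rmorph_nat.
by rewrite ltcR invf_plt ?posrE// Num.Theory.truncnS_gt.
Qed.

(** The set V m of points at distance at least 1 / m, in the sense of B m, from the
complement of U is closed.  The limit lies in U if and only if, for some m, the
sequence is eventually in V m. *)
Lemma measurable_borel_limit d (T : measurableType d) (S : ptopologicalType)
    (B : nat -> S -> set S) (E : set T) (f_ : nat -> T -> S) (f : T -> S) :
  (forall m x, nbhs x (B m x)) ->
  (forall x U, nbhs x U -> exists m, forall y z, B m x y -> B m z y -> U z) ->
  measurable E -> (forall k, measurable_fun E (f_ k : T -> borel S)) ->
  (forall x, E x -> f_ ^~ x @ \oo --> f x) ->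
  measurable_fun E (f : T -> borel S).
Proof.
move=> nB shrink mE mf cf; apply: (@measurability _ _ T (borel S) E f open) => //= _ [U oU <-].
pose V m := ~` \bigcup_(y in ~` U) (B m y)°.
have mV m : measurable (V m : set (borel S)).
  apply: measurableC; apply: sub_sigma_algebra; apply: bigcup_open => y _.
  exact: open_interior.
suff -> : E `&` f @^-1` U = \bigcup_m \bigcup_K \bigcap_(k in [set k | (K <= k)%N])
    (E `&` f_ k @^-1` V m).
  apply: bigcup_measurable => m _; apply: bigcup_measurable => K _.
  by apply: bigcap_measurable; [exists K => /=|move=> k _; exact: mf].
apply/seteqP; split => x.
- move=> [Ex Ux]; have [m sub] := shrink _ _ (open_nbhs_nbhs (conj oU Ux)).
  have [K _ HK] : \forall k \near \oo, B m (f x) (f_ k x) by apply: (cf x Ex); exact: nB.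
  exists m => //; exists K => // k /= /HK kb; split => // -[y nUy /interior_subset yb].
  by apply: nUy; exact: sub kb yb.
- move=> [m _ [K _ HK]]; have [Ex _] := HK K (leqnn K).
  split => //=; apply: contrapT => nU.
  have [K' _ HK'] : \forall k \near \oo, (B m (f x))° (f_ k x).
    apply: (cf x Ex); apply: open_nbhs_nbhs; split; first exact: open_interior.
    by apply: nbhs_singleton; apply: nbhs_interior; exact: nB.
  have [_ /= nV] := HK (maxn K K') (leq_maxl _ _).
  by apply: nV; exists (f x) => //; apply: HK'; exact: leq_maxr.
Qed.

Lemma complex_ball_shrink (S : pseudoMetricType R[i]) (x : S) U : nbhs x U ->
  exists m : nat, forall y z : S, ball x (m.+1%:R^-1 : R[i]) y -> ball z (m.+1%:R^-1 : R[i]) y -> U z.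
Proof.
rewrite -filter_from_ballE => -[e /= e0 sub].
have [m me] := complex_invn_lt (divr_gt0 e0 (ltr0n R[i] 2)).
exists m => y z xy zy; apply: sub.
apply: (@le_ball _ _ x (m.+1%:R^-1 + m.+1%:R^-1)).
  by rewrite (splitr e) lerD// ltW.
by apply: (ball_triangle xy); exact: ball_sym.
Qed.

Lemma cvg_rV n (T : Type) (F : set_system T) (FF : Filter F) (f : T -> 'rV[R[i]]_n)
    (l : 'rV[R[i]]_n) :
  (forall j, f x 0 j @[x --> F] --> l 0 j) -> f x @[x --> F] --> l.
Proof.
move=> h A [P lP sub].
suff H : F [set x | forall i j, P i j (f x i j)].
  apply: (@filterS _ F FF [set x | forall i j, P i j (f x i j)] (f @^-1` A)) H.
  by move=> x Hx; apply: sub.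
apply: filter_forall => i; apply: filter_forall => j.
by have := lP i j; rewrite (ord1 i) => /(h j).
Qed.

Lemma rV_cvg n (T : Type) (F : set_system T) (FF : Filter F) (f : T -> 'rV[R[i]]_n)
    (l : 'rV[R[i]]_n) j :
  f x @[x --> F] --> l -> f x 0 j @[x --> F] --> l 0 j.
Proof.
move=> h A lA; apply: (h [set M | A (M 0 j)]).
exists (fun i k => if k == j then A else setT).
  by move=> i k; rewrite (ord1 i); case: eqP => [->//|_]; exact: filterT.
by move=> M /(_ 0 j); rewrite eqxx.
Qed.

End BorelLimits.

(** * Hardy classes of vector functions *)

Section EuclideanNorm.
Context {R : realType} {n : nat}.
Implicit Types (z w : 'rV[R[i]]_n).

Lemma enorm_ge0 w : 0 <= enorm w.
Proof. exact: sqrtr_ge0. Qed.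

Lemma cabs_le_enorm w j : cabs (w 0 j) <= enorm w.
Proof.
have s0 (A : pred 'I_n) : 0 <= \sum_(k | A k) cabs (w 0 k) ^+ 2.
  by apply: sumr_ge0 => k _; exact: sqr_ge0.
rewrite -[cabs _]ger0_norm ?cabs_ge0// -sqrtr_sqr /enorm ler_sqrt//.
by rewrite (bigD1 j)//= lerDl.
Qed.

Lemma cabs_cdot_le z w : cabs (cdot z w) <= n%:R * (enorm z * enorm w).
Proof.
have hs (s : seq 'I_n) : cabs (\sum_(j <- s) z 0 j * w 0 j) <= \sum_(j <- s) enorm z * enorm w.
  elim: s => [|j s IH]; first by rewrite !big_nil cabs0.
  rewrite !big_cons; apply: le_trans (cabsD _ _) _; apply: lerD => //.
  by rewrite cabsM ler_pM ?cabs_ge0// cabs_le_enorm.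
rewrite /cdot; apply: le_trans (hs (index_enum _)) _.
by rewrite sumr_const card_ord mulr_natl.
Qed.

End EuclideanNorm.

Section HardyComponents.
Context {R : realType}.
Local Notation mu := (@lebesgue_measure R).
Local Notation sg := (sigma R).

Lemma circ_le_sigma (g : R[i] -> R) (X : R[i] -> \bar R) (M : R) : ccont g ->
  (forall s, circle s -> (g s)%:E <= X s)%E ->
  (\int[sg]_(s in @circle R) X s <= M%:E)%E -> circ g <= twopi * M.
Proof.
move=> cg gX XM; have tp0 := @twopi_gt0 R.
have [_] := @sigma_integral R set0 g (fun x => g (ei x)) measurable0 (measure0 _)
  (itc_ccont cg) (fun _ _ _ => erefl).
move=> e; rewrite mulrC -ler_pdivrMr// -lee_fin -e; apply: le_trans XM.
have m0 : @measurable _ (borel R[i]) (arc set0) by exact: measurable_arc.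
apply: (integral_le_ae m0) => [|s As]; first exact: sigma_arcC.
by rewrite /patch !mem_set//; [apply: gX|]; exact: (arc_circle As).
Qed.

Lemma measurable_dil_enorm n (F : R[i] -> 'rV[R[i]]_n) (r q : R) :
  (forall j, dhol (fun z => F z 0 j)) -> 0 <= r < 1 ->
  measurable_fun (arc set0) (fun s : borel R[i] => enorm (F (r%:C * s)) `^ q).
Proof.
move=> dF r01.
apply: (@measurable_fun_arc R set0 _ (fun x => enorm (F (r%:C * ei x)) `^ q)) => //.
apply: (@measurableT_comp _ _ _ _ _ _ (@powR R ^~ q)); first exact: measurable_powR.
apply: (@measurableT_comp _ _ _ _ _ _ (@Num.sqrt R)).
  by apply: continuous_measurable_fun; exact: sqrt_continuous.
apply: measurable_sum => j; apply: measurable_funX.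
have c : ccont (fun z => cabs (F (r%:C * z) 0 j)).
  by apply: ccont_chol_cabs; exact: (@chol_dhol_dil R (fun z => F z 0 j)).
by have /integrableP[/measurable_EFinP] := itc_ccont c.
Qed.

Variable n : nat.
Implicit Types (F f : R[i] -> 'rV[R[i]]_n).

Lemma hardy_dhol p F j : hardy p F -> dhol (fun z => F z 0 j).
Proof. by move=> [hF _] z z1; apply: derivable_cdiff; exact: hF. Qed.

(** |F_j| <= 1 + |F|^p for finite p. *)
Lemma hardy_hardy1 p F j : (1 <= p)%E -> hardy p F -> hardy1 (fun z => F z 0 j).
Proof.
move=> p1 hF; have dF k := hardy_dhol k hF; split; first exact: dF.
have cF r : 0 < r -> r < 1 -> ccont (fun z => cabs (F (r%:C * z) 0 j)).
  move=> r0 r1; apply: ccont_chol_cabs.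
  by apply: (@chol_dhol_dil R (fun z => F z 0 j)) => //; rewrite ltW.
case: hF => _; case: p p1 => [p| |]//; last first.
  move=> _ [M hM]; exists (twopi * M) => r r0 r1; rewrite -circ_cst.
  apply: le_circ; [exact/itc_ccont/cF|exact/itc_ccont/ccont_cst|move=> z z1].
  apply: le_trans (cabs_le_enorm _ _) (hM _ _).
  by rewrite /disc /= cabsM cabsR z1 mulr1 ger0_norm// ltW.
rewrite lee_fin => p1 [M hM]; exists (twopi * M + twopi * 1) => r r0 r1.
have := @circ_le_sigma (fun z => cabs (F (r%:C * z) 0 j) - 1) _ M _ _ (hM r (ltW r0) r1).
rewrite circB ?circ_cst ?lerBlDr; [|exact/itc_ccont/cF|exact/itc_ccont/ccont_cst].
apply; first by apply: ccontB; [exact: cF|exact: ccont_cst].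
move=> s _; rewrite lee_fin lerBlDr; apply: le_trans (cabs_le_enorm _ _) _.
have [h|h] := lerP 1 (enorm (F (r%:C * s))).
  by apply: le_trans (le1r_powR h p1) _; rewrite lerDl.
by apply: le_trans (ltW h) _; rewrite lerDr powR_ge0.
Qed.

Lemma dhol_cdot f F : (forall j, dhol (fun z => f z 0 j)) ->
  (forall j, dhol (fun z => F z 0 j)) -> dhol (fun z => cdot (f z) (F z)).
Proof.
move=> df dF z z1; apply: (@cdiff_sum R _ _ (fun j z => f z 0 j * F z 0 j)) => j.
by apply: cdiffM; [exact: df|exact: dF].
Qed.

Lemma hoelder_conjugate_fin (p : R) : 1 < p ->
  hoelder_conjugate p%:E = (p / (p - 1))%:E.
Proof.
move=> p1; rewrite /hoelder_conjugate/= eqe gt_eqF ?(lt_trans ltr01 p1)//.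
by rewrite -EFinB inver subr_eq0 gt_eqF.
Qed.

(** |z . w| <= n |z| |w|, and Young's inequality for finite p; for infinite p, F is bounded. *)
Lemma hardy_conjugate_cdot p f F : (1 < p)%E -> hardy (hoelder_conjugate p) f ->
  hardy p F -> hardy1 (fun z => cdot (f z) (F z)).
Proof.
move=> p1 hf hF; have df k := hardy_dhol k hf; have dF k := hardy_dhol k hF.
have dg := dhol_cdot df dF; split => //.
have cg (r : R) : 0 < r -> r < 1 -> ccont (fun z => cabs (cdot (f (r%:C * z)) (F (r%:C * z)))).
  move=> r0 r1; apply: ccont_chol_cabs.
  by apply: (@chol_dhol_dil R (fun z => cdot (f z) (F z))) => //; rewrite ltW.
have bound (r c : R) (X : R[i] -> \bar R) M : 0 < r -> r < 1 -> 0 < c ->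
    (\int[sg]_(s in @circle R) X s <= M%:E)%E ->
    (forall s, circle s -> (c^-1 * cabs (cdot (f (r%:C * s)) (F (r%:C * s))))%:E <= X s)%E ->
    mean1 (fun z => cdot (f z) (F z)) r <= c * (twopi * M).
  move=> r0 r1 c0 XM hX; have cgr := cg r r0 r1.
  have := circ_le_sigma (ccontM (@ccont_cst R c^-1) cgr) hX XM.
  by rewrite circZ ?ler_pdivrMl//; exact: itc_ccont.
case: hf => _ hf; case: hF => _ hF; case: p p1 hf hF => [p| |]//; last first.
  rewrite hoelder_conjugatey => _ [M hM] [K hK].
  have d0 : disc (0 : R[i]) by rewrite /disc /mkset cabs0 ltr01.
  have K0 : 0 <= K := le_trans (enorm_ge0 _) (hK 0 d0).
  have c0 : 0 < n%:R * K + 1 by rewrite ltr_pwDr// mulr_ge0.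
  exists ((n%:R * K + 1) * (twopi * M)) => r r0 r1.
  apply: bound (hM r (ltW r0) r1) _ => // s s1; rewrite lee_fin powRr1 ?enorm_ge0//.
  rewrite ler_pdivrMl//; apply: le_trans (cabs_cdot_le _ _) _.
  have h : enorm (F (r%:C * s)) <= K.
    by apply: hK; rewrite /disc /= cabsM cabsR s1 mulr1 ger0_norm// ltW.
  rewrite mulrDl mul1r ler_wpDr ?enorm_ge0// -mulrA ler_wpM2l// mulrC.
  by rewrite ler_wpM2r ?enorm_ge0.
rewrite lte_fin => p1; rewrite hoelder_conjugate_fin// => -[M hM] [K hK].
have p0 : 0 < p := lt_trans ltr01 p1.
have p10 : 0 < p - 1 by rewrite subr_gt0.
set q := p / (p - 1) in hM *.
have q1 : 1 <= q by rewrite ler_pdivlMr// mul1r gerDl lerN10.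
have pq : q^-1 + p^-1 = 1 by rewrite /q invf_div; field; rewrite !gt_eqF.
exists ((n%:R + 1) * (twopi * (M + K))) => r r0 r1.
have r01 : 0 <= r < 1 by rewrite ltW.
apply: (bound r (n%:R + 1) (fun s => (enorm (f (r%:C * s)) `^ q)%:E +
    (enorm (F (r%:C * s)) `^ p)%:E)%E) => //.
- have m0 : @measurable _ (borel R[i]) (arc set0) by exact: measurable_arc.
  have n0 : sg (~` arc set0) = 0%E by apply: sigma_arcC.
  have e X := @integral_full_subset _ _ _ sg (arc set0) (@circle R) X m0 n0 (@arc_circle R set0).
  rewrite e ge0_integralD//.
  + by rewrite EFinD -!e; apply: leeD; [exact: (hM r (ltW r0) r1)|exact: (hK r (ltW r0) r1)].
  + by move=> s _; rewrite lee_fin powR_ge0.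
  + by apply/measurable_EFinP; exact: measurable_dil_enorm.
  + by move=> s _; rewrite lee_fin powR_ge0.
  + by apply/measurable_EFinP; exact: measurable_dil_enorm.
- move=> s s1; rewrite -EFinD lee_fin ler_pdivrMl ?ltr_pwDr//.
  apply: le_trans (cabs_cdot_le _ _) _.
  have h := conjugate_powR (enorm_ge0 (f (r%:C * s))) (enorm_ge0 (F (r%:C * s)))
    (lt_le_trans ltr01 q1) p0 pq.
  rewrite mulrDl mul1r ler_wpDr//; first by rewrite addr_ge0 ?powR_ge0.
  rewrite ler_wpM2l//; apply: le_trans h _; apply: lerD.
    by rewrite ler_pdivrMr ?(lt_le_trans ltr01 q1)// ler_peMr ?powR_ge0.
  by rewrite ler_pdivrMr// ler_peMr ?powR_ge0// ltW.
Qed.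

End HardyComponents.

(** * Boundary values on a full arc *)

Section BoundaryValues.
Context {R : realType}.
Local Notation mu := (@lebesgue_measure R).
Local Notation sg := (sigma R).
Implicit Types (N : set (measurableTypeR R)) (g B : R[i] -> R[i]).

(** The conclusion of [hardy1_boundary] with the null set as a parameter.  It is monotone
in N, so that finitely many functions can share one exceptional set. *)
Definition boundary_off N g := exists u v : R -> R,
  [/\ itg 0 twopi u, itg 0 twopi v,
     forall t, cabs t < 1 ->
       Rint 0 twopi (fun x => poisson_kernel t (ei x) * u x) = twopi * Re (g t) /\
       Rint 0 twopi (fun x => poisson_kernel t (ei x) * v x) = twopi * Im (g t) &
     forall x, 0 < x < twopi -> ~ N x -> g (r%:C * ei x) @[r --> (1 : R)^'-] --> u x +i* v x].

Lemma hardy1_boundary_off g : hardy1 g -> exists N, [/\ measurable N, mu N = 0%E & boundary_off N g].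
Proof.
move=> /hardy1_boundary[u [v [iu iv Puv [N [mN N0 sub]]]]].
exists N; split => //; exists u, v; split => // x x01 Nx.
by apply: contrapT => h; apply: Nx; apply: sub => /= /(_ x01).
Qed.

Lemma boundary_off_sub N N' g : N `<=` N' -> boundary_off N g -> boundary_off N' g.
Proof.
move=> NN' [u [v [iu iv Puv h]]]; exists u, v; split => // x x01 N'x.
by apply: h => // /NN'.
Qed.

Lemma boundary_off_sigma N g B t : measurable N -> mu N = 0%E -> boundary_off N g ->
  (forall s, arc N s -> g (r%:C * s) @[r --> (1 : R)^'-] --> B s) -> cabs t < 1 ->
  [/\ sg.-integrable (arc N) (fun s => (poisson_kernel t s * Re (B s))%:E),
    (\int[sg]_(s in arc N) (poisson_kernel t s * Re (B s))%:E =
      (Re (g t))%:E)%E &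
    (\int[sg]_(s in arc N) (poisson_kernel t s * Im (B s))%:E =
      (Im (g t))%:E)%E].
Proof.
move=> mN N0 [u [v [iu iv Puv h]]] gB t1; have [Pu Pv] := Puv t t1.
have ck := continuous_poisson_kernel_ei t1.
have tp0 : twopi != 0 :> R by rewrite gt_eqF// twopi_gt0.
have Buv x : 0 < x < twopi -> ~ N x -> B (ei x) = u x +i* v x.
  move=> x01 Nx; apply: (@cvg_unique _ (@norm_hausdorff _ _) _ _ _ _ _ (h x x01 Nx)).
  exact: gB (arc_ei x01 Nx).
have ik w : itg 0 twopi w -> itg 0 twopi (fun x => poisson_kernel t (ei x) * w x).
  by move=> iw; apply: (itg_mul_bounded ck) => // x _; exact: poisson_kernel_bound.
have [i1 e1] := @sigma_integral R N (fun s => poisson_kernel t s * Re (B s)) _ mN N0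
  (ik _ iu) (fun x x01 Nx => congr1 (fun z => _ * Re z) (Buv x x01 Nx)).
have [i2 e2] := @sigma_integral R N (fun s => poisson_kernel t s * Im (B s)) _ mN N0
  (ik _ iv) (fun x x01 Nx => congr1 (fun z => _ * Im z) (Buv x x01 Nx)).
split => //; first by rewrite e1 Pu mulrC mulKf.
by rewrite e2 Pv mulrC mulKf.
Qed.

Lemma disc_radius_at_left : @disc_radius R n @[n --> \oo] --> (1 : R)^'-.
Proof.
move=> A; rewrite /at_left /within /= => /nbhs_ballP[e /= e0 he].
have [K hK] : exists K, 1 - e / 2 <= @disc_radius R K by apply: disc_radius_ge; lra.
exists K => // k /= Kk; have /andP[r0 r1] := @disc_radius_bounds R k.
apply: he => //; rewrite /ball /= ger0_norm; last by rewrite subr_ge0 ltW.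
have := @disc_radius_le R _ _ Kk; lra.
Qed.

Variable n : nat.
Implicit Types (F : R[i] -> 'rV[R[i]]_n).

Lemma bdryE F s (l : 'rV[R[i]]_n) : F (x%:C * s) @[x --> (1 : R)^'-] --> l -> bdry F s = l.
Proof. by move=> h; apply: cvg_lim => //; exact: norm_hausdorff. Qed.

Lemma boundary_off_bdry N F : (forall j, boundary_off N (fun z => F z 0 j)) ->
  forall s, arc N s -> F (x%:C * s) @[x --> (1 : R)^'-] --> bdry F s.
Proof.
move=> hF s /arcP[x [x01 -> Nx]].
pose l : 'rV[R[i]]_n := \row_j lim ((fun y : R => F (y%:C * ei x) 0 j) @ (1 : R)^'-).
suff h : F (y%:C * ei x) @[y --> (1 : R)^'-] --> l by rewrite (bdryE h).
apply: cvg_rV => j; rewrite mxE; have [u [v [_ _ _ H]]] := hF j.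
by apply/cvg_ex; exists (u x +i* v x); exact: H.
Qed.

(** The maps s |-> (s, F (r s)) are continuous near the circle for r < 1, and converge to
s |-> (s, b s) on the arc. *)
Lemma measurable_family_boundary (phi : R[i] -> 'rV[R[i]]_n -> \bar R) N F (b : R[i] -> 'rV[R[i]]_n) :
  measurable_convex_family phi -> (forall j, dhol (fun z => F z 0 j)) -> measurable N ->
  (forall s, arc N s -> F (x%:C * s) @[x --> (1 : R)^'-] --> b s) ->
  measurable_fun (arc N) (fun s => phi s (b s)).
Proof.
move=> [mphi _ _] dF mN FB; have mA := measurable_arc mN.
suff m : measurable_fun (arc N)
    ((fun s => (s, b s)) : borel R[i] -> borel (R[i] * 'rV[R[i]]_n)%type).
  apply: (@measurable_comp _ _ _ (borel R[i]) (borel (R[i] * 'rV[R[i]]_n)%type) _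
    (@circle R `*` [set: 'rV[R[i]]_n]) (fun x => phi x.1 x.2) _ (fun s => (s, b s))) => //.
    have -> : @circle R `*` [set: 'rV[R[i]]_n] =
        (fun x : R[i] * 'rV[R[i]]_n => cabs x.1) @^-1` [set 1].
      by apply/seteqP; split => [[s w] []|[s w]].
    rewrite -[X in measurable X]setTI.
    suff H : measurable_fun setT
        ((fun x => cabs x.1) : borel (R[i] * 'rV[R[i]]_n)%type -> R) by exact: H.
    apply: (@continuous_measurable_borel R (R[i] * 'rV[R[i]]_n)%type (fun x => cabs x.1)).
    move=> x; apply: (@continuous_comp _ _ _ fst (@cabs R)); first exact: cvg_fst.
    exact: cabs_continuous.
  by move=> _ [s As <-]; split => //; exact: (arc_circle As).
apply: (@measurable_borel_limit _ (borel R[i]) (R[i] * 'rV[R[i]]_n)%type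
  (fun m x => ball x (m.+1%:R^-1 : R[i])) (arc N)
  (fun k s => (s, F ((disc_radius k)%:C * s)))) => //.
- by move=> m x; apply: nbhsx_ballx; rewrite invr_gt0 ltr0n.
- by move=> x U; exact: (@complex_ball_shrink R (R[i] * 'rV[R[i]]_n)%type).
- move=> k; have /andP[r0 r1] := @disc_radius_bounds R k.
apply: (@measurable_borel_continuous_on R[i] (R[i] * 'rV[R[i]]_n)%type
  [set s | cabs s < (disc_radius k)^-1]) => //.
  + rewrite openE => s /= s1; apply/nbhscP; exists ((disc_radius k)^-1 - cabs s).
      by rewrite subr_gt0.
  by move=> w sw; have := cabsD s (w - s); rewrite addrC subrK cabsB -/(cabs _) /= => h; lra.
  + by move=> s /arc_circle /= s1; rewrite s1 invf_gt1.
  + move=> s /= s1.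
    have c1 : F ((disc_radius k)%:C * z) @[z --> s] --> F ((disc_radius k)%:C * s); last first.
      exact: (@cvg_pair _ _ _ (nbhs s) (nbhs s) (nbhs (F ((disc_radius k)%:C * s))) _ _ _
        (fun s => s) (fun s => F ((disc_radius k)%:C * s)) (@contc_id R s) c1).
    apply: cvg_rV => j; apply: (@cdiff_continuous R (fun z => F ((disc_radius k)%:C * z) 0 j)).
  apply: (@cdiff_comp R (fun z => F z 0 j) (fun z => (disc_radius k)%:C * z)).
      exact: cdiff_scale.
  by apply: dF; rewrite cabsM cabsR gtr0_norm// -ltr_pdivlMl// mulr1.
- move=> s As.
  have c1 : F ((disc_radius k)%:C * s) @[k --> \oo] --> b s.
    exact: (cvg_comp _ _ disc_radius_at_left (FB s As)).
  exact: (@cvg_pair _ _ _ \oo (nbhs s) (nbhs (b s)) _ _ _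
    (fun=> s) (fun k => F ((disc_radius k)%:C * s)) (@cvgc_cst R _ \oo _ s) c1).
Qed.

End BoundaryValues.

(** * Equality in the midpoint inequality *)

Section MidpointIntegrals.
Context d (T : measurableType d) (R : realType) (mu : {measure set T -> \bar R}).
Implicit Types (E : set T) (f a b m : T -> \bar R).

Lemma integrable_bounded_below E f (A : R) : measurable E -> (mu E < +oo)%E ->
  measurable_fun E f -> 0 <= A -> (forall x, E x -> (- A)%:E <= f x)%E ->
  (\int[mu]_(x in E) f x < +oo)%E -> mu.-integrable E f.
Proof.
move=> mE Eoo mf A0 fA; rewrite integralE => foo.
have fn : (\int[mu]_(x in E) f^\- x < +oo)%E.
  apply: (@le_lt_trans _ _ (\int[mu]_(x in E) A%:E)%E).
    apply: ge0_le_integral => //; first exact: measurable_funeneg.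
    by move=> x Ex; rewrite funenegE ge_max lee_fin A0 andbT leeNl fA.
  by rewrite integral_cst// lte_mul_pinfty// lee_fin.
have fn0 : (0 <= \int[mu]_(x in E) f^\- x)%E by apply: integral_ge0.
have fp : (\int[mu]_(x in E) f^\+ x < +oo)%E.
  rewrite ltey; apply: contraTN foo => /eqP ->.
  by move: fn fn0; case: (X in (_ - X)%E) => // r _ _.
apply/integrableP; split => //.
rewrite (eq_integral (fun x => f^\+ x + f^\- x)%E); last first.
  by move=> x _; have := congr1 (fun h => h x) (fune_abse f).
rewrite ge0_integralD//; last 2 first.
- exact: measurable_funepos.
- exact: measurable_funeneg.
exact: lte_add_pinfty.
Qed.

(** The difference of the two sides of the midpoint inequality is nonnegative with
nonpositive integral.  The values may be infinite, and the difference is taken off the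
null set Z where one of them is. *)
Lemma midpoint_eq_ae E a b m (A : R) : measurable E -> (mu E < +oo)%E ->
  mu.-integrable E a -> mu.-integrable E b -> measurable_fun E m -> 0 <= A ->
  (forall x, E x -> (- A)%:E <= m x)%E ->
  (forall x, E x -> m x <= 2^-1%:E * (a x + b x))%E ->
  mu.-integrable E m /\
  ((2^-1%:E * (\int[mu]_(x in E) a x + \int[mu]_(x in E) b x) <= \int[mu]_(x in E) m x)%E ->
   {ae mu, forall x, E x -> [/\ a x \is a fin_num, b x \is a fin_num &
     ~ (m x < 2^-1%:E * (a x + b x))%E]}).
Proof.
move=> mE Eoo ia ib mm A0 Am mab.
have iab : mu.-integrable E (fun x => a x + b x)%E by exact: integrableD.
have ic : mu.-integrable E (fun x => 2^-1%:E * (a x + b x))%E by exact: integrableZl.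
have ec : (\int[mu]_(x in E) (2^-1%:E * (a x + b x)) =
    2^-1%:E * (\int[mu]_(x in E) a x + \int[mu]_(x in E) b x))%E.
  by rewrite integralZl// integralD.
have im : mu.-integrable E m.
  apply: (integrable_bounded_below mE Eoo mm A0 Am).
  apply: (@le_lt_trans _ _ (\int[mu]_(x in E) (2^-1%:E * (a x + b x)))%E).
    apply: (@integral_le_ae _ _ _ mu setT) => //; first by rewrite setCT measure0.
    by move=> x _; rewrite /patch; case: ifPn => // /set_mem; exact: mab.
  by have := integrable_fin_num mE ic; rewrite fin_numElt => /andP[].
split => // le_m.
have icm : mu.-integrable E (fun x => 2^-1%:E * (a x + b x) - m x)%E by exact: integrableB.
have [Za [mZa Za0 sa]] := integrable_ae mE ia.
have [Zb [mZb Zb0 sb]] := integrable_ae mE ib.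
have [Zm [mZm Zm0 sm]] := integrable_ae mE im.
pose Z := Za `|` (Zb `|` Zm).
have mZ : measurable Z by do 2 apply: measurableU => //.
have Z0 : mu Z = 0%E.
  by apply: null_set_setU => //; [exact: measurableU|exact: null_set_setU].
have Zfin x : E x -> ~ Z x -> [/\ a x \is a fin_num, b x \is a fin_num & m x \is a fin_num].
  move=> Ex nZ; split; apply: contrapT => h; apply: nZ.
  - by left; apply: sa => /= /(_ Ex).
  - by right; left; apply: sb => /= /(_ Ex).
  - by right; right; apply: sm => /= /(_ Ex).
have mEZ : measurable (E `\` Z) by exact: measurableD.
have i0 : (\int[mu]_(x in E `\` Z) `|2^-1%:E * (a x + b x) - m x| = 0)%E.
  rewrite (eq_integral (fun x => 2^-1%:E * (a x + b x) - m x)%E); last first.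
    move=> x; rewrite inE => -[Ex nZ]; rewrite gee0_abs//.
    have [_ _ fm] := Zfin x Ex nZ.
    by rewrite sube_ge0 ?mab// fm.
  apply/eqP; rewrite eq_le; apply/andP; split; last first.
    apply: integral_ge0 => x [Ex nZ]; have [_ _ fm] := Zfin x Ex nZ.
    by rewrite sube_ge0 ?mab// fm.
  rewrite -negligible_integral// integralB// ec sube_le0//.
have mf : measurable_fun (E `\` Z) (fun x => 2^-1%:E * (a x + b x) - m x)%E.
  by apply: measurable_funS (measurable_int _ icm) => //; exact: subDsetl.
have [Z' [mZ' Z'0 s']] := (ae_eq_integral_abs mu mEZ mf).1 i0.
exists (Z `|` Z'); split; first exact: measurableU.
  exact: null_set_setU.
move=> x /= h; apply: contrapT => /not_orP[nZ nZ'].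
apply: h => Ex; have [fa fb fm] := Zfin x Ex nZ; split => //.
have : (2^-1%:E * (a x + b x) - m x = 0)%E.
  by apply: contrapT => h; apply: nZ'; apply: s' => /= H; apply: h; exact: H.
move: fa fb fm => /fineK <- /fineK <- /fineK <-.
by rewrite -EFinD -EFinM lte_fin => -[e]; lra.
Qed.

End MidpointIntegrals.

(** * Extremal functions *)

Section Extremals.
Context {R : realType} {n : nat}.
Local Notation mu := (@lebesgue_measure R).
Local Notation sg := (sigma R).
Implicit Types (N : set (measurableTypeR R)) (F G f : R[i] -> 'rV[R[i]]_n).
Implicit Types (p : \bar R) (t s : R[i]).

Lemma boundary_off_family F : (forall j, hardy1 (fun z => F z 0 j)) ->
  exists N, [/\ measurable N, mu N = 0%E & forall j, boundary_off N (fun z => F z 0 j)].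
Proof.
move=> hF.
suff H m : exists N, [/\ measurable N, mu N = 0%E &
    forall j : 'I_n, (j < m)%N -> boundary_off N (fun z => F z 0 j)].
  by have [N [mN N0 fN]] := H n; exists N; split => // j; exact: fN.
elim: m => [|m [N [mN N0 H]]]; first by exists set0; split.
have [mn|mn] := ltnP m n; last first.
  by exists N; split => // j jm; apply: H; apply: leq_trans (ltn_ord j) mn.
have [N' [mN' N'0 H']] := hardy1_boundary_off (hF (Ordinal mn)).
exists (N `|` N'); split; [exact: measurableU|exact: null_set_setU|].
move=> j; rewrite ltnS leq_eqVlt => /orP[/eqP jm|jm].
  apply: (@boundary_off_sub R N'); first exact: subsetUr.
  by rewrite (_ : j = Ordinal mn)//; apply/val_inj.
by apply: (@boundary_off_sub R N); [exact: subsetUl|exact: H].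
Qed.

Lemma cvg_cdot (T : Type) (S : set_system T) (FS : Filter S) (f F : T -> 'rV[R[i]]_n)
    (a b : 'rV[R[i]]_n) :
  f x @[x --> S] --> a -> F x @[x --> S] --> b -> cdot (f x) (F x) @[x --> S] --> cdot a b.
Proof.
move=> fa Fb; rewrite /cdot; apply: (@cvgc_sum R T S FS 'I_n (index_enum _) (fun j x => f x 0 j * F x 0 j)
  (fun j => a 0 j * b 0 j)) => j.
exact: (@cvgcM R T S FS (fun x => f x 0 j) (fun x => F x 0 j) (a 0 j) (b 0 j)
  (@rV_cvg R n T S FS f a j fa) (@rV_cvg R n T S FS F b j Fb)).
Qed.

Lemma poisson_arc N h t : measurable N -> mu N = 0%E ->
  poisson h t = (\int[sg]_(s in arc N) ((poisson_kernel t s)%:E * h s))%E.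
Proof.
move=> mN N0; rewrite /poisson; apply: (@integral_full_subset _ _ _ sg (arc N)).
- exact: measurable_arc.
- exact: sigma_arcC.
- exact: arc_circle.
Qed.

Lemma cdotDr (z w1 w2 : 'rV[R[i]]_n) : cdot z (w1 + w2) = cdot z w1 + cdot z w2.
Proof. by rewrite /cdot -big_split /=; apply: eq_bigr => j _; rewrite mxE mulrDr. Qed.

Lemma cdotZr (z w : 'rV[R[i]]_n) c : cdot z (c *: w) = c * cdot z w.
Proof. by rewrite /cdot mulr_sumr; apply: eq_bigr => j _; rewrite mxE mulrCA. Qed.

Lemma Re_half (z : R[i]) : Re (2^-1 * z) = 2^-1 * Re z.
Proof.
have -> : (2^-1 : R[i]) = (2^-1)%:C by rewrite fmorphV/= rmorph_nat.
by case: z => x y /=; rewrite mul0r subr0.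
Qed.

Lemma hoelder_conjugate_ge1 p : (1 < p)%E -> (1 <= hoelder_conjugate p)%E.
Proof.
case: p => [p| |]//; rewrite lte_fin => p1; rewrite hoelder_conjugate_fin// lee_fin.
by rewrite ler_pdivlMr ?subr_gt0// mul1r gerDl lerN10.
Qed.

(** The products f . F and f . G have the same value at t, namely f(t) . w, and the mean of
their boundary values is f . (F + G) / 2. *)
Lemma phi_tilde_le p phi F G N t : (1 < p)%E ->
  (forall s w, circle s -> (-oo < phi s w)%E) ->
  hardy p F -> hardy p G -> disc t -> F t = G t ->
  measurable N -> mu N = 0%E ->
  (forall j, boundary_off N (fun z => F z 0 j)) -> (forall j, boundary_off N (fun z => G z 0 j)) ->
  let m := fun s => ((poisson_kernel t s)%:E * phi s (2^-1 *: (bdry F s + bdry G s))%R)%E in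
  sg.-integrable (arc N) m ->
  (phi_tilde p phi t (F t) <= \int[sg]_(s in arc N) m s)%E.
Proof.
move=> p1 phioo hF hG t1 FG mN N0 fF fG m im; apply: ge_ereal_sup => _ [f hf <-].
have q1 := hoelder_conjugate_ge1 p1.
have [N1 [mN1 N10 ff]] := boundary_off_family (fun j => hardy_hardy1 j q1 hf).
have [N2 [mN2 N20 fg1]] := hardy1_boundary_off (hardy_conjugate_cdot p1 hf hF).
have [N3 [mN3 N30 fg2]] := hardy1_boundary_off (hardy_conjugate_cdot p1 hf hG).
pose M := N `|` (N1 `|` (N2 `|` N3)).
have mM : measurable M by do 3 apply: measurableU => //.
have M0 : mu M = 0%E.
  apply: null_set_setU => //; first by do 2 apply: measurableU => //.
  apply: null_set_setU => //; first by apply: measurableU => //.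
  exact: null_set_setU.
have MN : N `<=` M by apply: subsetUl.
have MN1 : N1 `<=` M by move=> x; right; left.
have MN2 : N2 `<=` M by move=> x; right; right; left.
have MN3 : N3 `<=` M by move=> x; right; right; right.
have lF := boundary_off_bdry (fun j => boundary_off_sub MN (fF j)).
have lG := boundary_off_bdry (fun j => boundary_off_sub MN (fG j)).
have lf := boundary_off_bdry (fun j => boundary_off_sub MN1 (ff j)).
have [i1 e1 _] := @boundary_off_sigma R M _ (fun s => cdot (bdry f s) (bdry F s)) t mM M0
  (boundary_off_sub MN2 fg1) (fun s As => cvg_cdot _ (lf s As) (lF s As)) t1.
have [i2 e2 _] := @boundary_off_sigma R M _ (fun s => cdot (bdry f s) (bdry G s)) t mM M0
  (boundary_off_sub MN3 fg2) (fun s As => cvg_cdot _ (lf s As) (lG s As)) t1.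
have mA : @measurable _ (borel R[i]) (arc M) by exact: measurable_arc.
have mA' : @measurable _ (borel R[i]) (arc N) by exact: measurable_arc.
have sub : arc M `<=` arc N.
  by move=> s /arcP[x [x01 -> Mx]]; apply: arc_ei => // /MN.
have imM : sg.-integrable (arc M) m by exact: integrableS sub im.
have eI : (\int[sg]_(s in arc N) m s = \int[sg]_(s in arc M) m s)%E.
  by rewrite -!poisson_arc.
have iL := integrableZl mA 2^-1 (integrableD mA i1 i2).
have key : ((Re (cdot (f t) (F t)))%:E - \int[sg]_(s in arc M) m s <=
    poisson (fun s => legendre phi s (bdry f s)) t)%E.
  have -> : (Re (cdot (f t) (F t)))%:E = (\int[sg]_(s in arc M) (2^-1%:E *
     ((poisson_kernel t s * Re (cdot (bdry f s) (bdry F s)))%:E +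
      (poisson_kernel t s * Re (cdot (bdry f s) (bdry G s)))%:E)))%E.
    rewrite integralZl//; last exact: integrableD.
    rewrite integralD// e1 e2 -FG -EFinD -EFinM; congr EFin; lra.
  rewrite -integralB//.
  rewrite (poisson_arc _ _ mM M0).
  apply: (@integral_le_ae _ _ _ sg (arc M)) => //; first exact: sigma_arcC.
  move=> s As; rewrite /patch !mem_set//.
  (* Fenchel's inequality at the point H *)
  set H := 2^-1 *: (bdry F s + bdry G s).
  have leg : ((Re (cdot (bdry f s) H))%:E - phi s H <= legendre phi s (bdry f s))%E.
    by apply: ereal_sup_ubound; exists H.
  have k0 : 0 <= poisson_kernel t s by apply: poisson_kernel_ge0.
  apply: le_trans (lee_wpmul2l _ leg); last by rewrite lee_fin.
  rewrite muleBr//.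
  rewrite /m -/H cdotZr cdotDr Re_half raddfD /= -EFinD -EFinM.
  by rewrite le_eqVlt; apply/orP; left; apply/eqP; congr (_%:E - _)%E; ring.
move: key; rewrite eI; set y := (\int[sg]_(s in arc M) m s)%E.
have : y \is a fin_num by exact: integrable_fin_num.
case: y => // y _; case: (poisson _ t) => [P| |]//=.
  by rewrite -!EFinB !lee_fin; lra.
by rewrite leNye.
Qed.

End Extremals.

Section Uniqueness.
Context {R : realType} {n : nat}.
Local Notation mu := (@lebesgue_measure R).
Local Notation sg := (sigma R).
Implicit Types (N : set (measurableTypeR R)) (F G f : R[i] -> 'rV[R[i]]_n).
Implicit Types (p : \bar R) (t s : R[i]).

Lemma poisson_kernel_bounds t : cabs t < 1 -> exists c C : R, [/\ 0 < c, 0 <= C &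
  forall s, circle s -> c <= poisson_kernel t s <= C].
Proof.
move=> t1; exists ((1 - cabs t ^+ 2) / 4), (2 / (1 - cabs t)).
have c0 : 0 < 1 - cabs t ^+ 2 by rewrite subr_gt0 expr_lt1 ?cabs_ge0.
split; first by rewrite divr_gt0.
  by rewrite divr_ge0// subr_ge0 ltW.
move=> s s1; have [x _ ->] := circle_ei s1.
apply/andP; split.
  have d0 : 0 < cabs (ei x - t).
    rewrite cabs_gt0 subr_eq0; apply: contraTneq t1 => <-.
    by rewrite cabs_ei ltxx.
  rewrite /poisson_kernel ler_wpM2l ?(ltW c0)// lef_pV2 ?posrE ?exprn_gt0//.
  have := cabsD (ei x) (- t); rewrite cabsN cabs_ei => h.
  have -> : 4 = 2 ^+ 2 :> R by rewrite expr2; ring.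
  by rewrite ler_sqr ?nnegrE ?(ltW d0)//; lra.
by apply: le_trans (poisson_kernel_bound x t1); exact: ler_norm.
Qed.

Lemma growth_lower_bound p (phi : R[i] -> 'rV[R[i]]_n -> \bar R) : uniform_growth p phi ->
  exists2 A : R, 0 <= A & forall s w, circle s -> ((- A)%:E <= phi s w)%E.
Proof.
move=> [c [C [A [c0 C0 A0 H]]]]; exists A; first exact: ltW.
move=> s w s1; case: p H => [p| |]//.
  move=> /(_ s w s1) /andP[h _]; apply: le_trans h; rewrite lee_fin lerDr.
  by rewrite mulr_ge0 ?powR_ge0// ltW.
move=> [/(_ s w s1) /andP[h _] _]; apply: le_trans h.
by rewrite EFinN leeDr// /chi; case: ifP => //.
Qed.

Lemma measurable_poisson_kernel N t : measurable N -> cabs t < 1 ->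
  measurable_fun (arc N) (poisson_kernel t : borel R[i] -> R).
Proof.
move=> mN t1; apply: (measurable_fun_arc mN (w := fun x => poisson_kernel t (ei x))) => //.
by apply: measurable_funTS; apply: continuous_measurable_fun; exact: continuous_poisson_kernel_ei.
Qed.

Lemma sigma_arc_finite N : measurable N -> (sg (arc N) < +oo)%E.
Proof.
by move=> mN; apply: (le_lt_trans (probability_le1 _ _)); [exact: measurable_arc|rewrite ltry].
Qed.

(** Finiteness of phi~ at t0 makes phi_s(F(s)) integrable against the Poisson kernel at
t0, and the kernels at two points of the disc are comparable on the circle. *)
Lemma extremal_integrable p (phi : R[i] -> 'rV[R[i]]_n -> \bar R) F N t0 t w0 (A : R) :
  0 <= A -> (forall s w, circle s -> ((- A)%:E <= phi s w)%E) ->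
  extremal p phi t0 w0 F -> disc t0 -> (phi_tilde p phi t0 w0 < +oo)%E ->
  measurable N -> mu N = 0%E ->
  measurable_fun (arc N) ((fun s => phi s (bdry F s)) : borel R[i] -> \bar R) -> disc t ->
  sg.-integrable (arc N) (fun s => (poisson_kernel t s)%:E * phi s (bdry F s))%E.
Proof.
move=> A0 phiA [_ F0 ext] t01 foo mN N0 mphi t1; have mA := measurable_arc mN.
have mk t' : disc t' -> measurable_fun (arc N)
    (fun s : borel R[i] => (poisson_kernel t' s)%:E * phi s (bdry F s))%E.
  move=> t'1; apply: emeasurable_funM => //; apply/measurable_EFinP.
  exact: measurable_poisson_kernel.
have [c [C [c0 C0 hk]]] := poisson_kernel_bounds t01.
have [c' [C' [c'0 C'0 hk']]] := poisson_kernel_bounds t1.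
have i0 : sg.-integrable (arc N) (fun s => (poisson_kernel t0 s)%:E * phi s (bdry F s))%E.
  apply: (@integrable_bounded_below _ _ _ sg _ _ (C * A)) => //.
  - exact: sigma_arc_finite.
  - exact: mk.
  - exact: mulr_ge0.
  - move=> s /arc_circle s1; have /andP[k1 k2] := hk s s1.
    have k0 : 0 <= poisson_kernel t0 s by apply: le_trans k1; exact: ltW.
    apply: (@le_trans _ _ ((poisson_kernel t0 s)%:E * (- A)%:E)%E).
      by rewrite -EFinM lee_fin mulrN lerN2 ler_wpM2r.
    by apply: lee_wpmul2l (phiA _ _ s1); rewrite lee_fin.
  - by rewrite -poisson_arc// -ext// F0.
apply: (le_integrable mA (mk t t1) _ (integrableZl mA (C' / c) i0)).
move=> s /arc_circle s1; have /andP[k1 k2] := hk s s1; have /andP[k'1 k'2] := hk' s s1.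
have k0 : 0 < poisson_kernel t0 s := lt_le_trans c0 k1.
have k'0 : 0 < poisson_kernel t s := lt_le_trans c'0 k'1.
rewrite muleA !abseM; apply: lee_wpmul2r => //.
have cc : 0 < C' / c by rewrite divr_gt0// (lt_le_trans k'0 k'2).
rewrite !abse_EFin -EFinM lee_fin (gtr0_norm k'0) (gtr0_norm cc) (gtr0_norm k0).
apply: (le_trans k'2); rewrite -mulrA ler_peMr// ler_pdivlMl ?mulr1//.
Qed.

Lemma convex_ext_midpoint (psi : 'rV[R[i]]_n -> \bar R) : convex_ext psi ->
  forall z w, (-oo < psi z)%E -> (-oo < psi w)%E ->
  (psi (2^-1 *: (z + w))%R <= 2^-1%:E * (psi z + psi w))%E.
Proof.
move=> cpsi z w z0 w0.
have h1 : (2^-1 : R) < 1 by rewrite invf_lt1 ?ltr1n.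
have h0 : 0 < (2^-1 : R) by rewrite invr_gt0.
have := cpsi z w 2^-1 h0 h1.
have -> : 1 - 2^-1 = 2^-1 :> R by lra.
have -> : (2^-1 : R)%:C = 2^-1 by rewrite fmorphV/= rmorph_nat.
by rewrite -scalerDr muleDr//; exact: ltninfty_adde_def.
Qed.

Lemma pos_mule_fin_num (k : R) (a : \bar R) : 0 < k -> (k%:E * a)%E \is a fin_num ->
  a \is a fin_num.
Proof. by move=> k0; case: a => //; rewrite ?gt0_muley ?gt0_muleNy. Qed.

(** For almost every s, phi_s at the midpoint of the two boundary values is the average
of its values at them, and strict convexity makes the boundary values equal. *)
Lemma extremal_eq_of_meet p (phi : R[i] -> 'rV[R[i]]_n -> \bar R) t t0 t1 w0 w1 F G :
  (1 < p)%E -> measurable_convex_family phi -> uniform_growth p phi ->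
  (forall s, circle s -> strictly_convex_ext (phi s)) ->
  disc t -> disc t0 -> disc t1 ->
  (phi_tilde p phi t0 w0 < +oo)%E -> (phi_tilde p phi t1 w1 < +oo)%E ->
  extremal p phi t0 w0 F -> extremal p phi t1 w1 G -> F t = G t ->
  forall x, disc x -> F x = G x.
Proof.
move=> p1 fam growth strict td t0d t1d fin0 fin1 extF extG FG x xd.
have [A A0 phiA] := growth_lower_bound growth.
have [_ phioo convex] := fam.
have [hF _ eF] := extF; have [hG _ eG] := extG.
have [N1 [mN1 N10 fF]] := boundary_off_family (fun j => hardy_hardy1 j (ltW p1) hF).
have [N2 [mN2 N20 fG]] := boundary_off_family (fun j => hardy_hardy1 j (ltW p1) hG).
pose N := N1 `|` N2.
have mN : measurable N by exact: measurableU.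
have N0 : mu N = 0%E by exact: null_set_setU.
have {}fF j := boundary_off_sub (@subsetUl _ N1 N2) (fF j).
have {}fG j := boundary_off_sub (@subsetUr _ N1 N2) (fG j).
have lF := boundary_off_bdry fF; have lG := boundary_off_bdry fG.
have mA : @measurable _ (borel R[i]) (arc N) by exact: measurable_arc.
have nA : sg (~` arc N) = 0%E by exact: sigma_arcC.
have dF j := hardy_dhol j hF; have dG j := hardy_dhol j hG.
have mF := measurable_family_boundary fam dF mN lF.
have mG := measurable_family_boundary fam dG mN lG.
have dH j : dhol (fun z => (2^-1 *: (F z + G z)) 0 j).
  have e : (fun z => (2^-1 *: (F z + G z)) 0 j) = (fun z => 2^-1 * (F z 0 j + G z 0 j)).
    by apply/funext => z; rewrite !mxE.
  rewrite e => z z1; apply: cdiffM; first exact: cdiff_cst.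
  by apply: cdiffD; [exact: dF|exact: dG].
have lH s : arc N s -> (2^-1 *: (F (y%:C * s) + G (y%:C * s))) @[y --> (1 : R)^'-] -->
    2^-1 *: (bdry F s + bdry G s).
  move=> As; apply: cvg_rV => j; rewrite !mxE.
  have e : (fun y : R => (2^-1 *: (F (y%:C * s) + G (y%:C * s))) 0 j) =
      (fun y => 2^-1 * (F (y%:C * s) 0 j + G (y%:C * s) 0 j)).
    by apply/funext => y; rewrite !mxE.
  rewrite e.
  have h1 : F (y%:C * s) 0 j @[y --> (1 : R)^'-] --> bdry F s 0 j by exact: rV_cvg (lF s As).
  have h2 : G (y%:C * s) 0 j @[y --> (1 : R)^'-] --> bdry G s 0 j by exact: rV_cvg (lG s As).
  apply: (@cvgcM R R _ _ (fun=> 2^-1) (fun y => F (y%:C * s) 0 j + G (y%:C * s) 0 j)).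
    exact: cvgc_cst.
  exact: (@cvgcD R R _ _ (fun y => F (y%:C * s) 0 j) (fun y => G (y%:C * s) 0 j) _ _ h1 h2).
have mH := measurable_family_boundary fam dH mN lH.
have [c [C [c0 C0 hk]]] := poisson_kernel_bounds td.
have kpos s : circle s -> 0 < poisson_kernel t s.
  by move=> /hk /andP[k1 _]; exact: lt_le_trans k1.
have iF := extremal_integrable A0 phiA extF t0d fin0 mN N0 mF td.
have iG := extremal_integrable A0 phiA extG t1d fin1 mN N0 mG td.
have mkH : measurable_fun (arc N)
    (fun s : borel R[i] => (poisson_kernel t s)%:E * phi s (2^-1 *: (bdry F s + bdry G s))%R)%E.
  apply: emeasurable_funM => //; apply/measurable_EFinP.
  exact: measurable_poisson_kernel.
have mid_ge s : arc N s -> ((- (C * A))%:E <=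
    (poisson_kernel t s)%:E * phi s (2^-1 *: (bdry F s + bdry G s))%R)%E.
  move=> /arc_circle s1; have /andP[k1 k2] := hk s s1; have k0 := kpos s s1.
  apply: (@le_trans _ _ ((poisson_kernel t s)%:E * (- A)%:E)%E).
    by rewrite -EFinM lee_fin mulrN lerN2 ler_wpM2r.
  by apply: lee_wpmul2l (phiA _ _ s1); rewrite lee_fin ltW.
have half s : circle s -> (2^-1%:E * ((poisson_kernel t s)%:E * phi s (bdry F s) +
    (poisson_kernel t s)%:E * phi s (bdry G s)) =
    (poisson_kernel t s)%:E * (2^-1%:E * (phi s (bdry F s) + phi s (bdry G s))))%E.
  by move=> s1; rewrite -muleDr ?(muleCA 2^-1%:E)//; apply: ltninfty_adde_def; rewrite inE; exact: phioo.
have mid_le s : arc N s ->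
    ((poisson_kernel t s)%:E * phi s (2^-1 *: (bdry F s + bdry G s))%R <=
     2^-1%:E * ((poisson_kernel t s)%:E * phi s (bdry F s) +
       (poisson_kernel t s)%:E * phi s (bdry G s)))%E.
  move=> /arc_circle s1; rewrite half//; apply: lee_wpmul2l; first by rewrite lee_fin ltW ?kpos.
  by apply: (convex_ext_midpoint (convex s s1)); exact: phioo.
have [im] := midpoint_eq_ae mA (sigma_arc_finite mN) iF iG mkH (mulr_ge0 C0 A0) mid_ge mid_le.
have PF : (\int[sg]_(s in arc N) ((poisson_kernel t s)%:E * phi s (bdry F s)) =
    phi_tilde p phi t (F t))%E by rewrite eF// (poisson_arc _ _ mN N0).
have PG : (\int[sg]_(s in arc N) ((poisson_kernel t s)%:E * phi s (bdry G s)) =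
    phi_tilde p phi t (F t))%E by rewrite FG eG// (poisson_arc _ _ mN N0).
have le_mid := phi_tilde_le p1 phioo hF hG td FG mN N0 fF fG im.
have fin : (phi_tilde p phi t (F t) \is a fin_num)%E.
  by rewrite -PF; exact: integrable_fin_num.
rewrite PF PG => /(_ _)[].
  apply: le_trans le_mid; move: fin => /fineK <-.
  by rewrite -EFinD -EFinM lee_fin; lra.
move=> Z [mZ Z0 sub].
(* off Z the midpoint inequality is an equality between finite numbers *)
have bFG s : arc N s -> ~ Z s -> bdry F s = bdry G s.
  move=> As nZ; apply: contrapT => /eqP neq; apply: nZ; apply: sub => /= /(_ As)[fa fb].
  apply.
  have s1 := arc_circle As; have k0 := kpos s s1.
  rewrite half// lte_pmul2l ?lte_fin//; apply: (strict s s1) => //.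
  - exact: (pos_mule_fin_num k0 fa).
  - exact: (pos_mule_fin_num k0 fb).
pose E := arc N `\` Z.
have mE : @measurable _ (borel R[i]) E by exact: measurableD.
have nE : sg (~` E) = 0%E.
  rewrite /E setDE setCI setCK; apply: null_set_setU => //; exact: measurableC.
have same (h h' : R[i] -> R) : (forall s, E s -> h s = h' s) ->
    (\int[sg]_(s in arc N) (h s)%:E = \int[sg]_(s in arc N) (h' s)%:E)%E.
  move=> hh; apply/eqP; rewrite eq_le; apply/andP.
  by split; apply: (integral_le_ae mE nE) => s Es; rewrite /patch; case: ifP => // _; rewrite hh.
apply/rowP => j.
have [_ r1 i1] := @boundary_off_sigma R N _ (fun s => bdry F s 0 j) x mN N0 (fF j)
  (fun s As => rV_cvg _ (lF s As)) xd.
have [_ r2 i2] := @boundary_off_sigma R N _ (fun s => bdry G s 0 j) x mN N0 (fG j)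
  (fun s As => rV_cvg _ (lG s As)) xd.
apply/eqP; rewrite eq_complex; apply/andP; split; apply/eqP/EFin_inj.
- by rewrite -r1 -r2; apply: same => s [As nZ]; rewrite bFG.
- by rewrite -i1 -i2; apply: same => s [As nZ]; rewrite bFG.
Qed.

End Uniqueness.

Local Close Scope complex_scope.

Theorem proposition2 (R : realType) (n : nat) (p : \bar R)
    (phi : R[i] -> 'rV[R[i]]_n -> \bar R)
    (n_ge1 : (1 <= n)%N) (p_gt1 : (1 < p)%E)
    (phi_family : measurable_convex_family phi)
    (phi_growth : uniform_growth p phi)
    (phi_strict : forall s : R[i], circle s -> strictly_convex_ext (phi s)) :
  (forall (t0 : R[i]) (w0 : 'rV[R[i]]_n),
      disc t0 -> (phi_tilde p phi t0 w0 < +oo)%E ->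
      forall F G : R[i] -> 'rV[R[i]]_n,
        extremal p phi t0 w0 F -> extremal p phi t0 w0 G ->
        forall x : R[i], disc x -> F x = G x)
  /\
  (forall (t t0 t1 : R[i]) (w0 w1 : 'rV[R[i]]_n),
      disc t -> disc t0 -> disc t1 ->
      (phi_tilde p phi t0 w0 < +oo)%E -> (phi_tilde p phi t1 w1 < +oo)%E ->
      forall F0 F1 : R[i] -> 'rV[R[i]]_n,
        extremal p phi t0 w0 F0 -> extremal p phi t1 w1 F1 ->
        F0 t = F1 t ->
        forall x : R[i], disc x -> F0 x = F1 x).
Proof.
split=> [t0 w0 t0_disc fin F G extF extG|
    t t0 t1 w0 w1 t_disc t0_disc t1_disc fin0 fin1 F0 F1 ext0 ext1 F01].
  apply: (@extremal_eq_of_meet R n p phi t0 t0 t0 w0 w0 F G) => //.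
  by have [_ -> _] := extF; have [_ -> _] := extG.
exact: (@extremal_eq_of_meet R n p phi t t0 t1 w0 w1 F0 F1).
Qed.
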